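(* Let $G$ be a finite group and $k\ge 1$ with $|G|=k+1$. Then the near-group fusion rule $(G,k)$ admits a monoidal structure (i.e. there exists a near-group category with fusion rule $(G,k)$) if and only if $G$ is isomorphic to the multiplicative group $\mathbb{F}_q^{*}$ of a finite field $\mathbb{F}_q$, $q=p^\alpha$ a prime power; equivalently, if and only if $G$ is cyclic of order $p^\alpha-1$ for some prime $p$ and integer $\alpha\ge1$.
   Context: Standing conventions. The ground ring $R$ is an algebraically closed field whose characteristic does not divide $|G|$ (nor, for the existence direction, $q(q-1)$). A near-group category with fusion rule $(G,k)$ is an $R$-linear semisimple monoidal category with duality: finite-dimensional hom-spaces; finitely many isomorphism classes of simple objects $s_i$ with $\mathrm{hom}(s_i,s_j)\cong R$ if $i=j$ and $0$ otherwise, every object a finite direct sum of simples; a bilinear tensor product with unit object $\epsilon$ and natural associativity isomorphisms satisfying the pentagon axiom; every object $x$ has a dual $x^*$ with evaluation $x^*\otimes x\to\epsilon$ and coevaluation $\epsilon\to x\otimes x^*$ satisfying the zig-zag identities. The simple objects are the invertible ones, forming a group isomorphic to $G$ under $\otimes$, and exactly one non-invertible simple $m$, with $g\otimes m\cong m\otimes g\cong m$ for $g\in G$ and $m\otimes m\cong\bigoplus_{g\in G}g\oplus k\cdot m$. *)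

(* Defs.v *)
From HB Require Import structures.
From mathcomp Require Import all_boot all_order all_algebra all_fingroup.
Set Implicit Arguments.
Unset Strict Implicit.
Unset Printing Implicit Defensive.
Import GRing.Theory.
Local Open Scope ring_scope.

Record catData (R : fieldType) : Type := CatData {
  Ob   : Type;
  Hom  : Ob -> Ob -> vectType R;
  idm  : forall x, Hom x x;
  cmp  : forall x y z, Hom y z -> Hom x y -> Hom x z;
  tob  : Ob -> Ob -> Ob;
  tm   : forall x x' y y', Hom x x' -> Hom y y' -> Hom (tob x y) (tob x' y');
  one  : Ob;
  aso  : forall x y z, Hom (tob (tob x y) z) (tob x (tob y z));
  asoV : forall x y z, Hom (tob x (tob y z)) (tob (tob x y) z);
  lu   : forall x, Hom (tob one x) x;
  luV  : forall x, Hom x (tob one x);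
  ru   : forall x, Hom (tob x one) x;
  ruV  : forall x, Hom x (tob x one);
  dl   : Ob -> Ob;
  ev   : forall x, Hom (tob (dl x) x) one;
  coev : forall x, Hom one (tob x (dl x))
}.

Arguments Ob {R}.
Arguments Hom {R} c.
Arguments idm {R c}.
Arguments cmp {R c x y z}.
Arguments tob {R c}.
Arguments tm {R c x x' y y'}.
Arguments one {R c}.
Arguments aso {R c}.
Arguments asoV {R c}.
Arguments lu {R c}.
Arguments luV {R c}.
Arguments ru {R c}.
Arguments ruV {R c}.
Arguments dl {R c}.
Arguments ev {R c}.
Arguments coev {R c}.

Section CatLaws.
Variables (R : fieldType) (C : catData R).
Local Notation Ob := (Ob C).
Local Notation Hom := (Hom C).

Definition is_category : Prop :=
  [/\ forall (x y : Ob) (f : Hom x y), cmp f (idm x) = f,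
      forall (x y : Ob) (f : Hom x y), cmp (idm y) f = f
    & forall (w x y z : Ob) (f : Hom w x) (g : Hom x y) (h : Hom y z),
        cmp h (cmp g f) = cmp (cmp h g) f].

Definition cmp_bilinear : Prop :=
  (forall (x y z : Ob) (a : R) (g g' : Hom y z) (f : Hom x y),
      cmp (a *: g + g') f = a *: cmp g f + cmp g' f) /\
  (forall (x y z : Ob) (a : R) (g : Hom y z) (f f' : Hom x y),
      cmp g (a *: f + f') = a *: cmp g f + cmp g f').

Definition tensor_bifunctor : Prop :=
  [/\ forall x y : Ob, tm (idm x) (idm y) = idm (tob x y),
      forall (x x' x'' y y' y'' : Ob) (f : Hom x x') (f' : Hom x' x'')
             (g : Hom y y') (g' : Hom y' y''),
        tm (cmp f' f) (cmp g' g) = cmp (tm f' g') (tm f g),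
      forall (x x' y y' : Ob) (a : R) (f f' : Hom x x') (g : Hom y y'),
        tm (a *: f + f') g = a *: tm f g + tm f' g
    & forall (x x' y y' : Ob) (a : R) (f : Hom x x') (g g' : Hom y y'),
        tm f (a *: g + g') = a *: tm f g + tm f g'].

Definition associator_ok : Prop :=
  [/\ forall x y z : Ob, cmp (aso x y z) (asoV x y z) = idm _,
      forall x y z : Ob, cmp (asoV x y z) (aso x y z) = idm _,
      forall (x x' y y' z z' : Ob) (f : Hom x x') (g : Hom y y') (h : Hom z z'),
        cmp (aso x' y' z') (tm (tm f g) h) = cmp (tm f (tm g h)) (aso x y z)
    & forall w x y z : Ob,
        cmp (aso w x (tob y z)) (aso (tob w x) y z) =
        cmp (tm (idm w) (aso x y z))
            (cmp (aso w (tob x y) z) (tm (aso w x y) (idm z)))].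

Definition unitors_ok : Prop :=
  [/\ forall x : Ob, cmp (lu x) (luV x) = idm _ /\ cmp (luV x) (lu x) = idm _,
      forall x : Ob, cmp (ru x) (ruV x) = idm _ /\ cmp (ruV x) (ru x) = idm _,
      forall (x x' : Ob) (f : Hom x x'), cmp (lu x') (tm (idm one) f) = cmp f (lu x),
      forall (x x' : Ob) (f : Hom x x'), cmp (ru x') (tm f (idm one)) = cmp f (ru x)
    & forall x y : Ob,
        cmp (tm (idm x) (lu y)) (aso x one y) = tm (ru x) (idm y)].

Definition rigid : Prop :=
  forall x : Ob,
    cmp (ru x) (cmp (tm (idm x) (ev x))
      (cmp (aso x (dl x) x) (cmp (tm (coev x) (idm x)) (luV x)))) = idm x /\
    cmp (lu (dl x)) (cmp (tm (ev x) (idm (dl x)))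
      (cmp (asoV (dl x) x (dl x)) (cmp (tm (idm (dl x)) (coev x)) (ruV (dl x)))))
      = idm (dl x).

Definition iso (x y : Ob) : Prop :=
  exists (f : Hom x y) (g : Hom y x), cmp f g = idm y /\ cmp g f = idm x.

Definition is_dsum (x : Ob) (n : nat) (o : 'I_n -> Ob) : Prop :=
  exists (i : forall j, Hom (o j) x) (p : forall j, Hom x (o j)),
    [/\ forall j, cmp (p j) (i j) = idm (o j),
        forall j j', j != j' -> cmp (p j) (i j') = 0
      & \sum_j cmp (i j) (p j) = idm x].

End CatLaws.

(* Index of the k.+? summands of m (x) m = (+)_{g in G} g (+) k.m :
   the first #|G| indices run through the elements of G, the last k are m. *)
Definition mm_index (gT : finGroupType) (k : nat) (j : 'I_(#|gT| + k))
  : option gT :=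
  if (j < #|gT|)%N then Some (nth 1%g (enum gT) j) else None.

(* A near-group category with fusion rule (G, k) over R.  The simple objects
   are listed by s : option G -> Ob, with s (Some g) the invertible simple
   object corresponding to g in G and s None the non-invertible simple m. *)
Record NearGroupCategory (R : fieldType) (gT : finGroupType) (k : nat)
  : Type := NGC {
  ngc_data : catData R;
  ngc_cat : is_category ngc_data;
  ngc_cmp_bilinear : cmp_bilinear ngc_data;
  ngc_tensor : tensor_bifunctor ngc_data;
  ngc_assoc : associator_ok ngc_data;
  ngc_unit : unitors_ok ngc_data;
  ngc_rigid : rigid ngc_data;
  ngc_simple : option gT -> Ob ngc_data;
  ngc_simple_end : forall i, \dim {: Hom ngc_data (ngc_simple i) (ngc_simple i)} = 1%N;
  ngc_simple_hom : forall i j, i != j ->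
      \dim {: Hom ngc_data (ngc_simple i) (ngc_simple j)} = 0%N;
  ngc_semisimple : forall x : Ob ngc_data,
      exists (n : nat) (o : 'I_n -> option gT),
        is_dsum x (fun j => ngc_simple (o j));
  ngc_unit_obj : iso one (ngc_simple (Some 1%g));
  ngc_fus_gg : forall g h : gT,
      iso (tob (ngc_simple (Some g)) (ngc_simple (Some h))) (ngc_simple (Some (g * h)%g));
  ngc_fus_gm : forall g : gT,
      iso (tob (ngc_simple (Some g)) (ngc_simple None)) (ngc_simple None);
  ngc_fus_mg : forall g : gT,
      iso (tob (ngc_simple None) (ngc_simple (Some g))) (ngc_simple None);
  ngc_fus_mm : is_dsum (tob (ngc_simple None) (ngc_simple None))
      (fun j => ngc_simple (@mm_index gT k j))
}.

Definition is_Fq_star (gT : finGroupType) : Prop :=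
  exists F : finFieldType, ([set: gT] \isog [set: {unit F}])%g.

(* Main.v *)
(* Let [m] be the non-invertible simple object.  The group G acts on the
   k-dimensional space Hom(m, m m) in three commuting ways, by inserting an
   invertible object and its inverse before, between or after the two factors,
   and these three actions L, M, N are conjugate.  Decomposing Hom(m, m m m)
   along (m m) m and along m (m m) shows that M plus the trivial representation
   has the multiplicities of the regular one: the commutant of M then has
   dimension at most k = |G| - 1 and is spanned by the [L g], and also by the
   [N g], which commute with them; so G is abelian, and M is the sum of the
   nontrivial characters of G, once each.  On joint eigenvectors L and N
   are given by functions sigma, tau on the dual group A of G, and comparing the
   two decompositions again makes them satisfy the relation that
   [x |-> 1 - x] satisfies in a field with multiplicative group A.  Hence A and
   this map generate a sharply doubly transitive group of permutations of A plus
   a zero; its Frobenius kernel is elementary abelian and A embeds in the units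
   of a field, so that A, and therefore G, is cyclic of order p^a - 1.

   Conversely, for G isomorphic to F^*, take the representations of F^* graded by
   F equivariantly, with the tensor product adding degrees: the invertible
   objects are the characters of F^* in degree 0 and [m] is the regular
   representation in nonzero degrees. *)

Require Import Defs.
From HB Require Import structures.
From mathcomp Require Import all_boot all_order all_algebra all_fingroup all_solvable.
From mathcomp Require Import all_field all_character zify.
Set Implicit Arguments.
Unset Strict Implicit.
Unset Printing Implicit Defensive.
Import GRing.Theory Defs.
Local Open Scope ring_scope.
#[local] Obligation Tactic := idtac.

(** The isomorphisms [g m -> m], [m g -> m] and [g h -> gh] are unique only up to scalars, so a
    priori the gap actions are projective and commute only up to scalars. Two facts remove this
    ambiguity: the middle action can be normalised on the unit summand of [m m], and a commutation
    scalar [a] satisfies both [a ^+ k = 1] (determinants) and [a ^+ k.+1 = 1] (orders of group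
    elements), where [|G| = k + 1] enters. Until the diagonalisation, the ground field is arbitrary
    and dimensions of spaces of intertwiners replace characters. In the two expansions of Hom(m, m m
    m), inserting [g] in the first inner gap fixes the invertible summands of one and translates
    those of the other; this is what compares M with the regular representation. Inserting [g] in
    front fixes the invertible summands of the second, so a joint eigenvector on which this
    insertion acts nontrivially has no component there and can be compared entry by entry. In the
    field to be reconstructed sigma is [x |-> 1 - x^-1] and tau is [y |-> (1 - y)^-1]; two of its
    points escape the relation and are recovered by injectivity. *)

Definition has_dual_basis (R : fieldType) (U : lmodType R) (I : finType) (b : I -> U) : Prop :=
  exists beta : I -> U -> R, [/\ forall i, linear (beta i : U -> R^o),
    forall u, u = \sum_i beta i u *: b i
  & forall i j, beta i (b j) = (i == j)%:R].

(* What is left of a near-group category once the coherence isomorphisms have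
   been eliminated: [U] is Hom(m, m m m), [e] and [f] are its bases adapted to
   (m m) m and m (m m), and [A0], [A1], [A2] are the actions of [gT] by inserting
   invertible objects in the first three gaps.  On Hom(m, m m) the gap actions
   have the matrices [L], [M] and [N]. *)
Record gap_data (R : fieldType) (gT : finGroupType) (k : nat) := GapData {
  gU : vectType R;
  gL : gT -> 'M[R]_k;
  gM : gT -> 'M[R]_k;
  gN : gT -> 'M[R]_k;
  gQ : 'M[R]_k;
  ge : gT + 'I_k * 'I_k -> gU;
  gf : gT + 'I_k * 'I_k -> gU;
  gA0 : gT -> gU -> gU;
  gA1 : gT -> gU -> gU;
  gA2 : gT -> gU -> gU;
  gM1 : gM 1%g = 1%:M;
  gMM : forall g h, gM g *m gM h = gM (g * h)%g;
  gLMC : forall g h, gL g *m gM h = gM h *m gL g;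
  gNMC : forall g h, gN g *m gM h = gM h *m gN g;
  gLNC : forall g h, gL g *m gN h = gN h *m gL g;
  gQ_unit : gQ \in unitmx;
  gMQ : forall g, gM g *m gQ = gQ *m gL g;
  gNQ : forall g, gN g *m gQ = gQ *m gM g;
  ge_basis : has_dual_basis ge;
  gf_basis : has_dual_basis gf;
  gA0_lin : forall g, linear (gA0 g);
  gA1_lin : forall g, linear (gA1 g);
  gA2_lin : forall g, linear (gA2 g);
  gA1_1 : forall u, gA1 1%g u = u;
  gA1_M : forall g h u, gA1 g (gA1 h u) = gA1 (g * h)%g u;
  gA0_e : forall g i j, gA0 g (ge (inr (i, j))) =
    \sum_h gL g h i *: \sum_l gL g l j *: ge (inr (h, l));
  gA0_f : forall g i j, gA0 g (gf (inr (i, j))) = \sum_l gL g l j *: gf (inr (i, l));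
  gA0_f1 : forall g h, gA0 g (gf (inl h)) = gf (inl h);
  gA1_e : forall g i j, gA1 g (ge (inr (i, j))) = \sum_h gM g h i *: ge (inr (h, j));
  gA1_e1 : forall g h, gA1 g (ge (inl h)) = ge (inl h);
  gA1_f : forall g i j, gA1 g (gf (inr (i, j))) =
    \sum_h gL g h i *: \sum_l gM g l j *: gf (inr (h, l));
  gA1_f1 : forall g h, exists2 y, y != 0 & gA1 g (gf (inl h)) = y *: gf (inl (g * h)%g);
  gA2_e : forall g i j, gA2 g (ge (inr (i, j))) =
    \sum_h gN g h i *: \sum_l gM g l j *: ge (inr (h, l));
  gA2_f : forall g i j, gA2 g (gf (inr (i, j))) = \sum_h gM g h i *: gf (inr (h, j))
}.

(** * Words of objects as strictly composing module functors *)

Section Strict.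
Variables (R : fieldType) (C : catData R).
Hypotheses (Ccat : is_category C) (Cbil : cmp_bilinear C)
  (Cten : tensor_bifunctor C) (Cass : associator_ok C) (Cuni : unitors_ok C).
Local Notation Ob := (Ob C).
Local Notation Hom := (Hom C).
Local Notation "f \c g" := (cmp f g) (at level 45, left associativity).
Local Notation "x *> f" := (tm (idm x) f) (at level 40, left associativity).
Local Notation "f <* x" := (tm f (idm x)) (at level 40, left associativity).

Lemma cmp1r (x y : Ob) (f : Hom x y) : f \c idm x = f.
Proof. by case: Ccat => *. Qed.
Lemma cmp1l (x y : Ob) (f : Hom x y) : idm y \c f = f.
Proof. by case: Ccat => *. Qed.
Lemma cmpA (w x y z : Ob) (f : Hom w x) (g : Hom x y) (h : Hom y z) :
  h \c (g \c f) = h \c g \c f.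
Proof. by case: Ccat => *. Qed.

Lemma cmp_is_linear (x y z : Ob) (g : Hom y z) : linear (@cmp R C x y z g).
Proof. by case: Cbil => _ E a f f'; apply: E. Qed.
Lemma cmpr_is_linear (x y z : Ob) (f : Hom x y) : linear (fun g : Hom y z => g \c f).
Proof. by case: Cbil => E _ a g g'; apply: E. Qed.
Lemma tmr_is_linear (x x' y y' : Ob) (f : Hom x x') : linear (@tm R C x x' y y' f).
Proof. by case: Cten => _ _ _ E a g g'; apply: E. Qed.
Lemma tml_is_linear (x x' y y' : Ob) (g : Hom y y') :
  linear (fun f : Hom x x' => tm f g).
Proof. by case: Cten => _ _ E _ a f f'; apply: E. Qed.

Section LinFun.
Variables (U V : lmodType R) (f : U -> V).
Hypothesis lf : linear f.
Let F : {linear U -> V} := HB.pack f (GRing.isLinear.Build R U V _ f lf).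
Lemma linfZ a u : f (a *: u) = a *: f u. Proof. exact: (linearZZ F). Qed.
Lemma linf0 : f 0 = 0. Proof. exact: (linear0 F). Qed.
Lemma linfD u v : f (u + v) = f u + f v. Proof. exact: (linearD F). Qed.
Lemma linf_sum I (r : seq I) (P : pred I) (E : I -> U) :
  f (\sum_(i <- r | P i) E i) = \sum_(i <- r | P i) f (E i).
Proof. exact: (linear_sum F). Qed.
End LinFun.

Lemma cmpZr x y z (a : R) (g : Hom y z) (f : Hom x y) : g \c (a *: f) = a *: (g \c f).
Proof. exact: (linfZ (cmp_is_linear g)). Qed.
Lemma cmpZl x y z (a : R) (g : Hom y z) (f : Hom x y) : (a *: g) \c f = a *: (g \c f).
Proof. exact: (linfZ (cmpr_is_linear f)). Qed.
Lemma cmp0r x y z (g : Hom y z) : g \c (0 : Hom x y) = 0.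
Proof. exact: (linf0 (cmp_is_linear g)). Qed.
Lemma cmp0l x y z (f : Hom x y) : (0 : Hom y z) \c f = 0.
Proof. exact: (linf0 (cmpr_is_linear f)). Qed.
Lemma cmpDr x y z (g : Hom y z) (f f' : Hom x y) : g \c (f + f') = g \c f + g \c f'.
Proof. exact: (linfD (cmp_is_linear g)). Qed.
Lemma cmpDl x y z (g g' : Hom y z) (f : Hom x y) : (g + g') \c f = g \c f + g' \c f.
Proof. exact: (linfD (cmpr_is_linear f)). Qed.
Lemma cmp_sumr x y z (I : Type) (r : seq I) (P : pred I) (g : Hom y z) (F : I -> Hom x y) :
  g \c (\sum_(i <- r | P i) F i) = \sum_(i <- r | P i) (g \c F i).
Proof. exact: (linf_sum (cmp_is_linear g)). Qed.
Lemma cmp_suml x y z (I : Type) (r : seq I) (P : pred I) (F : I -> Hom y z) (f : Hom x y) :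
  (\sum_(i <- r | P i) F i) \c f = \sum_(i <- r | P i) (F i \c f).
Proof. exact: (linf_sum (cmpr_is_linear f)). Qed.
Lemma tmZr x x' y y' (a : R) (f : Hom x x') (g : Hom y y') : tm f (a *: g) = a *: tm f g.
Proof. exact: (linfZ (tmr_is_linear f)). Qed.
Lemma tm0r x x' y y' (f : Hom x x') : tm f (0 : Hom y y') = 0.
Proof. exact: (linf0 (tmr_is_linear f)). Qed.
Lemma tm_sumr x x' y y' (I : Type) (r : seq I) (P : pred I) (f : Hom x x') (F : I -> Hom y y') :
  tm f (\sum_(i <- r | P i) F i) = \sum_(i <- r | P i) tm f (F i).
Proof. exact: (linf_sum (tmr_is_linear f)). Qed.
Lemma tmZl x x' y y' (a : R) (f : Hom x x') (g : Hom y y') : tm (a *: f) g = a *: tm f g.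
Proof. exact: (linfZ (tml_is_linear g)). Qed.
Lemma tm0l x x' y y' (g : Hom y y') : tm (0 : Hom x x') g = 0.
Proof. exact: (linf0 (tml_is_linear g)). Qed.
Lemma tm_suml x x' y y' (I : Type) (r : seq I) (P : pred I) (F : I -> Hom x x') (g : Hom y y') :
  tm (\sum_(i <- r | P i) F i) g = \sum_(i <- r | P i) tm (F i) g.
Proof. exact: (linf_sum (tml_is_linear g)). Qed.

Lemma tm11 (x y : Ob) : tm (idm x) (idm y) = idm (tob x y).
Proof. by case: Cten. Qed.
Lemma tmM (x x' x'' y y' y'' : Ob) (f : Hom x x') (f' : Hom x' x'')
    (g : Hom y y') (g' : Hom y' y'') : tm (f' \c f) (g' \c g) = tm f' g' \c tm f g.
Proof. by case: Cten. Qed.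
Lemma lwM (x : Ob) y y' y'' (g : Hom y y') (g' : Hom y' y'') :
  x *> (g' \c g) = (x *> g') \c (x *> g).
Proof. by rewrite -tmM cmp1l. Qed.
Lemma rwM (y : Ob) x x' x'' (f : Hom x x') (f' : Hom x' x'') :
  (f' \c f) <* y = (f' <* y) \c (f <* y).
Proof. by rewrite -tmM cmp1l. Qed.
Lemma interchange x x' y y' (f : Hom x x') (g : Hom y y') :
  (f <* y') \c (x *> g) = (x' *> g) \c (f <* y).
Proof. by rewrite -!tmM !cmp1l !cmp1r. Qed.

Lemma asoK (x y z : Ob) : aso x y z \c asoV x y z = idm _. Proof. by case: Cass. Qed.
Lemma asoVK (x y z : Ob) : asoV x y z \c aso x y z = idm _. Proof. by case: Cass. Qed.
Lemma aso_nat (x x' y y' z z' : Ob) (f : Hom x x') (g : Hom y y') (h : Hom z z') :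
  aso x' y' z' \c tm (tm f g) h = tm f (tm g h) \c aso x y z.
Proof. by case: Cass. Qed.
Lemma pentagon (w x y z : Ob) :
  aso w x (tob y z) \c aso (tob w x) y z =
  (w *> aso x y z) \c (aso w (tob x y) z \c (aso w x y <* z)).
Proof. by case: Cass. Qed.
Lemma asoV_nat (x x' y y' z z' : Ob) (f : Hom x x') (g : Hom y y') (h : Hom z z') :
  tm (tm f g) h \c asoV x y z = asoV x' y' z' \c tm f (tm g h).
Proof.
rewrite -[LHS]cmp1l -asoVK -!cmpA; congr (_ \c _).
by rewrite cmpA aso_nat -cmpA asoK cmp1r.
Qed.

Lemma pentagonV (x y T S : Ob) :
  aso (tob x y) T S \c (asoV x y T <* S) =
  asoV x y (tob T S) \c ((x *> aso y T S) \c aso x (tob y T) S).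
Proof.
have E : (aso x y T <* S) \c (asoV x y T <* S) = idm _ by rewrite -rwM asoK tm11.
rewrite -[LHS]cmp1l -asoVK -!cmpA [aso x _ _ \c _]cmpA pentagon.
by rewrite -!cmpA E cmp1r.
Qed.

(* A (right module) endofunctor of [C], in practice a composite of functors
   [tob x]: words of objects compose strictly, and no associator is written. *)
Record mfun := MFun {
  fob :> Ob -> Ob;
  fmp : forall x y, Hom x y -> Hom (fob x) (fob y);
  fcan : forall T S, Hom (tob (fob T) S) (fob (tob T S)) }.

Record is_mfun (F : mfun) : Prop := IsMFun {
  fmp1 : forall x, fmp F (idm x) = idm (F x);
  fmpM : forall x y z (f : Hom x y) (g : Hom y z), fmp F (g \c f) = fmp F g \c fmp F f;
  fcanV : forall T S, exists g, fcan F T S \c g = idm _ }.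

Definition cF (F G : mfun) : mfun :=
  @MFun (fun T => F (G T)) (fun _ _ f => fmp F (fmp G f))
    (fun T S => fmp F (fcan G T S) \c fcan F (G T) S).
Definition tF (x : Ob) : mfun :=
  @MFun (tob x) (fun _ _ f => x *> f) (fun T S => aso x T S).

Lemma tF_is_mfun x : is_mfun (tF x).
Proof.
split=> /=.
- by move=> y; rewrite tm11.
- by move=> *; rewrite lwM.
- by move=> T S; exists (asoV x T S); rewrite asoK.
Qed.

(** The field [nmod], compatibility with tensoring on the right, is what makes a transformation
    determined by its component at [one]. *)
Record nt (F G : mfun) := NT {
  nfam :> forall T, Hom (F T) (G T);
  nnat : forall T T' (f : Hom T T'), fmp G f \c nfam T = nfam T' \c fmp F f;
  nmod : forall T S, fcan G T S \c (nfam T <* S) = nfam (tob T S) \c fcan F T S }.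

(** The left unitor presents [T] as [one] tensored with [T], and [nmod] then computes [t T] from
    [t one]. Identities between transformations, and Schur's lemma for them, reduce to this one
    component. *)
Lemma nt_eq F G (HF : is_mfun F) (HG : is_mfun G) (t u : nt F G) :
  t one = u one -> forall T, t T = u T.
Proof.
have [Ulu _ _ _ _] := Cuni.
have E (s : nt F G) T : s T \c (fmp F (lu T) \c fcan F one T) =
    fmp G (lu T) \c fcan G one T \c (s one <* T).
  by rewrite cmpA -nnat -cmpA -nmod cmpA.
move=> tu T; have [g Hg] := fcanV HF one T.
have r : (fmp F (lu T) \c fcan F one T) \c (g \c fmp F (luV T)) = idm _.
  rewrite -cmpA [fcan F _ _ \c _]cmpA Hg cmp1l -(fmpM HF).
  by case: (Ulu T) => -> _; rewrite (fmp1 HF).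
by rewrite -[t T]cmp1r -[u T]cmp1r -r [LHS]cmpA [RHS]cmpA !E tu.
Qed.

Program Definition nid F (HF : is_mfun F) : nt F F := @NT F F (fun T => idm _) _ _.
Next Obligation. by move=> F HF *; rewrite cmp1l cmp1r. Qed.
Next Obligation. by move=> F HF T S; rewrite tm11 cmp1l cmp1r. Qed.

Program Definition ncmp F G H (t : nt G H) (u : nt F G) : nt F H :=
  @NT F H (fun T => t T \c u T) _ _.
Next Obligation. by move=> F G H t u T T' f; rewrite cmpA nnat -cmpA nnat cmpA. Qed.
Next Obligation. by move=> F G H t u T S; rewrite rwM cmpA nmod -cmpA nmod cmpA. Qed.

Program Definition nlw x F G (t : nt F G) : nt (cF (tF x) F) (cF (tF x) G) :=
  @NT (cF (tF x) F) (cF (tF x) G) (fun T => x *> t T) _ _.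
Next Obligation. by move=> x F G t T T' f /=; rewrite -!lwM nnat. Qed.
Next Obligation.
by move=> x F G t T S /=; rewrite -cmpA aso_nat !cmpA -!lwM nmod.
Qed.

Program Definition nscale F G a (t : nt F G) : nt F G :=
  @NT F G (fun T => a *: t T) _ _.
Next Obligation. by move=> F G a t T T' f /=; rewrite cmpZr cmpZl nnat. Qed.
Next Obligation. by move=> F G a t T S /=; rewrite tmZl cmpZr cmpZl nmod. Qed.

(** The associator is absorbed here. The pentagon axiom serves only to check [nmod] for [n21] and
    [n12]; afterwards composites of transformations need no coherence argument. *)
Program Definition n21 x y z (f : Hom (tob x y) z) : nt (cF (tF x) (tF y)) (tF z) :=
  @NT (cF (tF x) (tF y)) (tF z) (fun T => (f <* T) \c asoV x y T) _ _.
Next Obligation.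
move=> x y z f T T' h /=; rewrite cmpA -interchange -cmpA -tm11 asoV_nat.
by rewrite cmpA.
Qed.
Next Obligation.
move=> x y z f T S /=; rewrite rwM cmpA aso_nat tm11 -!cmpA; congr (_ \c _).
by rewrite pentagonV.
Qed.

Program Definition n12 x y z (f : Hom x (tob y z)) : nt (tF x) (cF (tF y) (tF z)) :=
  @NT (tF x) (cF (tF y) (tF z)) (fun T => aso y z T \c (f <* T)) _ _.
Next Obligation.
move=> x y z f T T' h /=; rewrite -cmpA interchange !cmpA; congr (_ \c _).
by rewrite -aso_nat tm11.
Qed.
Next Obligation.
move=> x y z f T S /=; rewrite rwM -!cmpA -[idm (tob T S)]tm11 -aso_nat [RHS]cmpA pentagon.
by rewrite -!cmpA.
Qed.

Local Notation "F ** G" := (cF F G) (at level 35, right associativity).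

Program Definition nrw12 x y z H (t : nt (tF x) (tF y ** tF z)) :
    nt (tF x ** H) (tF y ** tF z ** H) :=
  @NT (tF x ** H) (tF y ** tF z ** H) (fun T => t (H T)) _ _.
Next Obligation. by move=> x y z H t T T' f /=; rewrite (nnat t). Qed.
Next Obligation.
move=> x y z H t T S /=; rewrite lwM -!cmpA.
have /= := nmod t (H T) S; rewrite -!cmpA => ->.
by rewrite !cmpA; congr (_ \c _); exact: (nnat t).
Qed.

Program Definition nrw21 x y z H (t : nt (tF x ** tF y) (tF z)) :
    nt (tF x ** tF y ** H) (tF z ** H) :=
  @NT (tF x ** tF y ** H) (tF z ** H) (fun T => t (H T)) _ _.
Next Obligation. by move=> x y z H t T T' f /=; rewrite (nnat t). Qed.
Next Obligation.
move=> x y z H t T S /=; rewrite lwM -!cmpA.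
have /= -> := nmod t (H T) S.
by rewrite !cmpA; congr (_ \c _ \c _); exact: (nnat t).
Qed.

(** * Schur's lemma for the simple objects *)

Section NearGroup.
Variables (gT : finGroupType) (k : nat) (s : option gT -> Ob).
Hypotheses (s_end : forall i, \dim {: Hom (s i) (s i)} = 1%N)
  (s_hom : forall i j, i != j -> \dim {: Hom (s i) (s j)} = 0%N).

Lemma homs_eq0 i j (f : Hom (s i) (s j)) : i != j -> f = 0.
Proof.
move/s_hom/eqP; rewrite dimv_eq0 => /eqP E.
by apply/eqP; rewrite -memv0 -E memvf.
Qed.

Lemma ids_neq0 i : idm (s i) != 0.
Proof.
apply/eqP => E; have := s_end i; suff -> : fullv = 0%VS :> {vspace Hom (s i) (s i)}.
  by rewrite dimv0.
apply/eqP; rewrite -subv0; apply/subvP => f _.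
by rewrite -[f]cmp1l E cmp0l mem0v.
Qed.

Lemma homs_scalar i (f : Hom (s i) (s i)) : exists a, f = a *: idm _.
Proof.
apply/vlineP; suff -> : <[idm (s i)]>%VS = fullv by rewrite memvf.
by apply/eqP; rewrite eqEdim subvf s_end dim_vline ids_neq0.
Qed.

(** Conjugation turns [u] into an endomorphism of [s i]. The detour is needed because components at
    [one] live on [tob (s i) one], which is only isomorphic to [s i]. *)
Lemma iso_scalar i x y (p : Hom x (s i)) (q : Hom (s i) x) (p' : Hom y (s i))
    (q' : Hom (s i) y) (u0 : Hom x y) :
    q \c p = idm x -> p' \c q' = idm _ -> q' \c p' = idm y -> q' \c p = u0 ->
  forall u, exists a, u = a *: u0.
Proof.
move=> qp pq' qp' <- u; have [a E] := homs_scalar (p' \c u \c q).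
exists a; rewrite -cmpZl -[q']cmp1r -cmpZr -E !cmpA qp' cmp1l -cmpA qp.
by rewrite cmp1r.
Qed.

Lemma iso_hom0 i j x y (p : Hom x (s i)) (q : Hom (s i) x) (p' : Hom y (s j))
    (q' : Hom (s j) y) : i != j -> q \c p = idm x -> q' \c p' = idm y ->
  forall u : Hom x y, u = 0.
Proof.
move=> ij qp qp' u; rewrite -[u]cmp1r -qp -[u]cmp1l -qp' !cmpA -[q' \c _ \c _]cmpA.
by rewrite -[q' \c _ \c _]cmpA [p' \c u \c q]homs_eq0 // cmp0r cmp0l.
Qed.

Lemma ruK (x : Ob) : ru x \c ruV x = idm _.
Proof. by case: Cuni => _ E _ _ _; case: (E x). Qed.
Lemma ruVK (x : Ob) : ruV x \c ru x = idm _.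
Proof. by case: Cuni => _ E _ _ _; case: (E x). Qed.

Lemma schur i (t : nt (tF (s i)) (tF (s i))) : exists a, forall T, t T = a *: idm _.
Proof.
have [a Ea] : exists a, t one = a *: idm _.
  exact: (iso_scalar (ruVK (s i)) (ruK (s i)) (ruVK (s i)) (ruVK (s i))).
exists a; have H := tF_is_mfun (s i).
exact: (@nt_eq _ _ H H t (nscale a (nid H))).
Qed.

Lemma schur0 i j (t : nt (tF (s i)) (tF (s j))) : i != j -> forall T, t T = 0.
Proof.
move=> ij T; rewrite -[RHS](scale0r (t T)).
apply: (@nt_eq _ _ (tF_is_mfun _) (tF_is_mfun _) t (nscale 0 t)).
by rewrite /= scale0r (iso_hom0 ij (ruVK (s i)) (ruVK (s j)) (t one)).
Qed.

Lemma schur_iso i F (p : nt F (tF (s i))) (q : nt (tF (s i)) F)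
    (qp : forall T, q T \c p T = idm _) (t : nt F (tF (s i))) :
  exists a, forall T, t T = a *: p T.
Proof.
have [a E] := schur (ncmp t q); exists a => T.
by rewrite -[t T]cmp1r -qp cmpA [t T \c _]E cmpZl cmp1l.
Qed.

Lemma schur_isoV i F (p : nt F (tF (s i))) (q : nt (tF (s i)) F)
    (qp : forall T, q T \c p T = idm _) (t : nt (tF (s i)) F) :
  exists a, forall T, t T = a *: q T.
Proof.
have [a E] := schur (ncmp p t); exists a => T.
by rewrite -[t T]cmp1l -qp -cmpA [p T \c _]E cmpZr cmp1r.
Qed.

Lemma id1_neq0 i : idm (tob (s i) one) != 0.
Proof.
apply/eqP => E; move/eqP: (ids_neq0 i); case.
by rewrite -(ruK (s i)) -[ruV _]cmp1l E cmp0l cmp0r.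
Qed.

Local Notation m := (s None).
Local Notation S g := (s (Some g)).
Local Notation "x ⊗ T" := (tob x T) (at level 41, right associativity).

(** * Decomposition of m m and the gap actions on Hom(m, m m) *)

Section MM.
Variables (c : forall g, nt (tF (S g)) (tF m ** tF m))
  (d : forall g, nt (tF m ** tF m) (tF (S g)))
  (v : 'I_k -> nt (tF m) (tF m ** tF m)) (w : 'I_k -> nt (tF m ** tF m) (tF m)).
Hypotheses (dc1 : forall g T, d g T \c c g T = idm _)
  (dc0 : forall g h T, g != h -> d g T \c c h T = 0)
  (dv : forall g i T, d g T \c v i T = 0)
  (wc : forall g i T, w i T \c c g T = 0)
  (wv : forall i j T, w i T \c v j T = (i == j)%:R *: idm _)
  (cdvw : forall T, \sum_g (c g T \c d g T) + \sum_i (v i T \c w i T) = idm (m ⊗ m ⊗ T)).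

Lemma expand_mm X T (u : Hom X (m ⊗ m ⊗ T)) :
  u = \sum_g (c g T \c (d g T \c u)) + \sum_i (v i T \c (w i T \c u)).
Proof.
rewrite -[LHS]cmp1l -cdvw cmpDl !cmp_suml; congr (_ + _); apply: eq_bigr => i _;
by rewrite cmpA.
Qed.

Lemma nt_c g (t : nt (tF (S g)) (tF m ** tF m)) : exists a, forall T, t T = a *: c g T.
Proof.
have [a Ha] := schur (ncmp (d g) t); exists a => T.
rewrite [LHS]expand_mm (bigD1 g) //= [d g T \c _]Ha cmpZr cmp1r.
rewrite big1 ?addr0 => [|h hg]; last first.
  by rewrite [d h T \c _](schur0 (ncmp (d h) t)) ?cmp0r //; apply: contra hg => /eqP[->].
rewrite big1 ?addr0 // => i _.
by rewrite [w i T \c _](schur0 (ncmp (w i) t)) // cmp0r.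
Qed.

Lemma nt_v (t : nt (tF m) (tF m ** tF m)) :
  exists a : 'I_k -> R, forall T, t T = \sum_i a i *: v i T.
Proof.
have [a Ha] := fin_all_exists (fun i => schur (ncmp (w i) t)).
exists a => T; rewrite [LHS]expand_mm big1 ?add0r => [|g _]; last first.
  by rewrite [d g T \c _](schur0 (ncmp (d g) t)) ?cmp0r.
by apply: eq_bigr => i _; rewrite [w i T \c _]Ha cmpZr cmp1r.
Qed.

Lemma v_coord (a : 'I_k -> R) T j : w j T \c (\sum_i a i *: v i T) = a j *: idm _.
Proof.
rewrite cmp_sumr (bigD1 j) //= cmpZr wv eqxx scale1r big1 ?addr0 // => i ij.
by rewrite cmpZr wv eq_sym (negPf ij) scale0r scaler0.
Qed.

Lemma v_free (a b : 'I_k -> R) :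
  \sum_i a i *: v i one = \sum_i b i *: v i one -> a =1 b.
Proof.
move=> E j; have := congr1 (fun u => w j one \c u) E; rewrite !v_coord => /eqP.
rewrite -subr_eq0 -scalerBl scaler_eq0 subr_eq0 (negPf (id1_neq0 _)) orbF.
by move/eqP.
Qed.

Lemma nt_vM (I : finType) (t : I -> 'I_k -> nt (tF m) (tF m ** tF m)) :
  exists M : I -> 'M[R]_k, forall g j T, t g j T = \sum_i M g i j *: v i T.
Proof.
suff /fin_all_exists[M HM] g : exists M : 'M[R]_k, forall j T, t g j T = \sum_i M i j *: v i T.
  by exists M.
have [a Ha] := fin_all_exists (fun j => nt_v (t g j)).
exists (\matrix_(i, j) a j i) => j T; rewrite Ha.
by apply: eq_bigr => i _; rewrite mxE.
Qed.

Variables (l : forall g, nt (tF (S g) ** tF m) (tF m))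
  (lV : forall g, nt (tF m) (tF (S g) ** tF m))
  (r : forall g, nt (tF m ** tF (S g)) (tF m))
  (rV : forall g, nt (tF m) (tF m ** tF (S g)))
  (q : forall g h, nt (tF (S g) ** tF (S h)) (tF (S (g * h)%g)))
  (qV : forall g h, nt (tF (S (g * h)%g)) (tF (S g) ** tF (S h))).
Hypotheses (lK : forall g T, l g T \c lV g T = idm _)
  (lVK : forall g T, lV g T \c l g T = idm _)
  (rK : forall g T, r g T \c rV g T = idm _)
  (rVK : forall g T, rV g T \c r g T = idm _)
  (qK : forall g h T, q g h T \c qV g h T = idm _)
  (qVK : forall g h T, qV g h T \c q g h T = idm _).

Lemma l_nat g T T' (f : Hom T T') : (m *> f) \c l g T = l g T' \c (S g *> (m *> f)).
Proof. exact: (nnat (l g)). Qed.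
Lemma rV_nat g T T' (f : Hom T T') : (m *> (S g *> f)) \c rV g T = rV g T' \c (m *> f).
Proof. exact: (nnat (rV g)). Qed.

(** The middle gap action [m m -> m g m -> m m]: the object [g] is created by the first [m] and
    absorbed by the second. *)
Definition mu g : nt (tF m ** tF m) (tF m ** tF m) :=
  ncmp (nlw m (l g)) (nrw12 (tF m) (rV g)).
Lemma muE g T : mu g T = (m *> l g T) \c rV g (m ⊗ T). Proof. by []. Qed.

Definition muV g : nt (tF m ** tF m) (tF m ** tF m) :=
  ncmp (nrw21 (tF m) (r g)) (nlw m (lV g)).
Lemma muVK g T : muV g T \c mu g T = idm _.
Proof.
rewrite /= -!cmpA [(m *> _) \c (_ \c _)]cmpA -lwM lVK tm11 cmp1l.
exact: rK.
Qed.

(** The word [g m h] is isomorphic to [m], so its two reductions are proportional. The commutation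
    of the gap actions rests on showing in [pairing1] that the scalar is 1. *)
Lemma pairing g h : exists a, forall T,
  r h T \c l g (S h ⊗ T) = a *: (l g T \c (S g *> r h T)).
Proof.
apply: (@schur_iso _ _ (ncmp (l g) (nlw (S g) (r h))) (ncmp (nlw (S g) (rV h)) (lV g)) _
          (ncmp (r h) (nrw21 (tF (S h)) (l g)))) => T /=.
by rewrite -!cmpA [lV g T \c _]cmpA lVK cmp1l -lwM rVK tm11.
Qed.

Lemma l_proj g h : exists a, forall T,
  l g T \c (S g *> l h T) = a *: (l (g * h)%g T \c q g h (m ⊗ T)).
Proof.
apply: (@schur_iso _ _ (ncmp (l (g * h)%g) (nrw21 (tF m) (q g h)))
  (ncmp (nrw12 (tF m) (qV g h)) (lV _)) _ (ncmp (l g) (nlw (S g) (l h)))) => T /=.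
by rewrite -!cmpA [lV _ T \c _]cmpA lVK cmp1l qVK.
Qed.

Lemma rV_proj g h : exists a, forall T,
  rV g (S h ⊗ T) \c rV h T = a *: ((m *> qV g h T) \c rV (g * h)%g T).
Proof.
apply: (@schur_isoV _ _ (ncmp (r (g * h)%g) (nlw m (q g h))) 
  (ncmp (nlw m (qV g h)) (rV _)) _ (ncmp (nrw12 (tF (S h)) (rV g)) (rV h))) => T /=.
by rewrite -!cmpA [rV _ T \c _]cmpA rVK cmp1l -lwM qVK tm11.
Qed.

Lemma cmp_eq0 x y z (f : Hom x y) (f' : Hom y x) (g : Hom z x) :
  f' \c f = idm _ -> f \c g = 0 -> g = 0.
Proof. by move=> ff fg; rewrite -[g]cmp1l -ff -cmpA fg cmp0r. Qed.

Lemma cmp_epi x y z (f : Hom x y) (f' : Hom y x) (g g' : Hom y z) :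
  f \c f' = idm _ -> g \c f = g' \c f -> g = g'.
Proof. by move=> ff E; rewrite -[g]cmp1r -[g']cmp1r -ff !cmpA E. Qed.

Lemma cmp_mono x y z (f : Hom x y) (f' : Hom y x) (g g' : Hom z x) :
  f' \c f = idm _ -> f \c g = f \c g' -> g = g'.
Proof. by move=> ff E; rewrite -[g]cmp1l -[g']cmp1l -ff -!cmpA E. Qed.

Hypothesis muc : forall g T, mu g T \c c 1%g T = c 1%g T.

Lemma c_neq0 g : c g one != 0.
Proof.
by apply: contraNneq (id1_neq0 (Some g)) => E; rewrite -(dc1 g one) E cmp0r.
Qed.

(** Multiplicativity holds up to a scalar by [l_proj] and [rV_proj]. By the normalisation [muc] both
    sides fix [c 1], so the scalar is 1. *)
Lemma muM g h T : mu g T \c mu h T = mu (g * h)%g T.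
Proof.
have [a Ha] := l_proj g h; have [b Hb] := rV_proj g h.
have E X : mu g X \c mu h X = (a * b) *: mu (g * h)%g X.
  rewrite !muE cmpA -[_ \c _ \c (m *> l h X)]cmpA -rV_nat cmpA -lwM Ha.
  rewrite -cmpA Hb tmZr cmpZl cmpZr scalerA lwM; congr (_ *: _).
  by rewrite !cmpA -[m *> l _ X \c _ \c _]cmpA -lwM qK tm11 cmp1r.
suff ab : a * b = 1 by rewrite E ab scale1r.
have := congr1 (fun u => u \c c 1%g one) (E one); rewrite cmpZl -cmpA !muc => /eqP.
rewrite -[X in X == _]scale1r -subr_eq0 -scalerBl scaler_eq0 (negPf (c_neq0 _)) orbF.
by rewrite subr_eq0 => /eqP<-.
Qed.

Lemma nt_cS g h : exists a, forall T,
  l h (m ⊗ T) \c (S h *> c g T) = a *: (c (h * g)%g T \c q h g T).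
Proof.
have [a Ha] := nt_c (ncmp (nrw21 (tF m) (l h)) (ncmp (nlw (S h) (c g)) (qV h g))).
exists a => T; have /= Ha' := Ha T.
by rewrite -cmpZl -Ha' -!cmpA qVK cmp1r.
Qed.

Lemma L_ex : exists L : gT -> 'M[R]_k, forall g j T,
  l g (m ⊗ T) \c (S g *> v j T) = (\sum_i L g i j *: v i T) \c l g T.
Proof.
have [L HL] := nt_vM (fun g j => ncmp (nrw21 (tF m) (l g)) (ncmp (nlw (S g) (v j)) (lV g))).
by exists L => g j T; rewrite -HL /= -!cmpA lVK cmp1r.
Qed.

Lemma M_ex : exists M : gT -> 'M[R]_k, forall g j T,
  mu g T \c v j T = \sum_i M g i j *: v i T.
Proof.
have [M HM] := nt_vM (fun g j => ncmp (mu g) (v j)).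
by exists M => g j T; rewrite -HM.
Qed.

Lemma R_ex : exists N : gT -> 'M[R]_k, forall g j T,
  (m *> r g T) \c v j (S g ⊗ T) = (\sum_i N g i j *: v i T) \c r g T.
Proof.
have [N HN] := nt_vM (fun g j => ncmp (nlw m (r g)) (ncmp (nrw12 (tF (S g)) (v j)) (rV g))).
by exists N => g j T; rewrite -HN /= -!cmpA rVK cmp1r.
Qed.

Section Matrices.
Variables L M N : gT -> 'M[R]_k.
Local Notation lc A j T := (\sum_i (A : 'M[R]_k) i j *: v i T).
Hypotheses (HL : forall g j T, l g (m ⊗ T) \c (S g *> v j T) = lc (L g) j T \c l g T)
  (HM : forall g j T, mu g T \c v j T = lc (M g) j T)
  (HN : forall g j T, (m *> r g T) \c v j (S g ⊗ T) = lc (N g) j T \c r g T).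

Lemma lc_eq (A B : 'M[R]_k) : (forall j, lc A j one = lc B j one) -> A = B.
Proof. by move=> E; apply/matrixP => i j; apply: v_free (E j) i. Qed.

Lemma lcM (A B : 'M[R]_k) (V : lmodType R) (x : 'I_k -> V) j :
  \sum_i B i j *: (\sum_h A h i *: x h) = \sum_i (A *m B) i j *: x i.
Proof.
rewrite (eq_bigr (fun i => \sum_h (A h i * B i j) *: x h)) => [|i _]; last first.
  by rewrite scaler_sumr; apply: eq_bigr => h _; rewrite scalerA mulrC.
rewrite exchange_big; apply: eq_bigr => h _.
by rewrite mxE scaler_suml.
Qed.

Lemma lcZ (A : 'M[R]_k) a j (V : lmodType R) (x : 'I_k -> V) :
  \sum_i (a *: A) i j *: x i = a *: \sum_i A i j *: x i.
Proof. by rewrite scaler_sumr; apply: eq_bigr => i _; rewrite mxE scalerA. Qed.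

Lemma mu_lc g A j T : mu g T \c lc A j T = lc (M g *m A) j T.
Proof.
rewrite cmp_sumr -lcM; apply: eq_bigr => i _.
by rewrite cmpZr HM.
Qed.

Lemma l_lc g A j T :
  l g (m ⊗ T) \c (S g *> lc A j T) = lc (L g *m A) j T \c l g T.
Proof.
rewrite tm_sumr cmp_sumr -lcM cmp_suml; apply: eq_bigr => i _.
by rewrite tmZr cmpZr HL cmpZl.
Qed.

Lemma r_lc g A j T :
  (m *> r g T) \c lc A j (S g ⊗ T) = lc (N g *m A) j T \c r g T.
Proof.
rewrite cmp_sumr -lcM cmp_suml; apply: eq_bigr => i _.
by rewrite cmpZr HN cmpZl.
Qed.

Lemma lc1 j T : v j T = lc 1%:M j T.
Proof.
rewrite (bigD1 j) //= mxE eqxx scale1r big1 ?addr0 // => i ij.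
by rewrite mxE (negPf ij) scale0r.
Qed.

Lemma MM g h : M g *m M h = M (g * h)%g.
Proof.
by apply: lc_eq => j; rewrite -mu_lc -HM cmpA muM HM.
Qed.

Lemma l_proj_neq0 g h a :
  (forall T, l g T \c (S g *> l h T) = a *: (l (g * h)%g T \c q g h (m ⊗ T))) -> a != 0.
Proof.
move=> Ha; apply: contraNneq (id1_neq0 None) => a0; have := Ha one; rewrite a0 scale0r.
move/(cmp_eq0 (lVK _ _))/(congr1 (fun u => u \c (S g *> lV h one))).
rewrite cmp0l -lwM lK tm11 => E.
by rewrite -(lK g one) -[lV _ _]cmp1l E cmp0l cmp0r.
Qed.

(** The scalar comparing [l g] after [l h] with [l (g * h)] occurs on both sides and cancels, so [L]
    is an honest representation whatever the choice of [l]. *)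
Lemma LL g h : L g *m L h = L (g * h)%g.
Proof.
have [a Ha] := l_proj g h; have a0 := l_proj_neq0 Ha.
apply: lc_eq => j.
suff : lc (L g *m L h) j one \c (l g one \c (S g *> l h one)) =
    lc (L (g * h)%g) j one \c (l g one \c (S g *> l h one)).
  rewrite Ha !cmpZr => /(scalerI a0); rewrite !cmpA.
  by move/(cmp_epi (qK g h _))/(cmp_epi (lK _ _)).
rewrite [LHS]cmpA -l_lc -cmpA -lwM -HL lwM [LHS]cmpA !Ha cmpZr cmpZl; congr (_ *: _).
rewrite [RHS]cmpA -HL -!cmpA; congr (_ \c _).
exact: esym (nnat (q g h) _).
Qed.

Lemma pair_rV g h a :
  (forall T, r h T \c l g (S h ⊗ T) = a *: (l g T \c (S g *> r h T))) ->
  forall T, l g (S h ⊗ T) \c (S g *> rV h T) = a *: (rV h T \c l g T).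
Proof.
move=> Ha T; apply: (cmp_mono (rVK h _)).
apply: (cmp_epi (_ : (S g *> r h T) \c (S g *> rV h T) = idm _)).
  by rewrite -lwM rK tm11.
rewrite -!cmpA -[S g *> rV h _ \c _]lwM rVK tm11 cmp1r Ha !(cmpZl, cmpZr).
by congr (_ *: _); rewrite !cmpA rK cmp1l.
Qed.

Lemma pair_LM g h a :
  (forall T, r h T \c l g (S h ⊗ T) = a *: (l g T \c (S g *> r h T))) ->
  forall T, l g (m ⊗ T) \c (S g *> mu h T) = a *: (mu h T \c l g (m ⊗ T)).
Proof.
move=> /pair_rV Ha T; rewrite muE lwM cmpA -l_nat -!cmpA -cmpZr; congr (_ \c _).
by rewrite Ha.
Qed.

Lemma mu1 T : mu 1%g T = idm _.
Proof.
by apply: (cmp_mono (muVK 1%g T)); rewrite muM mulg1 cmp1r.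
Qed.

Lemma inj_unitmx n (A : 'M[R]_n) : (forall B : 'M_n, A *m B = 0 -> B = 0) -> A \in unitmx.
Proof.
move=> H; rewrite -unitmx_tr -row_free_unit -kermx_eq0.
apply/eqP/trmx_inj; rewrite trmx0; apply: H.
by rewrite -{1}[A]trmxK -trmx_mul mulmx_ker trmx0.
Qed.

Lemma L_unit g : L g \in unitmx.
Proof.
apply: inj_unitmx => B LB; apply/matrixP => i j; rewrite mxE.
have : l g (m ⊗ one) \c (S g *> lc B j one) = 0.
  by rewrite l_lc LB big1 ?cmp0l // => h _; rewrite mxE scale0r.
move/(cmp_eq0 (lVK _ _))/(congr1 (fun u => (S g *> w i one) \c u)).
rewrite -lwM v_coord cmp0r tmZr tm11 => /eqP; rewrite scaler_eq0 => /orP[/eqP//|/eqP E].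
by case/eqP: (id1_neq0 None); rewrite -(lK g one) -[lV _ _]cmp1l E cmp0l cmp0r.
Qed.

Lemma N_unit g : N g \in unitmx.
Proof.
apply: inj_unitmx => B LB; apply/matrixP => i j; rewrite mxE.
have : (m *> r g one) \c lc B j (S g ⊗ one) = 0.
  by rewrite r_lc LB big1 ?cmp0l // => h _; rewrite mxE scale0r.
have rr : (m *> rV g one) \c (m *> r g one) = idm _ by rewrite -lwM rVK tm11.
move/(cmp_eq0 rr)/(congr1 (fun u => w i (S g ⊗ one) \c u)).
rewrite v_coord cmp0r => /eqP; rewrite scaler_eq0 => /orP[/eqP//|/eqP E].
by case/eqP: (id1_neq0 None); rewrite -(rK g one) -[rV _ _]cmp1l E cmp0l cmp0r.
Qed.

Lemma M1 : M 1%g = 1%:M.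
Proof. by apply: lc_eq => j; rewrite -HM mu1 cmp1l -lc1. Qed.

Lemma M_unit g : M g \in unitmx.
Proof.
suff /mulmx1_unit[] : M g *m M g^-1%g = 1%:M by [].
by rewrite MM mulgV M1.
Qed.

Lemma L1 : L 1%g = 1%:M.
Proof.
by rewrite -[LHS](mulKmx (L_unit 1%g)) LL mulg1 mulVmx ?L_unit.
Qed.

Hypotheses (k_gt0 : (0 < k)%N) (card_gT : #|gT| = k.+1).

(** If the scalar is [a], then [L g] and [M h] commute up to [a]. Determinants of these invertible
    matrices of size [k] give [a ^+ k = 1]; since [g] has trivial power [|G| = k + 1], also
    [a ^+ k.+1 = 1]. *)
Lemma pairing1 g h T : r h T \c l g (S h ⊗ T) = l g T \c (S g *> r h T).
Proof.
have [a Ha] := pairing g h; suff a1 : a = 1 by rewrite Ha a1 scale1r.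
have LM j : L (g ^+ j)%g *m M h = a ^+ j *: (M h *m L (g ^+ j)%g).
  elim: j => [|j IH]; first by rewrite expg0 L1 mulmx1 mul1mx scale1r.
  rewrite expgS -LL -mulmxA IH -scalemxAr [L g *m (M h *m _)]mulmxA.
  have -> : L g *m M h = a *: (M h *m L g).
    apply: lc_eq => i; apply: (cmp_epi (lK g _)).
    rewrite -l_lc -HM lwM [LHS]cmpA (pair_LM Ha) lcZ !cmpZl; congr (_ *: _).
    by rewrite -cmpA HL cmpA mu_lc.
  by rewrite -scalemxAl scalerA -exprSr mulmxA.
have ak : a ^+ k = 1.
  have := congr1 determinant (LM 1%N); rewrite expr1 expg1 detZ !det_mulmx.
  rewrite [\det (M h) * _]mulrC -[LHS]mul1r => /mulIf <- //.
  have := M_unit h; have := L_unit g.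
  by rewrite !unitmxE !unitfE mulf_eq0 negb_or => -> ->.
have := LM #|gT|; rewrite -cardsT expg_cardG ?inE // L1 mul1mx mulmx1 cardsT card_gT.
rewrite exprS ak mulr1 => /eqP; rewrite -[X in X == _]scale1r -subr_eq0 -scalerBl.
rewrite scaler_eq0 subr_eq0 => /orP[/eqP//|/eqP M0].
have := M_unit h; rewrite M0 -[k]prednK // unitr0 //.
Qed.

Lemma rV_l g h T : l g (S h ⊗ T) \c (S g *> rV h T) = rV h T \c l g T.
Proof.
rewrite (@pair_rV g h 1) ?scale1r // => T'.
by rewrite pairing1 scale1r.
Qed.

Lemma l_mu g h T : l g (m ⊗ T) \c (S g *> mu h T) = mu h T \c l g (m ⊗ T).
Proof.
rewrite (@pair_LM g h 1) ?scale1r // => T'.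
by rewrite pairing1 scale1r.
Qed.

Lemma LM_comm g h : L g *m M h = M h *m L g.
Proof.
apply: lc_eq => i; apply: (cmp_epi (lK g _)).
by rewrite -l_lc -HM lwM [LHS]cmpA l_mu -cmpA HL cmpA mu_lc.
Qed.

Lemma r_mu g h T : (m *> r g T) \c mu h (S g ⊗ T) = mu h T \c (m *> r g T).
Proof.
rewrite !muE cmpA -lwM pairing1 lwM -[LHS]cmpA -[RHS]cmpA; congr (_ \c _).
exact: (nnat (rV h) (r g T)).
Qed.

Lemma NM_comm g h : N g *m M h = M h *m N g.
Proof.
apply: lc_eq => i; apply: (cmp_epi (rK g _)).
by rewrite -r_lc -HM cmpA r_mu -cmpA HN cmpA mu_lc.
Qed.

Lemma LN_comm g h : L g *m N h = N h *m L g.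
Proof.
apply: lc_eq => i; apply: (cmp_epi (lK g _)).
have rr : (S g *> r h one) \c (S g *> rV h one) = idm _ by rewrite -lwM rK tm11.
apply: (cmp_epi rr).
rewrite -l_lc -cmpA -lwM -HN lwM [LHS]cmpA -l_nat -[LHS]cmpA HL [LHS]cmpA r_lc.
by rewrite -[LHS]cmpA pairing1 cmpA.
Qed.

Lemma nt_cS_neq0 g h a :
  (forall T, l h (m ⊗ T) \c (S h *> c g T) = a *: (c (h * g)%g T \c q h g T)) -> a != 0.
Proof.
move=> Ha; apply: contraNneq (id1_neq0 (Some (h * g)%g)) => a0.
have := Ha one; rewrite a0 scale0r => /(cmp_eq0 (lVK _ _)).
move/(congr1 (fun u => (S h *> d g one) \c u)); rewrite -lwM dc1 cmp0r tm11 => E.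
by rewrite -(qK h g one) -[qV h g one]cmp1l E cmp0l cmp0r.
Qed.

(** Up to a nonzero scalar, [c h] arises from [c 1] by absorbing [h] on the left, and by [l_mu] this
    commutes with the middle action. *)
Lemma mu_c g h T : mu g T \c c h T = c h T.
Proof.
have [a Ha] := nt_cS 1 h; have a0 := nt_cS_neq0 Ha.
have : mu g T \c (l h (m ⊗ T) \c (S h *> c 1%g T)) = l h (m ⊗ T) \c (S h *> c 1%g T).
  by rewrite cmpA -l_mu -cmpA -lwM muc.
by rewrite Ha cmpZr => /(scalerI a0); rewrite cmpA => /(cmp_epi (qK h 1%g T)); rewrite mulg1.
Qed.

(** [Q] is the rotation of Hom(m, m m): it compares the two families in Hom(1, m m m) obtained from
    [c 1] by splitting its second or its first factor. In the expansion along the first two factors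
    the component at [g] vanishes, because [g m] is isomorphic to [m] and receives nothing from the
    unit. *)
Lemma Q_ex : exists Q : 'M[R]_k, forall j T,
  (m *> v j T) \c c 1%g T = \sum_i Q i j *: (v i (m ⊗ T) \c c 1%g T).
Proof.
suff /fin_all_exists[a Ha] j : exists a : 'I_k -> R, forall T,
    (m *> v j T) \c c 1%g T = \sum_i a i *: (v i (m ⊗ T) \c c 1%g T).
  exists (\matrix_(i, j) a j i) => j T; rewrite Ha.
  by apply: eq_bigr => i _; rewrite mxE.
pose t := ncmp (nlw m (v j)) (c 1%g).
have [a Ha] := fin_all_exists (fun i => nt_c (ncmp (nrw21 (tF m) (w i)) t)).
exists a => T; rewrite [LHS]expand_mm big1 ?add0r => [|g _]; last first.
  have /= := schur0 (ncmp (l g) (ncmp (nrw21 (tF m) (d g)) t)) _ T.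
  by move=> /(_ isT)/(cmp_eq0 (lVK _ _)) ->; rewrite cmp0r.
by apply: eq_bigr => i _; have /= -> := Ha i T; rewrite cmpZr.
Qed.

(** * Rotation, and the conjugacy of the three gap actions *)

Section Q.
Variable Q : 'M[R]_k.
Hypothesis HQ : forall j T,
  (m *> v j T) \c c 1%g T = \sum_i Q i j *: (v i (m ⊗ T) \c c 1%g T).

Lemma Q_lc A j T : (m *> lc A j T) \c c 1%g T = lc (Q *m A) j (m ⊗ T) \c c 1%g T.
Proof.
rewrite tm_sumr cmp_suml (eq_bigr (fun i => A i j *: (lc Q i (m ⊗ T) \c c 1%g T))).
  by rewrite -lcM cmp_suml; apply: eq_bigr => i _; rewrite cmpZl.
move=> i _; rewrite tmZr cmpZl HQ cmp_suml; congr (_ *: _).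
by apply: eq_bigr => h _; rewrite cmpZl.
Qed.

Lemma lc_c_eq (A B : 'M[R]_k) :
  (forall j, lc A j (m ⊗ one) \c c 1%g one = lc B j (m ⊗ one) \c c 1%g one) -> A = B.
Proof.
move=> E; apply/matrixP => i j; have := congr1 (fun u => w i (m ⊗ one) \c u) (E j).
rewrite !cmpA !v_coord !cmpZl !cmp1l => /eqP; rewrite -subr_eq0 -scalerBl scaler_eq0.
by rewrite subr_eq0 (negPf (c_neq0 _)) orbF => /eqP.
Qed.

Lemma Q_unit : Q \in unitmx.
Proof.
apply: inj_unitmx => B QB; apply/matrixP => i j; rewrite mxE.
have : (m *> lc B j one) \c c 1%g one = 0.
  by rewrite Q_lc QB big1 ?cmp0l // => h _; rewrite mxE scale0r.
move/(congr1 (fun u => (m *> w i one) \c u)); rewrite cmpA -lwM v_coord cmp0r tmZr tm11.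
rewrite cmpZl cmp1l => /eqP; rewrite scaler_eq0 (negPf (c_neq0 _)) orbF.
by move/eqP.
Qed.

Lemma mu_lw g A j T :
  mu g (m ⊗ T) \c (m *> lc A j T) = (m *> lc (L g *m A) j T) \c mu g T.
Proof.
rewrite !muE -cmpA -rV_nat cmpA -lwM l_lc lwM -[LHS]cmpA.
by rewrite cmpA.
Qed.

(** The action in the first gap of [m m m] is computed in both families: it is [M] where the gap
    lies inside the split factor, and [L] where it lies in front of it. In the same way [NQ] treats
    the second gap. *)
Lemma MQ g : M g *m Q = Q *m L g.
Proof.
apply: lc_c_eq => j; rewrite -mu_lc -[LHS]cmpA.
have -> : lc Q j (m ⊗ one) \c c 1%g one = (m *> lc 1%:M j one) \c c 1%g one.
  by rewrite Q_lc mulmx1.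
by rewrite cmpA mu_lw -cmpA mu_c Q_lc mulmx1.
Qed.

(** A gap action creates [g] by [rV] on the left of the gap, whereas [N] absorbs it by [r]. Hence
    the third action of the gap data is [invmx (N g)]. *)
Lemma N_rV g A j T :
  (m *> rV g T) \c lc A j T = lc (invmx (N g) *m A) j (S g ⊗ T) \c rV g T.
Proof.
have rr : (m *> rV g T) \c (m *> r g T) = idm _ by rewrite -lwM rVK tm11.
apply: (cmp_mono (_ : (m *> rV g T) \c (m *> r g T) = idm _)) => //.
rewrite [LHS]cmpA -lwM rK tm11 cmp1l [RHS]cmpA r_lc mulKVmx ?N_unit //.
by rewrite -cmpA rK cmp1r.
Qed.

Lemma mu_rw g A j T :
  (m *> mu g T) \c lc A j (m ⊗ T) = lc (invmx (N g) *m A) j (m ⊗ T) \c mu g T.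
Proof.
rewrite muE lwM -cmpA N_rV cmpA [RHS]cmpA; congr (_ \c _).
rewrite cmp_sumr cmp_suml; apply: eq_bigr => i _; rewrite cmpZr cmpZl; congr (_ *: _).
exact: (nnat (v i) (l g T)).
Qed.

Lemma NQ g : invmx (N g) *m Q = Q *m M g.
Proof.
apply: lc_c_eq => j; rewrite -{1}[c 1%g one](mu_c g) cmpA -mu_rw -[LHS]cmpA.
have -> : lc Q j (m ⊗ one) \c c 1%g one = (m *> v j one) \c c 1%g one.
  by rewrite HQ cmp_suml; under eq_bigr do rewrite cmpZl.
by rewrite cmpA -lwM HM Q_lc.
Qed.

(** * The two bases of Hom(m, m m m) *)

Local Notation U := (Hom (m ⊗ one) (m ⊗ m ⊗ m ⊗ one)).
Local Notation I := (gT + 'I_k * 'I_k)%type.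

Lemma rV_proj_neq0 g h b :
  (forall T, rV g (S h ⊗ T) \c rV h T = b *: ((m *> qV g h T) \c rV (g * h)%g T)) -> b != 0.
Proof.
move=> Hb; apply: contraNneq (id1_neq0 None) => b0; have := Hb one; rewrite b0 scale0r.
move/(cmp_eq0 (rK _ _))/(congr1 (fun u => r h one \c u)).
by rewrite cmp0r rK => ->.
Qed.

Lemma m1_scalar (u : Hom (m ⊗ one) (m ⊗ one)) : exists a, u == a *: idm (m ⊗ one).
Proof.
have [a Ha] := iso_scalar (ruVK m) (ruK m) (ruVK m) (ruVK m) u.
by exists a; rewrite -Ha.
Qed.

Definition sc u : R := projT1 (sigW (m1_scalar u)).
Lemma scE u : u = sc u *: idm (m ⊗ one).
Proof. by apply/eqP; rewrite /sc; case: sigW. Qed.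
Lemma sc_uniq u a : u = a *: idm (m ⊗ one) -> sc u = a.
Proof.
move=> E; have := scE u; rewrite {1}E => /eqP; rewrite -subr_eq0 -scalerBl.
by rewrite scaler_eq0 (negPf (id1_neq0 None)) orbF subr_eq0 => /eqP.
Qed.

Definition eU (x : I) : U := match x with
  | inl h => c h (m ⊗ one) \c lV h one
  | inr p => v p.1 (m ⊗ one) \c v p.2 one end.
Definition fU (x : I) : U := match x with
  | inl h => (m *> c h one) \c rV h one
  | inr p => (m *> v p.1 one) \c v p.2 one end.
Definition eD (x : I) : Hom (m ⊗ m ⊗ m ⊗ one) (m ⊗ one) := match x with
  | inl h => l h one \c d h (m ⊗ one)
  | inr p => w p.2 one \c w p.1 (m ⊗ one) end.
Definition fD (x : I) : Hom (m ⊗ m ⊗ m ⊗ one) (m ⊗ one) := match x with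
  | inl h => r h one \c (m *> d h one)
  | inr p => w p.2 one \c (m *> w p.1 one) end.

Lemma eD_eU x y : eD x \c eU y = (x == y)%:R *: idm _.
Proof.
case: x y => [g|[i j]] [h|[i' j']] /=.
- rewrite -cmpA [d g _ \c _]cmpA; case: (eqVneq (inl g : I) (inl h)) => [[<-]|gh].
    by rewrite dc1 cmp1l lK scale1r.
  rewrite dc0; last by apply: contra gh => /eqP->.
  by rewrite cmp0l cmp0r scale0r.
- by rewrite -cmpA [d g _ \c _]cmpA dv cmp0l cmp0r scale0r.
- by rewrite -cmpA [w i _ \c _]cmpA wc cmp0l cmp0r scale0r.
- by rewrite -cmpA [w i _ \c _]cmpA wv cmpZl cmp1l cmpZr wv scalerA -natrM mulnb.
Qed.

Lemma fD_fU x y : fD x \c fU y = (x == y)%:R *: idm _.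
Proof.
case: x y => [g|[i j]] [h|[i' j']] /=; rewrite -cmpA [(m *> _) \c (_ \c _)]cmpA -lwM.
- case: (eqVneq (inl g : I) (inl h)) => [[<-]|gh].
    by rewrite dc1 tm11 cmp1l rK scale1r.
  rewrite dc0; last by apply: contra gh => /eqP->.
  by rewrite tm0r cmp0l cmp0r scale0r.
- by rewrite dv tm0r cmp0l cmp0r scale0r.
- by rewrite wc tm0r cmp0l cmp0r scale0r.
- by rewrite wv tmZr tm11 cmpZl cmp1l cmpZr wv scalerA -natrM mulnb.
Qed.

Lemma expand_m1_mm (u : Hom (m ⊗ one) (m ⊗ m ⊗ one)) :
  u = \sum_j (v j one \c (w j one \c u)).
Proof.
rewrite [LHS]expand_mm big1 ?add0r // => g _.
rewrite [d g one \c u](iso_hom0 (i := None) (j := Some g) _ (ruVK m) (ruVK (S g))) //.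
by rewrite cmp0r.
Qed.

Lemma eU_span (u : U) : u = \sum_x (eU x \c (eD x \c u)).
Proof.
rewrite [LHS]expand_mm big_sumType /=; congr (_ + _).
  apply: eq_bigr => g _; rewrite -!cmpA; congr (_ \c _).
  by rewrite cmpA lVK cmp1l.
rewrite -(pair_bigA _ (fun i j : 'I_k => eU (inr (i, j)) \c (eD (inr (i, j)) \c u))) /=.
apply: eq_bigr => i _; rewrite [w i _ \c u]expand_m1_mm cmp_sumr.
by apply: eq_bigr => j _; rewrite !cmpA.
Qed.

Lemma fU_span (u : U) : u = \sum_x (fU x \c (fD x \c u)).
Proof.
have {1}-> : u = (m *> idm (m ⊗ m ⊗ one)) \c u by rewrite tm11 cmp1l.
rewrite -cdvw big_sumType /=.
have -> : m *> (\sum_g (c g one \c d g one) + \sum_i (v i one \c w i one)) =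
  \sum_g (m *> (c g one \c d g one)) + \sum_i (m *> (v i one \c w i one)).
  by rewrite -!tm_sumr; exact: (linfD (tmr_is_linear (idm m))).
rewrite cmpDl !cmp_suml; congr (_ + _).
  apply: eq_bigr => g _; rewrite lwM -!cmpA; congr (_ \c _).
  by rewrite [rV _ _ \c _]cmpA rVK cmp1l.
rewrite -(pair_bigA _ (fun i j : 'I_k => fU (inr (i, j)) \c (fD (inr (i, j)) \c u))) /=.
apply: eq_bigr => i _; rewrite lwM -cmpA [(m *> w i _) \c u]expand_m1_mm cmp_sumr.
by apply: eq_bigr => j _; rewrite !cmpA.
Qed.

Lemma has_dual_basis_of (b : I -> U) (D : I -> Hom (m ⊗ m ⊗ m ⊗ one) (m ⊗ one)) :
  (forall x y, D x \c b y = (x == y)%:R *: idm _) ->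
  (forall u : U, u = \sum_x (b x \c (D x \c u))) -> has_dual_basis b.
Proof.
move=> DE span; exists (fun x u => sc (D x \c u)); split=> [x a u u'|u|x y].
- apply: sc_uniq; rewrite cmpDr cmpZr scalerDl; congr (_ + _); last exact: scE.
  by transitivity (a *: (sc (D x \c u) *: idm (m ⊗ one))); [rewrite -scE | exact: scalerA].
- rewrite [LHS]span; apply: eq_bigr => x _.
  by rewrite {1}[D x \c u]scE cmpZr cmp1r.
- exact: sc_uniq.
Qed.

Definition A0 g (u : U) : U := l g (m ⊗ m ⊗ one) \c (S g *> u) \c lV g one.
Definition A1 g (u : U) : U := mu g (m ⊗ one) \c u.
Definition A2 g (u : U) : U := (m *> mu g one) \c u.

Lemma A0_e g i j : A0 g (eU (inr (i, j))) =
  \sum_h L g h i *: \sum_n L g n j *: eU (inr (h, n)).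
Proof.
rewrite /A0 /= lwM [l g _ \c _]cmpA HL -[X in X \c _]cmpA HL -2!cmpA lK cmp1r.
rewrite cmp_suml; apply: eq_bigr => h _; rewrite cmpZl cmp_sumr; congr (_ *: _).
by apply: eq_bigr => n _; rewrite cmpZr.
Qed.

Lemma A0_f g i j : A0 g (fU (inr (i, j))) = \sum_n L g n j *: fU (inr (i, n)).
Proof.
rewrite /A0 /= lwM [l g _ \c _]cmpA -l_nat -[X in X \c _]cmpA HL -2!cmpA lK cmp1r.
by rewrite cmp_sumr; apply: eq_bigr => n _; rewrite cmpZr.
Qed.

Lemma A0_f1 g h : A0 g (fU (inl h)) = fU (inl h).
Proof.
rewrite /A0 /= lwM [l g _ \c _]cmpA -l_nat -[X in X \c _]cmpA rV_l -!cmpA lK.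
by rewrite cmp1r.
Qed.

Lemma A1_e g i j : A1 g (eU (inr (i, j))) = \sum_h M g h i *: eU (inr (h, j)).
Proof.
rewrite /A1 [LHS]cmpA HM cmp_suml.
by apply: eq_bigr => h _; rewrite cmpZl.
Qed.

Lemma A1_e1 g h : A1 g (eU (inl h)) = eU (inl h).
Proof. by rewrite /A1 [LHS]cmpA mu_c. Qed.

Lemma A1_f g i j : A1 g (fU (inr (i, j))) =
  \sum_h L g h i *: \sum_n M g n j *: fU (inr (h, n)).
Proof.
rewrite /A1 [LHS]cmpA lc1 mu_lw mulmx1 -[LHS]cmpA HM.
rewrite tm_sumr cmp_suml; apply: eq_bigr => h _; rewrite tmZr cmpZl cmp_sumr.
by congr (_ *: _); apply: eq_bigr => n _; rewrite cmpZr.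
Qed.

(** The object [g] created by the first factor is absorbed by the summand [h] of the last two, which
    becomes [g h]. This is the regular representation inside Hom(m, m m m), twisted by the scalars
    of [nt_cS] and [rV_proj]. *)
Lemma A1_f1 g h : exists2 y, y != 0 & A1 g (fU (inl h)) = y *: fU (inl (g * h)%g).
Proof.
have [a Ha] := nt_cS h g; have [b Hb] := rV_proj g h.
exists (a * b); first by rewrite mulf_neq0 ?(nt_cS_neq0 Ha) ?(rV_proj_neq0 Hb).
rewrite /A1 muE /= -[LHS]cmpA [rV g _ \c _]cmpA.
have -> : rV g (m ⊗ m ⊗ one) \c (m *> c h one) = (m *> (S g *> c h one)) \c rV g (S h ⊗ one).
  by rewrite rV_nat.
rewrite -cmpA Hb cmpA -lwM Ha tmZr cmpZl cmpZr scalerA lwM; congr (_ *: _).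
by rewrite -[LHS]cmpA [(m *> q _ _ _) \c _]cmpA -lwM qK tm11 cmp1l.
Qed.

Lemma A2_e g i j : A2 g (eU (inr (i, j))) =
  \sum_h invmx (N g) h i *: \sum_n M g n j *: eU (inr (h, n)).
Proof.
rewrite /A2 [LHS]cmpA lc1 mu_rw mulmx1 -[LHS]cmpA HM.
rewrite cmp_suml; apply: eq_bigr => h _; rewrite cmpZl cmp_sumr.
by congr (_ *: _); apply: eq_bigr => n _; rewrite cmpZr.
Qed.

Lemma A2_f g i j : A2 g (fU (inr (i, j))) = \sum_h M g h i *: fU (inr (h, j)).
Proof.
rewrite /A2 [LHS]cmpA -lwM HM tm_sumr cmp_suml.
by apply: eq_bigr => h _; rewrite tmZr cmpZl.
Qed.

Lemma gap_data_of_matrices : gap_data R gT k.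
Proof.
apply: (@GapData R gT k U L M (fun g => invmx (N g)) Q eU fU A0 A1 A2).
- exact: M1.
- exact: MM.
- exact: LM_comm.
- by move=> g h; rewrite -{1}[M h](mulmxK (N_unit g)) -NM_comm -!mulmxA mulKmx ?N_unit.
- by move=> g h; rewrite -{1}[L g](mulKmx (N_unit h)) -LN_comm -!mulmxA mulmxV ?N_unit ?mulmx1.
- exact: Q_unit.
- exact: MQ.
- exact: NQ.
- exact: has_dual_basis_of eD_eU eU_span.
- exact: has_dual_basis_of fD_fU fU_span.
- by move=> g a u u'; rewrite /A0 (tmr_is_linear (idm (S g))) cmpDr cmpZr cmpDl cmpZl.
- by move=> g a u u'; rewrite /A1 cmpDr cmpZr.
- by move=> g a u u'; rewrite /A2 cmpDr cmpZr.
- by move=> u; rewrite /A1 mu1 cmp1l.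
- by move=> g h u; rewrite /A1 cmpA muM.
- exact: A0_e.
- exact: A0_f.
- exact: A0_f1.
- exact: A1_e.
- exact: A1_e1.
- exact: A1_f.
- exact: A1_f1.
- exact: A2_e.
- exact: A2_f.
Qed.

End Q.
End Matrices.
End MM.

(** * From the fusion rules to the gap data *)

Lemma n21_n12 x y z (f : Hom (tob x y) z) (g : Hom z (tob x y)) T :
  n21 f T \c n12 g T = (f \c g) <* T.
Proof. by rewrite /= cmpA -[X in X \c _]cmpA asoVK cmp1r rwM. Qed.

Lemma n12_n21 x y z (f : Hom (tob x y) z) (g : Hom z (tob x y)) T :
  n12 g T \c n21 f T = aso x y T \c ((g \c f) <* T) \c asoV x y T.
Proof. by rewrite /= rwM !cmpA. Qed.

Lemma iso_nt x y z : iso (tob x y) z ->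
  exists (a : nt (tF x ** tF y) (tF z)) (b : nt (tF z) (tF x ** tF y)),
    (forall T, a T \c b T = idm _) /\ (forall T, b T \c a T = idm _).
Proof.
case=> f [g [fg gf]]; exists (n21 f), (n12 g); split=> T.
  by rewrite n21_n12 fg tm11.
by rewrite n12_n21 gf tm11 cmp1r asoK.
Qed.

Section Direct.
Hypothesis fus_mm : is_dsum (tob m m) (fun j => s (@mm_index gT k j)).

Let o (x : gT + 'I_k) : option gT := if x is inl g then Some g else None.
Let pos (x : gT + 'I_k) : 'I_(#|gT| + k) :=
  match x with inl g => lshift k (enum_rank g) | inr i => rshift #|gT| i end.

Let mm_index_pos x : mm_index (pos x) = o x.
Proof.
case: x => [g|i]; rewrite /mm_index /=; first by rewrite ltn_ord nth_enum_rank.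
by rewrite ltnNge leq_addr.
Qed.

Let pos_inj : injective pos.
Proof.
move=> [g|i] [h|j] /eqP; rewrite ?eq_lshift ?eq_rshift ?eq_lrshift ?eq_rlshift //.
  by move/eqP/enum_rank_inj->.
by move/eqP->.
Qed.

Lemma dsum_mm : exists (I : forall x, Hom (s (o x)) (m ⊗ m)) (P : forall x, Hom (m ⊗ m) (s (o x))),
  [/\ forall x, P x \c I x = idm _, forall x y, x != y -> P x \c I y = 0
    & \sum_x (I x \c P x) = idm _].
Proof.
have [i [p [pi1 pi0 ip]]] := fus_mm.
(* [mm_index (pos x)] and [o x] are equal only propositionally. The transported pair is packed with
   facts whose statements contain no cast, so one rewriting of the index settles all of them. *)
have Hx x : exists IP : Hom (s (o x)) (m ⊗ m) * Hom (m ⊗ m) (s (o x)),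
  [/\ IP.2 \c IP.1 = idm _, IP.1 \c IP.2 = i (pos x) \c p (pos x),
    forall z (f : Hom z (m ⊗ m)), p (pos x) \c f = 0 -> IP.2 \c f = 0 &
    forall z (f : Hom (m ⊗ m) z), f \c i (pos x) = 0 -> f \c IP.1 = 0].
  move: (i (pos x)) (p (pos x)) (pi1 (pos x)); rewrite mm_index_pos => a b ba.
  by exists (a, b).
have [IP HIP] := fin_all_exists Hx.
exists (fun x => (IP x).1), (fun x => (IP x).2); split=> [x|x y xy|].
- by case: (HIP x).
- have [_ _ _ H1] := HIP y; have [_ _ H2 _] := HIP x.
  by apply/H1/H2/pi0; rewrite (inj_eq pos_inj).
- rewrite -ip big_split_ord /= big_sumType /=; congr (_ + _).
    rewrite (reindex (@enum_rank gT)) /=; last exact: onW_bij (@enum_rank_bij _).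
    by apply: eq_bigr => g _; have [_ -> _ _] := HIP (inl g).
  by apply: eq_bigr => j _; have [_ -> _ _] := HIP (inr j).
Qed.

Hypotheses (fus_gg : forall g h, iso (tob (S g) (S h)) (S (g * h)%g))
  (fus_gm : forall g, iso (tob (S g) m) m) (fus_mg : forall g, iso (tob m (S g)) m)
  (k_gt0 : (0 < k)%N) (card_gT : #|gT| = k.+1).

Lemma gap_data_of_fusion : inhabited (gap_data R gT k).
Proof.
have [I [P [PI1 PI0 IP]]] := dsum_mm.
pose c g : nt (tF (S g)) (tF m ** tF m) := n12 (I (inl g)).
pose d g : nt (tF m ** tF m) (tF (S g)) := n21 (P (inl g)).
pose v i : nt (tF m) (tF m ** tF m) := n12 (I (inr i)).
pose w i : nt (tF m ** tF m) (tF m) := n21 (P (inr i)).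
have dc1 g T : d g T \c c g T = idm _ by rewrite n21_n12 (PI1 (inl g)) tm11.
have C0 x y (xy : x != y) T : n21 (P x) T \c n12 (I y) T = 0.
  by rewrite /= cmpA -[X in X \c _]cmpA asoVK cmp1r -rwM PI0 // tm0l.
have dc0 g h T : g != h -> d g T \c c h T = 0.
  by move=> gh; apply: (C0 (inl g) (inl h)); apply: contra gh => /eqP[->].
have dv g i T : d g T \c v i T = 0 by apply: (C0 (inl g) (inr i)).
have wc g i T : w i T \c c g T = 0 by apply: (C0 (inr i) (inl g)).
have wv i j T : w i T \c v j T = (i == j)%:R *: idm _.
  case: eqVneq => [<-|ij]; first by rewrite n21_n12 (PI1 (inr i)) tm11 scale1r.
  by rewrite scale0r; apply: (C0 (inr i) (inr j)); apply: contra ij => /eqP[->].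
have cdvw T : \sum_g (c g T \c d g T) + \sum_i (v i T \c w i T) = idm (m ⊗ m ⊗ T).
  transitivity (\sum_x (n12 (I x) T \c n21 (P x) T)); first by rewrite big_sumType.
  rewrite (eq_bigr (fun x => aso m m T \c (((I x \c P x) <* T) \c asoV m m T))).
    by rewrite -cmp_sumr -cmp_suml -tm_suml IP tm11 cmp1l asoK.
  by move=> x _; rewrite n12_n21 cmpA.
have [l /fin_all_exists[lV Hl]] := fin_all_exists (fun g => iso_nt (fus_gm g)).
have [r0 /fin_all_exists[rV0 Hr]] := fin_all_exists (fun g => iso_nt (fus_mg g)).
have /fin_all_exists[q0 /fin_all_exists[qV0 Hq0]] := fun gh : gT * gT => iso_nt (fus_gg gh.1 gh.2).
pose q g h := q0 (g, h); pose qV g h := qV0 (g, h).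
have qK g h T : q g h T \c qV g h T = idm _ by case: (Hq0 (g, h)) => E _; exact: E.
have qVK g h T : qV g h T \c q g h T = idm _ by case: (Hq0 (g, h)) => _ E; exact: E.
have lK g T : l g T \c lV g T = idm _ by case: (Hl g).
have lVK g T : lV g T \c l g T = idm _ by case: (Hl g).
pose mu0 g := ncmp (nlw m (l g)) (nrw12 (tF m) (rV0 g)).
have [a Ha] := fin_all_exists (fun g => nt_c cdvw (ncmp (mu0 g) (c 1%g))).
have a0 g : a g != 0.
  apply: contraNneq (id1_neq0 (Some 1%g)) => ag0; have := Ha g one; rewrite ag0 scale0r.
  have K : (r0 g (m ⊗ one) \c (m *> lV g one)) \c mu0 g one = idm _.
    rewrite /= -!cmpA [(m *> _) \c (_ \c _)]cmpA -lwM lVK tm11 cmp1l.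
    exact: (proj1 (Hr g)).
  by move/(cmp_eq0 K) => E; rewrite -(dc1 1%g one) E cmp0r.
(* The unnormalised middle action multiplies [c 1] by the nonzero [a g]; since it involves the
   inverse of [r0 g], rescaling [r0 g] by [a g] makes it fix [c 1]. *)
pose r g := nscale (a g) (r0 g); pose rV g := nscale (a g)^-1 (rV0 g).
have rK g T : r g T \c rV g T = idm _.
  by rewrite /= cmpZl cmpZr scalerA mulfV // scale1r (proj1 (Hr g)).
have rVK g T : rV g T \c r g T = idm _.
  by rewrite /= cmpZl cmpZr scalerA mulVf // scale1r (proj2 (Hr g)).
have muc g T : mu l rV g T \c c 1%g T = c 1%g T.
  rewrite /= cmpZr cmpZl; apply: (scalerI (a0 g)); rewrite scalerA mulfV // scale1r.
  exact: Ha.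
have [L HL] := L_ex cdvw lVK.
have [M HM] := M_ex cdvw l rV.
have [N HN] := R_ex cdvw rVK.
have [Q HQ] := Q_ex cdvw lVK.
constructor.
apply: (gap_data_of_matrices dc1 dc0 dv wc wv cdvw lK lVK rK rVK qK qVK muc HL HM HN k_gt0 card_gT HQ).
Qed.

End Direct.
End NearGroup.
End Strict.

Lemma gap_data_of_category (R : fieldType) (gT : finGroupType) (k : nat) :
  (0 < k)%N -> #|gT| = k.+1 -> NearGroupCategory R gT k -> inhabited (gap_data R gT k).
Proof.
move=> k_gt0 card_gT [C Ccat Cbil Cten Cass Cuni _ s s_end s_hom _ _ fgg fgm fmg fmm].
exact: (gap_data_of_fusion Ccat Cbil Cten Cass Cuni s_end s_hom fmm fgg fgm fmg).
Qed.

(** * Dimension counts *)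

Section LinearAlgebra.
Variable R : fieldType.

Definition hom_of (V W : vectType R) (f : V -> W) (lf : linear f) : 'Hom(V, W) :=
  linfun (HB.pack_for {linear V -> W} f (GRing.isLinear.Build R V W _ f lf)).

Lemma hom_ofE (V W : vectType R) (f : V -> W) (lf : linear f) v : hom_of lf v = f v.
Proof. by rewrite lfunE. Qed.

Definition sols (I : finType) (V W : vectType R) (F : I -> 'Hom(V, W)) : {vspace V} :=
  (\bigcap_i lker (F i))%VS.

Lemma solsP (I : finType) (V W : vectType R) (F : I -> 'Hom(V, W)) v :
  reflect (forall i, F i v = 0) (v \in sols F).
Proof.
rewrite memvE; apply: (iffP subv_bigcapP) => H i.
  by apply/eqP; rewrite -memv_ker memvE; exact: H.
by rewrite -memvE memv_ker H.
Qed.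

Lemma dim_bij (V W : vectType R) (S : {vspace V}) (T : {vspace W}) (f : V -> W) (g : W -> V) :
  linear f -> (forall v, v \in S -> f v \in T) -> (forall w, w \in T -> g w \in S) ->
  {in S, cancel f g} -> {in T, cancel g f} -> \dim S = \dim T.
Proof.
move=> lf fST gTS fK gK; rewrite -[RHS](_ : \dim (hom_of lf @: S) = _).
  apply/esym/limg_dim_eq/eqP; rewrite -subv0; apply/subvP => v.
  rewrite memv_cap memv_ker hom_ofE memv0 => /andP[vS /eqP fv0].
  have f0 : f 0 = 0 by rewrite -(hom_ofE lf) linear0.
  by rewrite -[v]fK // fv0 -{1}f0 fK ?mem0v.
congr (\dim _); apply/vspaceP => w; apply/memv_imgP/idP => [[v vS ->]|wT].
  by rewrite hom_ofE fST.
by exists (g w); rewrite ?gTS // hom_ofE gK.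
Qed.

Lemma dim_bijf (V W : vectType R) (S : {vspace V}) (f : V -> W) (g : W -> V) :
  linear f -> (forall w, g w \in S) ->
  {in S, cancel f g} -> cancel g f -> \dim S = dim W.
Proof.
move=> lf gS fK gK; rewrite -dimvf; apply: (dim_bij lf) fK _ => // *; exact: memvf.
Qed.

End LinearAlgebra.

Section Representations.
Variables (R : fieldType) (gT : finGroupType).

Definition is_rep (W : vectType R) (rho : gT -> 'End(W)) : Prop :=
  (forall w, rho 1%g w = w) /\ (forall g h w, rho (g * h)%g w = rho g (rho h w)).

Definition invar (W : vectType R) (rho : gT -> 'End(W)) := sols (fun g => rho g - \1)%VF.

Lemma invarP (W : vectType R) (rho : gT -> 'End(W)) w :
  reflect (forall g, rho g w = w) (w \in invar rho).
Proof.
apply: (iffP (solsP _ _)) => H g.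
  by have /eqP := H g; rewrite add_lfunE opp_lfunE id_lfunE subr_eq0 => /eqP.
by rewrite add_lfunE opp_lfunE id_lfunE H subrr.
Qed.

Section Homs.
Variables (k : nat) (M : gT -> 'M[R]_k).
Hypotheses (M1 : M 1%g = 1%:M) (MM : forall g h, M g *m M h = M (g * h)%g).
Variables (W : vectType R) (rho : gT -> 'End(W)).
Hypothesis rhoP : is_rep rho.

(* [{ffun 'I_k -> W}] stands for the linear maps from the module of [M] to [W]. *)
Fact homr_linear g : linear (fun w : {ffun 'I_k -> W} =>
  [ffun i => \sum_h M g^-1%g h i *: rho g (w h)]).
Proof.
move=> a u v; apply/ffunP => i; rewrite !ffunE scaler_sumr -big_split.
by apply: eq_bigr => h _; rewrite !ffunE linearP scalerDr !scalerA mulrC.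
Qed.
Definition homr g : 'End({ffun 'I_k -> W}) := hom_of (homr_linear g).

Lemma homr_rep : is_rep homr.
Proof.
have [r1 rM] := rhoP; split=> [w|g h w]; apply/ffunP => i; rewrite !hom_ofE !ffunE.
  rewrite invg1 M1 (bigD1 i) //= mxE eqxx scale1r r1 big1 ?addr0 // => j ji.
  by rewrite mxE (negPf ji) scale0r.
rewrite invMg -MM.
under eq_bigr => l _ do rewrite mxE scaler_suml rM.
rewrite exchange_big; apply: eq_bigr => j _; rewrite ffunE linear_sum scaler_sumr.
by apply: eq_bigr => l _; rewrite linearZ /= scalerA mulrC.
Qed.

(** The invariants are the intertwiners from [M] to [rho]; their dimension plays the role of a
    multiplicity, with no semisimplicity assumed. *)
Lemma invar_homrP (w : {ffun 'I_k -> W}) :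
  reflect (forall g i, rho g (w i) = \sum_h M g h i *: w h) (w \in invar homr).
Proof.
have [r1 rM] := rhoP.
apply: (iffP (invarP _ _)) => H g.
  move=> i; rewrite -{1}(H g^-1%g) hom_ofE ffunE linear_sum invgK; apply: eq_bigr => h _.
  by rewrite linearZ /= -rM mulgV r1.
apply/ffunP => i; rewrite hom_ofE ffunE.
transitivity (rho g (\sum_h M g^-1%g h i *: w h)).
  by rewrite linear_sum; apply: eq_bigr => h _; rewrite linearZ.
by rewrite -H -rM mulgV r1.
Qed.

Lemma homrE g (w : {ffun 'I_k -> W}) j :
  rho g (w j) = \sum_l M g l j *: homr g w l.
Proof.
have E h : \sum_l M g l j * M g^-1%g h l = (h == j)%:R.
  have /matrixP/(_ h j) := MM g^-1%g g; rewrite mulVg M1 !mxE => <-.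
  by apply: eq_bigr => l _; rewrite mulrC.
under eq_bigr => l _ do rewrite hom_ofE ffunE scaler_sumr.
rewrite exchange_big (bigD1 j) //= [X in _ + X]big1 ?addr0 => [|h hj];
  under eq_bigr => l _ do rewrite scalerA; rewrite -scaler_suml E.
  by rewrite eqxx scale1r.
by rewrite (negPf hj) scale0r.
Qed.

End Homs.

Lemma dim_invar_homr_conj k (L M : gT -> 'M[R]_k) (Q : 'M[R]_k) (W : vectType R)
    (rho : gT -> 'End(W)) :
  is_rep rho -> Q \in unitmx -> (forall g, M g *m Q = Q *m L g) ->
  \dim (invar (homr M rho)) = \dim (invar (homr L rho)).
Proof.
move=> rhoP Qu MQ.
pose act (A : 'M[R]_k) (w : {ffun 'I_k -> W}) := [ffun i => \sum_l A l i *: w l].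
have actM A B w : act A (act B w) = act (B *m A) w.
  apply/ffunP => i; rewrite !ffunE; under eq_bigr do rewrite ffunE scaler_sumr.
  rewrite exchange_big; apply: eq_bigr => l _ /=; rewrite mxE scaler_suml.
  by apply: eq_bigr => h _; rewrite scalerA mulrC.
have act1 w : act 1%:M w = w.
  apply/ffunP => i; rewrite ffunE (bigD1 i) //= mxE eqxx scale1r big1 ?addr0 // => j ji.
  by rewrite mxE (negPf ji) scale0r.
have act_inv A (X Y : gT -> 'M[R]_k) : (forall g, X g *m A = A *m Y g) ->
    forall w, w \in invar (homr X rho) -> act A w \in invar (homr Y rho).
  move=> XA w /(invar_homrP _ rhoP) H; apply/(invar_homrP _ rhoP) => g i.
  transitivity (act (X g *m A) w i); last by rewrite XA -actM ffunE.
  rewrite -actM !ffunE linear_sum; apply: eq_bigr => l _; rewrite linearZ /= H ffunE.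
  by [].
apply: (@dim_bij _ _ _ _ _ (act Q) (act (invmx Q))).
- move=> a u v; apply/ffunP => i; rewrite !ffunE scaler_sumr -big_split.
  by apply: eq_bigr => l _; rewrite !ffunE scalerDr !scalerA mulrC.
- exact: act_inv.
- by apply: act_inv => g; rewrite -[L g](mulKmx Qu) -MQ -!mulmxA mulmxV ?mulmx1.
- by move=> w _; rewrite actM mulmxV ?act1.
- by move=> w _; rewrite actM mulVmx ?act1.
Qed.

End Representations.

Section Gap.
Variables (R : fieldType) (gT : finGroupType) (k : nat) (G : gap_data R gT k).
Local Notation L := (gL G).
Local Notation M := (gM G).
Local Notation U := (gU G).
Local Notation e := (@ge _ _ _ G).
Local Notation f := (@gf _ _ _ G).
Local Notation A1 := (@gA1 _ _ _ G).

Lemma gL1 : L 1%g = 1%:M.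
Proof.
by rewrite -[LHS](mulKmx (gQ_unit G)) -gMQ gM1 mul1mx mulVmx ?gQ_unit.
Qed.

Lemma gLM g h : L g *m L h = L (g * h)%g.
Proof.
rewrite -[LHS](mulKmx (gQ_unit G)) [gQ G *m _]mulmxA -gMQ -[M g *m _ *m _]mulmxA -gMQ.
rewrite [M g *m _]mulmxA gMM gMQ.
by rewrite mulKmx ?gQ_unit.
Qed.

Lemma extend_basis (I : finType) (b : I -> U) (W : vectType R) : has_dual_basis b ->
  exists ext : (I -> W) -> 'Hom(U, W), (forall a x, ext a (b x) = a x) /\
    (forall phi psi : 'Hom(U, W), (forall x, phi (b x) = psi (b x)) -> phi = psi).
Proof.
case=> beta [lin span dual].
have lext (a : I -> W) : linear (fun u => \sum_z beta z u *: a z).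
  move=> c u v; rewrite scaler_sumr -big_split; apply: eq_bigr => z _.
  by rewrite lin scalerDl scalerA.
exists (fun a => hom_of (lext a)); split=> [a x|phi psi E].
  rewrite hom_ofE (bigD1 x) //= dual eqxx scale1r big1 ?addr0 // => y yx.
  by rewrite dual (negPf yx) scale0r.
apply/lfunP => u; rewrite [u]span !linear_sum; apply: eq_bigr => x _.
by rewrite !linearZ /= E.
Qed.

Section HomU.
Variables (W : vectType R) (rho : gT -> 'End(W)).
Hypothesis rhoP : is_rep rho.

Let a1 g : 'End(U) := hom_of (@gA1_lin _ _ _ G g).

Fact equivar_linear g : linear (fun phi : 'Hom(U, W) => ((phi \o a1 g) - (rho g \o phi))%VF).
Proof.
move=> a phi psi; apply/lfunP => u.
rewrite !(add_lfunE, opp_lfunE, scale_lfunE, comp_lfunE) linearP /= scalerBr opprD.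
by rewrite addrACA.
Qed.

Definition homU : {vspace 'Hom(U, W)} := sols (fun g => hom_of (equivar_linear g)).

Lemma homUP (phi : 'Hom(U, W)) : reflect (forall g u, phi (A1 g u) = rho g (phi u)) (phi \in homU).
Proof.
apply: (iffP (solsP _ _)) => H g.
  move=> u; have := H g; rewrite hom_ofE => /lfunP/(_ u)/eqP.
  by rewrite !(add_lfunE, opp_lfunE, comp_lfunE) hom_ofE zero_lfunE subr_eq0 => /eqP.
rewrite hom_ofE; apply/lfunP => u.
by rewrite !(add_lfunE, opp_lfunE, comp_lfunE) hom_ofE H zero_lfunE subrr.
Qed.

Lemma homU_basis (I : finType) (b : I -> U) (phi : 'Hom(U, W)) : has_dual_basis b ->
  (forall g x, phi (A1 g (b x)) = rho g (phi (b x))) -> phi \in homU.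
Proof.
move=> /(@extend_basis _ _ W)[ext [_ uniq]] H; apply/homUP => g u.
have := uniq (phi \o a1 g)%VF (rho g \o phi)%VF.
move/(_ _)/lfunP/(_ u); rewrite !comp_lfunE hom_ofE; apply => x.
by rewrite !comp_lfunE hom_ofE H.
Qed.

(** Along [e], under [gA1], the space [gU] is [|G|] copies of the trivial representation plus [k]
    copies of [M]. *)
Lemma dim_homU_e :
  \dim homU = (#|gT| * \dim (invar rho) + k * \dim (invar (homr M rho)))%N.
Proof.
pose V2 := ({ffun gT -> subvs_of (invar rho)} *
  {ffun 'I_k -> subvs_of (invar (homr M rho))})%type.
pose F (phi : 'Hom(U, W)) : V2 := ([ffun h => vsproj (invar rho) (phi (e (inl h)))],
  [ffun j => vsproj (invar (homr M rho)) [ffun i => phi (e (inr (i, j)))]]).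
have [ext [extE uniq]] := extend_basis W (ge_basis G).
pose F' (p : V2) := ext (fun x => match x with inl h => vsval (p.1 h)
  | inr ij => vsval (p.2 ij.2) ij.1 end).
have E : dim V2 = (#|gT| * \dim (invar rho) + #|'I_k| * \dim (invar (homr M rho)))%N by [].
transitivity (dim V2); last by rewrite E card_ord.
apply: (@dim_bijf _ _ V2 _ F F').
- move=> a phi psi; congr (_, _); apply/ffunP => h; rewrite !ffunE -linearP.
    by rewrite add_lfunE scale_lfunE.
  congr (vsproj _ _); apply/ffunP => i.
  by rewrite !ffunE add_lfunE scale_lfunE.
- move=> p; apply: (homU_basis (ge_basis G)) => g [h|[i j]].
    by rewrite gA1_e1 !extE; have /invarP-> := subvsP (p.1 h).
  rewrite gA1_e linear_sum extE /=.
  have /(invar_homrP _ rhoP) -> := subvsP (p.2 j).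
  by apply: eq_bigr => h _; rewrite linearZ /= extE.
- move=> phi /homUP H; apply: uniq => -[h|[i j]]; rewrite extE /= ffunE vsprojK ?ffunE //.
    by apply/invarP => g; rewrite -H gA1_e1.
  apply/(invar_homrP _ rhoP) => g l; rewrite !ffunE -H gA1_e linear_sum.
  by apply: eq_bigr => h _; rewrite linearZ /= ffunE.
- move=> [p q]; congr (_, _); apply/ffunP => h; rewrite ffunE ?extE ?vsvalK //.
  rewrite -[RHS]vsvalK; congr (vsproj _ _); apply/ffunP => i.
  by rewrite ffunE extE.
Qed.

(** Along [f], under [gA1], the space [gU] is a regular representation plus the tensor product of
    [L] and [M]. An intertwiner on the regular part is determined by the image of [f (inl 1)]; the
    scalars [y] record the rescaling of its translates. *)
Lemma dim_homU_f :
  \dim homU = (dim W + \dim (invar (homr L (homr M rho))))%N.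
Proof.
have [r1 rM] := rhoP.
have /fin_all_exists[y Hy] h : exists yh, yh != 0 /\ A1 h (f (inl 1%g)) = yh *: f (inl h).
  by have [yh y0 E] := @gA1_f1 _ _ _ G h 1%g; exists yh; rewrite E mulg1.
have y1 : y 1%g = 1.
  have [beta [lin _ dual]] := gf_basis G; have [_ /(congr1 (beta (inl 1%g)))] := Hy 1%g.
  by rewrite gA1_1 (linfZ (lin _)) dual eqxx => /esym; rewrite -[_ *: _]/(_ * _) mulr1.
pose V2 := (W * subvs_of (invar (homr L (homr M rho))))%type.
pose F (phi : 'Hom(U, W)) : V2 := (phi (f (inl 1%g)),
  vsproj (invar (homr L (homr M rho))) [ffun i => [ffun j => phi (f (inr (i, j)))]]).
have [ext [extE uniq]] := extend_basis W (gf_basis G).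
pose F' (p : V2) := ext (fun x => match x with inl h => (y h)^-1 *: rho h p.1
  | inr ij => vsval p.2 ij.1 ij.2 end).
have homrP2 (t : {ffun 'I_k -> {ffun 'I_k -> W}}) :
  (t \in invar (homr L (homr M rho))) <-> (forall g i j, rho g (t i j) =
     \sum_h L g h i *: \sum_n M g n j *: t h n).
  have HR := homr_rep (gM1 G) (gMM G) rhoP.
  split=> [/(invar_homrP _ HR) H g i j|H].
    rewrite (homrE (gM1 G) (gMM G)) H.
    under eq_bigr => l _ do rewrite sum_ffunE scaler_sumr.
    rewrite exchange_big; apply: eq_bigr => h _; rewrite scaler_sumr.
    by apply: eq_bigr => n _; rewrite ffunE !scalerA mulrC.
  apply/(invar_homrP _ HR) => g i; apply/ffunP => j; rewrite hom_ofE ffunE sum_ffunE.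
  under eq_bigr => h _ do rewrite H scaler_sumr.
  rewrite exchange_big; apply: eq_bigr => h _; rewrite ffunE.
  have E n : \sum_l M g n l * M g^-1%g l j = (n == j)%:R.
    by have /matrixP/(_ n j) := gMM G g g^-1%g; rewrite mulgV gM1 !mxE => <-.
  transitivity (L g h i *: \sum_n (n == j)%:R *: t h n).
    under [in RHS]eq_bigr => n _ do rewrite -E scaler_suml.
    rewrite exchange_big scaler_sumr; apply: eq_bigr => l _.
    rewrite scalerA mulrC -scalerA scaler_sumr; congr (_ *: _); apply: eq_bigr => n _.
    by rewrite scalerA mulrC.
  rewrite (bigD1 j) //= eqxx scale1r big1 ?addr0 // => n nj.
  by rewrite (negPf nj) scale0r.
apply: (@dim_bijf _ _ V2 _ F F').
- move=> a phi psi; rewrite /F [LHS](_ : _ = ((a *: phi + psi) (f (inl 1%g)),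
      vsproj (invar (homr L (homr M rho)))
        (a *: [ffun i => [ffun j => phi (f (inr (i, j)))]] +
         [ffun i => [ffun j => psi (f (inr (i, j)))]]))); last first.
    congr (_, vsproj _ _); apply/ffunP => i; apply/ffunP => j.
    by rewrite !ffunE add_lfunE scale_lfunE.
  by rewrite linearP add_lfunE scale_lfunE.
- move=> p; apply: (homU_basis (gf_basis G)) => g [h|[i j]].
    have [yh0 Eh] := Hy h; have [ygh0 Egh] := Hy (g * h)%g.
    have -> : f (inl h) = (y h)^-1 *: A1 h (f (inl 1%g)).
      by rewrite Eh scalerA mulVf // scale1r.
    rewrite (linfZ (@gA1_lin _ _ _ G g)) gA1_M Egh Eh !linearZ /= !extE /= !linearZ /= rM !scalerA.
    by rewrite !mulfV.
  rewrite gA1_f linear_sum extE /=.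
  have /homrP2 -> := subvsP p.2.
  apply: eq_bigr => h _; rewrite linearZ /= linear_sum; congr (_ *: _).
  by apply: eq_bigr => n _; rewrite linearZ /= extE.
- move=> phi /homUP H; apply: uniq => -[h|[i j]]; rewrite extE /=.
    have [yh0 Eh] := Hy h.
    by rewrite -H Eh linearZ /= scalerA mulVf // scale1r.
  rewrite vsprojK ?ffunE ?ffunE //; apply/homrP2 => g l n.
  rewrite !ffunE -H gA1_f linear_sum; apply: eq_bigr => h _; rewrite linearZ /= linear_sum.
  by congr (_ *: _); apply: eq_bigr => o _; rewrite linearZ /= !ffunE.
- move=> [w t]; congr (_, _); first by rewrite extE y1 invr1 scale1r r1.
  rewrite -[RHS]vsvalK; congr (vsproj _ _); apply/ffunP => i; apply/ffunP => j.
  by rewrite !ffunE extE.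
Qed.

End HomU.

Hypotheses (card_gT : #|gT| = k.+1).

(** Intertwiners to [rho] from [M] plus the trivial representation, minus those from the regular
    one. *)
Definition defect (W : vectType R) (rho : gT -> 'End(W)) : int :=
  (\dim (invar (homr M rho)))%:Z + (\dim (invar rho))%:Z - (dim W)%:Z.

(** Let [i] be the dimension of the invariants of [rho], and [h], [h'] the numbers of intertwiners
    from [M] to [rho] and to [homr M rho]. As [L] is conjugate to [M], the two counts give
    [|G| * i + k * h = dim W + h'], and [h' + h - k * dim W] becomes [|G| * (i + h - dim W)] by
    [|G| = k + 1]. *)
Lemma defect_homr (W : vectType R) (rho : gT -> 'End(W)) : is_rep rho ->
  defect (homr M rho) = #|gT|%:Z * defect rho.
Proof.
move=> rhoP; have HR := homr_rep (gM1 G) (gMM G) rhoP.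
have := dim_homU_f rhoP; rewrite (dim_homU_e rhoP) /defect.
rewrite -(dim_invar_homr_conj HR (gQ_unit G) (gMQ G)).
have -> : dim {ffun 'I_k -> W} = (k * dim W)%N by rewrite -[in RHS](card_ord k).
rewrite card_gT; lia.
Qed.

(** Bernoulli's inequality [(1 + 1/k)^j >= 1 + j/k], cleared of denominators. *)
Lemma bernoulli_k j : ((k + j) * k ^ j <= k * k.+1 ^ j)%N.
Proof. elim: j => [|j IH]; rewrite ?expn0 ?addn0 //= !expnS; nia. Qed.

Lemma defect_bound j (W : vectType R) (rho : gT -> 'End(W)) : is_rep rho ->
  (`|defect rho| * #|gT| ^ j <= #|gT| * dim W * k ^ j)%N.
Proof.
elim: j W rho => [|j IH] W rho rhoP.
  have i1 : (\dim (invar rho) <= dim W)%N by rewrite -dimvf dimvS ?subvf.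
  have i2 : (\dim (invar (homr M rho)) <= k * dim W)%N.
    have E : (k * dim W)%N = dim {ffun 'I_k -> W} by rewrite -[in LHS](card_ord k).
    by rewrite E -dimvf dimvS ?subvf.
  by rewrite /defect card_gT !expn0; lia.
have := IH _ _ (homr_rep (gM1 G) (gMM G) rhoP).
rewrite defect_homr // abszM /= expnS.
have -> : dim {ffun 'I_k -> W} = (k * dim W)%N by rewrite -[in RHS](card_ord k).
by rewrite expnS; nia.
Qed.

(* [M] plus the trivial representation behaves like the regular one: the defect
   is multiplied by [k + 1] when [W] is replaced by Hom(M, W), whose dimension is
   only [k] times larger, so it vanishes. *)
Lemma dim_hom_M (W : vectType R) (rho : gT -> 'End(W)) : (0 < k)%N -> is_rep rho ->
  (\dim (invar (homr M rho)) + \dim (invar rho))%N = dim W.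
Proof.
move=> k_gt0 rhoP; suff : `|defect rho|%N = 0%N by rewrite /defect; lia.
apply/eqP; rewrite -leqn0 leqNgt; apply/negP => d_gt0.
(* For a nonzero defect, [defect_bound] and Bernoulli at exponent [j] give [k + j <= k * C], which
   fails at [j = k * C + 1]. *)
set C := (#|gT| * dim W)%N; have := defect_bound (k * C).+1 rhoP; rewrite -/C => B.
have := bernoulli_k (k * C).+1; rewrite -card_gT => B2.
have p : (0 < k ^ (k * C).+1)%N by rewrite expn_gt0 k_gt0.
by move: (k ^ _)%N (#|gT| ^ _)%N B B2 p => X Y; nia.
Qed.

(** The [X g], each completed by the trivial representation, are linearly independent, as the
    operators of the regular representation are. *)
Definition affinely_free (X : gT -> 'M[R]_k) : Prop := forall c : gT -> R,
  \sum_g c g = 0 -> \sum_g c g *: X g = 0 -> forall g, c g = 0.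

(** Read along [e], such a relation annihilates all of [gU] under [gA1]. Applied to [f (inl 1)],
    whose translates lie on distinct basis lines, it has zero coefficients. *)
Lemma M_free : affinely_free M.
Proof.
move=> c c0 cM; have AE u : \sum_g c g *: A1 g u = 0.
  have [beta [_ span _]] := ge_basis G.
  rewrite [u]span; under eq_bigr => g _ do rewrite (linf_sum (@gA1_lin _ _ _ G g)) scaler_sumr.
  rewrite exchange_big big1 // => x _.
  under eq_bigr => g _ do rewrite (linfZ (@gA1_lin _ _ _ G g)) scalerA mulrC -scalerA.
  rewrite -scaler_sumr; case: x => [h|[i j]].
    by under eq_bigr => g _ do rewrite gA1_e1; rewrite -scaler_suml c0 scale0r scaler0.
  under eq_bigr => g _ do rewrite gA1_e scaler_sumr.
  rewrite exchange_big big1 ?scaler0 // => h _.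
  under eq_bigr => g _ do rewrite scalerA.
  rewrite -scaler_suml; have /matrixP/(_ h i) := cM.
  rewrite summxE !mxE; under eq_bigr => g _ do rewrite mxE.
  by move=> ->; rewrite scale0r.
have [beta [lin _ dual]] := gf_basis G => g.
have [y y0 Ey] := @gA1_f1 _ _ _ G g 1%g.
have := congr1 (beta (inl g)) (AE (f (inl 1%g))).
rewrite (linf_sum (lin _)) (linf0 (lin _)) (bigD1 g) //= big1 ?addr0 => [|h hg].
  rewrite (linfZ (lin _)) Ey (linfZ (lin _)) mulg1 dual eqxx.
  rewrite -[_ *: _]/(_ * _) -[_ *: _]/(_ * _) mulr1 => /eqP.
  by rewrite mulf_eq0 (negPf y0) orbF => /eqP.
have [z _ Ez] := @gA1_f1 _ _ _ G h 1%g.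
rewrite (linfZ (lin _)) Ez (linfZ (lin _)) mulg1 dual.
by rewrite (inj_eq (@inl_inj _ _)) eq_sym (negPf hg) !scaler0.
Qed.

Lemma affinely_free_conj (X Y : gT -> 'M[R]_k) (Q : 'M[R]_k) : Q \in unitmx ->
  (forall g, X g *m Q = Q *m Y g) -> affinely_free X -> affinely_free Y.
Proof.
move=> Qu XQ HX c c0 cY; apply: (HX c c0).
rewrite -[LHS](mulmxK Qu) mulmx_suml.
under eq_bigr => g _ do rewrite -scalemxAl XQ scalemxAr.
by rewrite -mulmx_sumr cY mulmx0 mul0mx.
Qed.

Lemma L_free : affinely_free L.
Proof. exact: affinely_free_conj (gQ_unit G) (gMQ G) M_free. Qed.

Lemma N_free : affinely_free (gN G).
Proof.
apply: (affinely_free_conj (Q := invmx (gQ G))) M_free; rewrite ?unitmx_inv ?gQ_unit //.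
by move=> g; rewrite -[LHS](mulKmx (gQ_unit G)) [gQ G *m _]mulmxA -gNQ mulmxK ?gQ_unit.
Qed.

Lemma affinely_free_inj X : affinely_free X -> injective X.
Proof.
move=> HX g h Xgh; apply/eqP; apply: contraT => gh.
have c0 : \sum_x ((x == g)%:R - (x == h)%:R : R) = 0.
  by rewrite sumrB (bigD1 g) //= (bigD1 (F := fun x => (x == h)%:R) h) //= !eqxx
    !big1 ?addr0 ?subrr // => x /negPf->.
have := HX _ c0; move/(_ _ g); rewrite eqxx (negPf gh) subr0 => /(_ _)/eqP.
rewrite oner_eq0; apply.
under eq_bigr => x _ do rewrite scalerBl.
rewrite sumrB (bigD1 g) //= [X in _ - X](bigD1 h) //= !eqxx !scale1r Xgh.
by rewrite !big1 ?addr0 ?subrr // => x /negPf->; rewrite scale0r.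
Qed.

Fact commutator_linear g : linear (fun X : 'M[R]_k => M g *m X - X *m M g).
Proof.
move=> a X Y; rewrite mulmxDr mulmxDl -scalemxAr -scalemxAl opprD addrACA.
by rewrite scalerBr.
Qed.

Definition commutant : {vspace 'M[R]_k} := sols (fun g => hom_of (commutator_linear g)).

Lemma commutantP X : reflect (forall g, M g *m X = X *m M g) (X \in commutant).
Proof.
apply: (iffP (solsP _ _)) => H g; have := H g; rewrite hom_ofE.
  by move/eqP; rewrite subr_eq0 => /eqP.
by move=> ->; rewrite subrr.
Qed.

Hypothesis k_gt0 : (0 < k)%N.

(** This is [dim_hom_M] for the column module of [M] itself, of dimension [k]. *)
Lemma dim_commutant : (\dim commutant <= k)%N.
Proof.
have lin g : linear (fun x : 'cV[R]_k => M g *m x).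
  by move=> a x y; rewrite mulmxDr -scalemxAr.
pose rho g : 'End('cV[R]_k) := hom_of (lin g).
have rhoP : is_rep rho.
  by split=> [w|g h w]; rewrite !hom_ofE ?gM1 ?mul1mx // mulmxA gMM.
have := dim_hom_M k_gt0 rhoP; have -> : dim 'cV[R]_k = k by exact: muln1.
move=> /eq_leq; suff -> : \dim commutant = \dim (invar (homr M rho)).
  exact: leq_trans (leq_addr _ _).
apply: (@dim_bij _ _ _ _ _ (fun X : 'M[R]_k => [ffun i => col i X])
   (fun w : {ffun 'I_k -> 'cV[R]_k} => \matrix_(i, j) w j i 0)).
- move=> a X Y; apply/ffunP => i; rewrite !ffunE.
  by apply/colP => j; rewrite !mxE.
- move=> X /commutantP H; apply/(invar_homrP _ rhoP) => g i; rewrite !ffunE hom_ofE.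
  apply/colP => j; transitivity ((M g *m X) j i).
    by rewrite !mxE; apply: eq_bigr => l _; rewrite mxE.
  rewrite H summxE mxE; apply: eq_bigr => h _.
  by rewrite ffunE !mxE mulrC.
- move=> w /(invar_homrP _ rhoP) H; apply/commutantP => g; apply/matrixP => i j.
  have /colP/(_ i) := H g j; rewrite hom_ofE summxE !mxE => E.
  transitivity (\sum_l M g i l * w j l 0); first by apply: eq_bigr => l _; rewrite mxE.
  by rewrite E; apply: eq_bigr => l _; rewrite !mxE mulrC.
- by move=> X _; apply/matrixP => i j; rewrite mxE ffunE mxE.
- by move=> w _; apply/ffunP => i; apply/colP => j; rewrite ffunE !mxE.
Qed.

(** The kernel of [c |-> \sum_g c g *: X g] meets the hyperplane of zero sum trivially, so it has
    dimension at most 1. The image then has dimension at least [k] and lies in the commutant, whose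
    dimension is at most [k]. *)
Lemma commutant_span (X : gT -> 'M[R]_k) : affinely_free X ->
  (forall g h, M g *m X h = X h *m M g) ->
  forall Y, Y \in commutant -> exists c : gT -> R, Y = \sum_g c g *: X g.
Proof.
move=> HX XM Y Yc.
have lin1 : linear (fun c : {ffun gT -> R^o} => \sum_g c g *: X g).
  move=> a c c'; rewrite scaler_sumr -big_split; apply: eq_bigr => g _.
  by rewrite !ffunE scalerDl scalerA.
have lin2 : linear (fun c : {ffun gT -> R^o} => \sum_g c g : R^o).
  move=> a c c'; rewrite scaler_sumr -big_split; apply: eq_bigr => g _.
  by rewrite !ffunE.
pose F := hom_of lin1; pose E := hom_of lin2.
have dim_limg_le (V : vectType R) (S : {vspace V}) (f : 'Hom(V, R^o)) : (\dim (f @: S) <= 1)%N.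
  by have := dimvS (subvf (f @: S)); rewrite dimvf.
have kerF : (\dim (lker F) <= 1)%N.
  rewrite -(@limg_dim_eq _ _ _ E (lker F)); first exact: dim_limg_le.
  apply/eqP; rewrite -subv0; apply/subvP => c; rewrite memv_cap !memv_ker memv0 !hom_ofE.
  move=> /andP[/eqP Fc /eqP Ec]; apply/eqP/ffunP => g; rewrite ffunE.
  exact: (HX c Ec Fc).
have : Y \in limg F.
  suff -> : limg F = commutant by [].
  apply/eqP; rewrite eqEdim; apply/andP; split.
    apply/subvP => _ /memv_imgP[c _ ->]; apply/commutantP => g; rewrite hom_ofE.
    rewrite mulmx_sumr mulmx_suml; apply: eq_bigr => h _.
    by rewrite -scalemxAr -scalemxAl XM.
  apply: leq_trans dim_commutant _.
  have := limg_ker_dim F fullv; rewrite capfv dimvf.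
  have -> : dim {ffun gT -> R^o} = k.+1 by rewrite -card_gT; exact: muln1.
  by move: kerF; lia.
by case/memv_imgP => c _ ->; exists c; rewrite hom_ofE.
Qed.

Lemma gT_abelian (g h : gT) : (g * h = h * g)%g.
Proof.
apply: (affinely_free_inj L_free); rewrite -!gLM.
have LMC a b : M a *m L b = L b *m M a by rewrite gLMC.
have NMC a b : M a *m gN G b = gN G b *m M a by rewrite gNMC.
have [|c ->] := commutant_span N_free NMC (Y := L g).
  by apply/commutantP => a; rewrite LMC.
rewrite mulmx_sumr mulmx_suml; apply: eq_bigr => a _.
by rewrite -scalemxAr -scalemxAl gLNC.
Qed.

End Gap.

Lemma col_mulmx (R : pzSemiRingType) m n p (A : 'M[R]_(m, n)) (B : 'M[R]_(n, p)) i :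
  col i (A *m B) = A *m col i B.
Proof. by apply/colP => j; rewrite !mxE; apply: eq_bigr => h _; rewrite mxE. Qed.

(** * Characters *)

Section RootsOfUnity.
Variables (R : closedFieldType) (n : nat).
Hypothesis nR : n%:R != 0 :> R.

Lemma unity_roots : exists2 rs : seq R, uniq rs & 'X^n - 1 = \prod_(z <- rs) ('X - z%:P).
Proof.
have n_gt0 : (0 < n)%N by case: n nR => //; rewrite eqxx.
have [rs Drs] := closed_field_poly_normal ('X^n - 1 : {poly R}).
move: Drs; rewrite (monicP (monic_Xn_sub_1 R n_gt0)) scale1r => Drs.
by exists rs; rewrite // -separable_prod_XsubC -Drs separable_Xn_sub_1.
Qed.

Lemma closed_prim_root : exists z : R, n.-primitive_root z.
Proof.
have n_gt0 : (0 < n)%N by case: n nR => //; rewrite eqxx.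
have [rs Urs Drs] := unity_roots.
have sz : size rs = n.
  by apply: succn_inj; rewrite -(size_prod_XsubC rs id) -Drs size_Xn_sub_1.
have /hasP[z _ Hz] : has n.-primitive_root rs.
  rewrite has_prim_root ?sz //; apply/allP => z zrs.
  by rewrite /root_of_unity Drs root_prod_XsubC.
by exists z.
Qed.

(** [A] is annihilated by ['X^n - 1], which splits with distinct roots. The iteration stands for a
    power of [A], since the ring structure on square matrices requires a positive size. *)
Lemma unipotent_diagonalizable m (A : 'M[R]_m) :
  (forall B : 'M[R]_m, iter n (mulmx A) B = B) -> diagonalizable A.
Proof.
case: m A => [|m] A An; first by rewrite thinmx0; exact: diagonalizable0.
have [rs Urs Drs] := unity_roots.
apply/diagonalizableP; exists rs; rewrite // -Drs; apply/mxminpoly_minP.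
rewrite rmorphB rmorphXn /= horner_mx_X rmorph1; apply/eqP; rewrite subr_eq0.
by have := An 1; rewrite -[A ^+ n]mulr1 -iter_mulr => ->.
Qed.

End RootsOfUnity.

Section Characters.
Variables (R : closedFieldType) (gT : finGroupType) (k : nat) (G : gap_data R gT k).
Hypotheses (k_gt0 : (0 < k)%N) (card_gT : #|gT| = k.+1) (charR : #|gT|%:R != 0 :> R).
Local Notation L := (gL G).
Local Notation M := (gM G).
Local Notation N := (gN G).
Local Notation Q := (gQ G).

Definition is_char (chi : gT -> R) : Prop :=
  chi 1%g = 1 /\ forall g h, chi (g * h)%g = chi g * chi h.

Section Multiplicity.
Variables (X : gT -> 'M[R]_k) (P : 'M[R]_k).
Hypotheses (Pu : P \in unitmx) (MP : forall g, M g *m P = P *m X g).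
Variable chi : gT -> R.
Hypothesis chiP : is_char chi.

Fact scale_linear g : linear (fun w : R^o => chi g *: w).
Proof. by move=> a u v; rewrite scalerDr !scalerA mulrC. Qed.
Let rho g : 'End(R^o) := hom_of (@scale_linear g).

Let rhoP : is_rep rho.
Proof.
have [c1 cM] := chiP; split=> [w|g h w]; rewrite !hom_ofE; first by rewrite c1 scale1r.
by rewrite cM scalerA.
Qed.

(** [dim_hom_M] for the line on which G acts by [chi]: a nontrivial character occurs exactly once in
    [X], the trivial one never. The three lemmas on eigenvectors below are read off from this
    equation. *)
Let dims : (\dim (invar (homr X rho)) + \dim (invar rho))%N = 1%N.
Proof. by rewrite -(dim_invar_homr_conj rhoP Pu MP) dim_hom_M. Qed.

Let eigen_mem (w : 'rV[R]_k) : (forall g, w *m X g = chi g *: w) ->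
  [ffun i => w 0 i : R^o] \in invar (homr X rho).
Proof.
move=> H; apply/(invar_homrP _ rhoP) => g i; rewrite hom_ofE ffunE.
have /rowP/(_ i) := H g; rewrite !mxE => E; rewrite -[_ *: _]/(_ * _) -E.
by apply: eq_bigr => h _; rewrite ffunE mulrC.
Qed.

Lemma eigen_uniq (w w' : 'rV[R]_k) : w != 0 ->
  (forall g, w *m X g = chi g *: w) -> (forall g, w' *m X g = chi g *: w') ->
  exists c, w' = c *: w.
Proof.
move=> w0 /eigen_mem Hw /eigen_mem Hw'.
set v := finfun _ in Hw; set v' := finfun _ in Hw'.
have v0 : v != 0.
  apply: contraNneq w0 => E; apply/eqP/rowP => i.
  by have /ffunP/(_ i) := E; rewrite !ffunE mxE.
have : v' \in <[v]>%VS.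
  suff -> : <[v]>%VS = invar (homr X rho) by [].
  apply/eqP; rewrite eqEdim -memvE Hw dim_vline v0 /=.
  by rewrite -dims leq_addr.
case/vlineP => c E; exists c; apply/rowP => i.
by have /ffunP/(_ i) := E; rewrite !ffunE mxE.
Qed.

Lemma eigen_triv (w : 'rV[R]_k) : (forall g, chi g = 1) ->
  (forall g, w *m X g = chi g *: w) -> w = 0.
Proof.
move=> chi1 /eigen_mem; have : invar (homr X rho) = 0%VS.
  apply/eqP; rewrite -dimv_eq0.
  have : invar rho = fullv.
    by apply/eqP; rewrite eqEsubv subvf; apply/subvP => u _; apply/invarP => g;
      rewrite hom_ofE chi1 scale1r.
  move=> E; have := dims; rewrite E dimvf /= -[dim R^o]/1%N addn1.
  by case=> ->.
move=> -> ; rewrite memv0 => /eqP/ffunP E; apply/rowP => i.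
by have := E i; rewrite !ffunE mxE.
Qed.

Lemma eigen_ex g0 : chi g0 != 1 ->
  exists2 w : 'rV[R]_k, w != 0 & forall g, w *m X g = chi g *: w.
Proof.
move=> chi1; have inv0 : invar rho = 0%VS.
  apply/eqP; rewrite -subv0; apply/subvP => u /invarP/(_ g0); rewrite hom_ofE memv0.
  rewrite -[X in _ = X]scale1r => /eqP; rewrite -subr_eq0 -scalerBl scaler_eq0 subr_eq0.
  by rewrite (negPf chi1).
have := dims; rewrite inv0 dimv0 addn0 => d1.
pose v := vpick (invar (homr X rho)).
have v0 : v != 0 by rewrite vpick0 -dimv_eq0 d1.
have /(invar_homrP _ rhoP) Hv : v \in invar (homr X rho) by exact: memv_pick.
exists (\row_i v i).
  apply: contraNneq v0 => /rowP E; apply/eqP/ffunP => i.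
  by have := E i; rewrite !mxE ffunE.
move=> g; apply/rowP => i; have := Hv g i; rewrite hom_ofE !mxE => E.
rewrite -[RHS]/(chi g *: v i) E; apply: eq_bigr => h _.
by rewrite mxE mulrC.
Qed.

End Multiplicity.

Let MM := gMM G.

Lemma diag_M : exists2 D : 'M[R]_k, D \in unitmx &
  exists chi : 'I_k -> gT -> R, forall i g, row i D *m M g = chi i g *: row i D.
Proof.
have : codiagonalizable [seq M g | g : gT].
  apply/codiagonalizableP; split=> [_ _ /mapP[g _ ->] /mapP[h _ ->]|_ /mapP[g _ ->]].
    by rewrite /comm_mx !MM (gT_abelian G).
  apply: (unipotent_diagonalizable charR) => B.
  suff E j : iter j (mulmx (M g)) B = M (g ^+ j)%g *m B.
    by rewrite E -cardsT expg_cardG ?inE // gM1 mul1mx.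
  elim: j => [|j IH]; first by rewrite expg0 gM1 mul1mx.
  by rewrite iterS IH mulmxA MM expgS.
case=> D Du /allP diagD; exists D => //.
have /fin_all_exists[d Hd] g : exists d, D *m M g = diag_mx d *m D.
  have /diagonalizable_forPex[d] := diagD (M g) (map_f _ (mem_enum _ g)).
  by move/(simmxPp (stablemx_unit _ Du)) => E; exists d.
exists (fun i g => d g 0 i) => i g.
by rewrite -row_mul Hd row_mul row_diag_mx -scalemxAl -rowE.
Qed.

Section Eigenbasis.
Variables (D : 'M[R]_k) (chi : 'I_k -> gT -> R).
Hypotheses (Du : D \in unitmx) (Dchi : forall i g, row i D *m M g = chi i g *: row i D).

Lemma rowD_neq0 i : row i D != 0.
Proof.
apply: contraTneq Du => Di0; apply/negP => /mulmxV /row_matrixP/(_ i).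
rewrite row_mul Di0 mul0mx row1 => /rowP/(_ i)/eqP.
by rewrite !mxE !eqxx eq_sym oner_eq0.
Qed.

Lemma rowD_scale i c c' : c *: row i D = c' *: row i D -> c = c'.
Proof.
move/eqP; rewrite -subr_eq0 -scalerBl scaler_eq0 (negPf (rowD_neq0 i)) orbF subr_eq0.
by move/eqP.
Qed.

Lemma rowD_inj i j c : row j D = c *: row i D -> i = j.
Proof.
move=> E; apply/eqP; apply: contraT => ij.
have /row_matrixP/(_ j) := mulmxV Du; rewrite row_mul E -scalemxAl -row_mul mulmxV //.
rewrite !row1 => /rowP/(_ j)/eqP; rewrite !mxE !eqxx (eq_sym j i) (negPf ij) mulr0.
by rewrite eq_sym oner_eq0.
Qed.

Lemma eigen_char (X : gT -> 'M[R]_k) (x : gT -> R) i : X 1%g = 1%:M ->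
  (forall g h, X g *m X h = X (g * h)%g) ->
  (forall g, row i D *m X g = x g *: row i D) -> is_char x.
Proof.
move=> X1 XM xE; split=> [|g h]; apply: (@rowD_scale i).
  by rewrite -xE X1 mulmx1 scale1r.
by rewrite -xE -XM mulmxA xE -scalemxAl xE scalerA.
Qed.

Lemma chi_char i : is_char (chi i).
Proof. exact: (eigen_char (gM1 G) MM (Dchi i)). Qed.

Let M1Q g : M g *m 1%:M = 1%:M *m M g. Proof. by rewrite mulmx1 mul1mx. Qed.

(** The eigenspaces of [M] are lines, one for each of its characters, and whatever commutes with [M]
    preserves each of them. *)
Lemma commuting_eigen (X : gT -> 'M[R]_k) : (forall g h, M g *m X h = X h *m M g) ->
  exists x : 'I_k -> gT -> R, forall i g, row i D *m X g = x i g *: row i D.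
Proof.
move=> MX; suff /fin_all_exists[x Hx] i : exists x : gT -> R, forall g,
  row i D *m X g = x g *: row i D by exists x.
apply: (fin_all_exists (P := fun g c => row i D *m X g = c *: row i D)) => g.
apply: (eigen_uniq (unitmx1 _ _) M1Q (chi_char i) (rowD_neq0 i) (Dchi i)) => h.
by rewrite -mulmxA -MX mulmxA Dchi -scalemxAl.
Qed.

Section Conjugate.
Variables (X : gT -> 'M[R]_k) (P : 'M[R]_k) (x : 'I_k -> gT -> R).
Hypotheses (Pu : P \in unitmx) (MP : forall g, M g *m P = P *m X g).
Hypothesis Dx : forall i g, row i D *m X g = x i g *: row i D.
Hypothesis x_char : forall i, is_char (x i).

Lemma x_inj i j : x i =1 x j -> i = j.
Proof.
move=> xij; have Hj g : row j D *m X g = x i g *: row j D by rewrite Dx xij.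
have [c] := eigen_uniq Pu MP (x_char i) (rowD_neq0 i) (Dx i) Hj.
exact: rowD_inj.
Qed.

Lemma x_nontriv i : exists g, x i g != 1.
Proof.
apply/existsP; rewrite -negb_forall; apply/negP => /forallP x1.
have := rowD_neq0 i; rewrite (eigen_triv Pu MP (x_char i) _ (Dx i)) ?eqxx // => g.
exact/eqP.
Qed.

Lemma x_surj (psi : gT -> R) g0 : is_char psi -> psi g0 != 1 -> exists i, psi =1 x i.
Proof.
move=> psiP psi1; have [w w0 wE] := eigen_ex Pu MP psiP psi1.
have [a wa] : exists a, w = a *m D by exists (w *m invmx D); rewrite mulmxKV.
have /existsP[i ai] : [exists i, a 0 i != 0].
  apply: contraNT w0; rewrite negb_exists => /forallP a0; rewrite wa.
  apply/eqP; rewrite (_ : a = 0) ?mul0mx //; apply/rowP => i; rewrite mxE.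
  by apply/eqP; have := a0 i; rewrite negbK.
exists i => g; have := wE g.
rewrite wa scalemxAl -mulmxA (_ : D *m X g = diag_mx (\row_j x j g) *m D); last first.
  by apply/row_matrixP => j; rewrite row_mul Dx row_mul row_diag_mx -scalemxAl -rowE mxE.
rewrite mulmxA => /(congr1 (fun z => z *m invmx D)); rewrite !mulmxK //.
move=> /rowP/(_ i); rewrite mul_mx_diag !mxE mulrC => /(mulIf ai).
by [].
Qed.

End Conjugate.

Variables (l r : 'I_k -> gT -> R).
Hypotheses (Dl : forall i g, row i D *m L g = l i g *: row i D)
  (Dr : forall i g, row i D *m N g = r i g *: row i D).

Let diagE (X : gT -> 'M[R]_k) (x : 'I_k -> gT -> R) :
  (forall i g, row i D *m X g = x i g *: row i D) ->
  forall g, D *m X g = diag_mx (\row_j x j g) *m D.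
Proof.
move=> Dx g; apply/row_matrixP => j.
by rewrite row_mul Dx row_mul row_diag_mx -scalemxAl -rowE mxE.
Qed.

Let colE (X : gT -> 'M[R]_k) (x : 'I_k -> gT -> R) :
  (forall i g, row i D *m X g = x i g *: row i D) ->
  forall i g, X g *m col i (invmx D) = x i g *: col i (invmx D).
Proof.
move=> Dx i g; have XD : X g *m invmx D = invmx D *m diag_mx (\row_j x j g).
  by rewrite -[X g](mulKmx Du) (diagE Dx) -!mulmxA mulmxV // mulmx1.
have -> : x i g *: col i (invmx D) = invmx D *m col i (diag_mx (\row_j x j g)).
  apply/colP => j; rewrite !mxE (bigD1 i) //= big1 ?addr0 => [|h hi].
    by rewrite !mxE eqxx mulr1n mulrC.
  by rewrite !mxE (negPf hi) mulr0n mulr0.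
by rewrite -!col_mulmx XD.
Qed.

(** Coordinates on the non-invertible part form a matrix, so that an action on both indices becomes
    [X *m B *m Y^T]. *)
Definition tens (b : gT + 'I_k * 'I_k -> gU G) (B : 'M[R]_k) : gU G :=
  \sum_i \sum_j B i j *: b (inr (i, j)).

Lemma tens_act (T : gU G -> gU G) b (X Y B : 'M[R]_k) : linear T ->
  (forall i j, T (b (inr (i, j))) = \sum_h X h i *: \sum_n Y n j *: b (inr (h, n))) ->
  T (tens b B) = tens b (X *m B *m Y^T).
Proof.
move=> lT TE; rewrite /tens (linf_sum lT).
transitivity (\sum_i \sum_j \sum_h \sum_n (X h i * B i j * Y n j) *: b (inr (h, n))).
  apply: eq_bigr => i _; rewrite (linf_sum lT); apply: eq_bigr => j _.
  rewrite (linfZ lT) TE scaler_sumr; apply: eq_bigr => h _.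
  rewrite !scaler_sumr; apply: eq_bigr => n _; rewrite !scalerA; congr (_ *: _).
  by rewrite ?mulrA [B i j * _]mulrC ?mulrA.
under eq_bigr => i _ do rewrite exchange_big.
rewrite exchange_big; apply: eq_bigr => h _ /=.
under eq_bigr => i _ do rewrite exchange_big.
rewrite exchange_big; apply: eq_bigr => n _ /=.
rewrite exchange_big mxE scaler_suml; apply: eq_bigr => j _ /=.
by rewrite !mxE mulr_suml scaler_suml.
Qed.

Lemma tens_actl (T : gU G -> gU G) b (X B : 'M[R]_k) : linear T ->
  (forall i j, T (b (inr (i, j))) = \sum_h X h i *: b (inr (h, j))) ->
  T (tens b B) = tens b (X *m B).
Proof.
move=> lT TE; rewrite (@tens_act T b X 1%:M) // ?trmx1 ?mulmx1 // => i j.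
rewrite TE; apply: eq_bigr => h _; congr (_ *: _).
rewrite (bigD1 j) //= mxE eqxx scale1r big1 ?addr0 // => n nj.
by rewrite mxE (negPf nj) scale0r.
Qed.

Lemma tens_actr (T : gU G -> gU G) b (Y B : 'M[R]_k) : linear T ->
  (forall i j, T (b (inr (i, j))) = \sum_n Y n j *: b (inr (i, n))) ->
  T (tens b B) = tens b (B *m Y^T).
Proof.
move=> lT TE; rewrite (@tens_act T b 1%:M Y) // ?mul1mx // => i j.
rewrite TE [RHS](bigD1 i) //= mxE eqxx scale1r [X in _ + X]big1 ?addr0 // => n nj.
by rewrite mxE (negPf nj) scale0r.
Qed.

Lemma tensZ b a B : tens b (a *: B) = a *: tens b B.
Proof.
rewrite /tens scaler_sumr; apply: eq_bigr => i _; rewrite scaler_sumr; apply: eq_bigr => j _.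
by rewrite mxE scalerA.
Qed.

Lemma tens_dual b (beta : gT + 'I_k * 'I_k -> gU G -> R) B i j :
  (forall x, linear (beta x : gU G -> R^o)) ->
  (forall x y, beta x (b y) = (x == y)%:R) -> beta (inr (i, j)) (tens b B) = B i j.
Proof.
move=> lin dual; rewrite (linf_sum (lin _)) (bigD1 i) //= [X in _ + X]big1 ?addr0 => [|h hi].
  rewrite (linf_sum (lin _)) (bigD1 j) //= big1 ?addr0 => [|h hj].
    by rewrite (linfZ (lin _)) dual eqxx; exact: mulr1.
  rewrite (linfZ (lin _)) dual (_ : _ == _ = false) ?scaler0 //.
  by apply: contraNF hj => /eqP[->].
rewrite (linf_sum (lin _)) big1 // => n _.
rewrite (linfZ (lin _)) dual (_ : _ == _ = false) ?scaler0 //.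
by apply: contraNF hi => /eqP[->].
Qed.

(* Both decompositions of m m m are compared on joint eigenvectors of the gap actions. *)
Lemma pentagon_chars a b g0 : l a g0 * l b g0 != 1 -> exists c d,
  [/\ forall g, chi d g = r b g * chi a g, forall g, l c g = l a g * l b g
    & forall g, l d g * chi c g = chi b g].
Proof.
(* The columns of [invmx D] are joint eigenvectors of [L], [M] and [N], so [u] is a joint
   eigenvector of the three gap actions, with eigenvalues read along [e]. *)
move=> lab; pose A := col b (invmx D) *m (col a (invmx D))^T.
pose u := tens (@ge _ _ _ G) A.
have colT (X : gT -> 'M[R]_k) (x : 'I_k -> gT -> R) (Dx : forall i g, row i D *m X g = x i g *: row i D) i g :
    (col i (invmx D))^T *m (X g)^T = x i g *: (col i (invmx D))^T.
  by rewrite -trmx_mul (colE Dx) linearZ.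
have A0u g : gA0 g u = (l a g * l b g) *: u.
  rewrite (tens_act A (@gA0_lin _ _ _ G g) (@gA0_e _ _ _ G g)) -tensZ; congr tens.
  rewrite [L g *m _]mulmxA (colE Dl) -mulmxA (colT _ _ Dl).
  by rewrite -scalemxAl -scalemxAr scalerA mulrC.
have A1u g : gA1 g u = chi b g *: u.
  rewrite (tens_actl A (@gA1_lin _ _ _ G g) (@gA1_e _ _ _ G g)) -tensZ; congr tens.
  by rewrite mulmxA (colE Dchi) -scalemxAl.
have A2u g : gA2 g u = (r b g * chi a g) *: u.
  rewrite (tens_act A (@gA2_lin _ _ _ G g) (@gA2_e _ _ _ G g)) -tensZ; congr tens.
  by rewrite [N g *m _]mulmxA (colE Dr) -mulmxA (colT _ _ Dchi) -scalemxAl -scalemxAr scalerA.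
have [beta [lin span dual]] := gf_basis G; have [eps [elin _ edual]] := ge_basis G.
pose B := \matrix_(i, j) beta (inr (i, j)) u.
have uB : u = \sum_h beta (inl h) u *: @gf _ _ _ G (inl h) + tens (@gf _ _ _ G) B.
  rewrite {1}[u]span big_sumType; congr (_ + _).
  rewrite /tens pair_bigA /=.
  by apply: eq_bigr => -[i j] _; rewrite mxE.
(* [gA0] fixes every [f (inl h)], while it multiplies [u] by [l a g0 * l b g0], which is not 1. *)
have b0 h : beta (inl h) u = 0.
  have := congr1 (beta (inl h)) (A0u g0).
  rewrite {1}uB (linfD (@gA0_lin _ _ _ G g0)) (linfD (lin _)) (linf_sum (@gA0_lin _ _ _ G g0)).
  rewrite (linf_sum (lin _)) (tens_actr B (@gA0_lin _ _ _ G g0) (@gA0_f _ _ _ G g0)).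
  rewrite [X in _ + X](_ : _ = 0) ?addr0; last first.
    rewrite (linf_sum (lin _)) big1 // => i _; rewrite (linf_sum (lin _)) big1 // => j _.
    by rewrite (linfZ (lin _)) dual scaler0.
  rewrite (bigD1 h) //= big1 ?addr0 => [|h' hh]; last first.
    rewrite (linfZ (@gA0_lin _ _ _ G g0)) gA0_f1 (linfZ (lin _)) dual (_ : _ == _ = false) ?scaler0 //.
    by apply: contraNF hh => /eqP[->].
  rewrite (linfZ (@gA0_lin _ _ _ G g0)) gA0_f1 !(linfZ (lin _)) dual eqxx => /eqP.
  rewrite -[_ *: _]/(_ * _) -[X in _ == X]/(_ * _) mulr1 -{1}[beta _ _]mul1r.
  rewrite -subr_eq0 -mulrBl mulf_eq0 subr_eq0 eq_sym (negPf lab).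
  by move/eqP.
have {}uB : u = tens (@gf _ _ _ G) B.
  by rewrite {1}uB big1 ?add0r // => h _; rewrite b0 scale0r.
have tens_inj X Y : tens (@gf _ _ _ G) X = tens (@gf _ _ _ G) Y -> X = Y.
  move=> E; apply/matrixP => i j.
  by rewrite -(tens_dual X i j lin dual) E (tens_dual Y i j lin dual).
have B0 g : B *m (L g)^T = (l a g * l b g) *: B.
  apply: tens_inj; rewrite tensZ -uB -A0u uB.
  by rewrite (tens_actr B (@gA0_lin _ _ _ G g) (@gA0_f _ _ _ G g)).
have B1 g : L g *m B *m (M g)^T = chi b g *: B.
  apply: tens_inj; rewrite tensZ -uB -A1u uB.
  by rewrite (tens_act B (@gA1_lin _ _ _ G g) (@gA1_f _ _ _ G g)).
have B2 g : M g *m B = (r b g * chi a g) *: B.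
  apply: tens_inj; rewrite tensZ -uB -A2u uB.
  by rewrite (tens_actl B (@gA2_lin _ _ _ G g) (@gA2_f _ _ _ G g)).
have A_neq0 : A != 0.
  have cD i : col i (invmx D) != 0.
    apply: contraTneq Du => Di0; apply/negP => /mulmxV/matrixP/(_ i i)/eqP.
    rewrite !mxE eqxx big1 ?[0 == _]eq_sym ?oner_eq0 // => h _.
    by have /colP/(_ h) := Di0; rewrite !mxE => ->; rewrite mulr0.
  apply/eqP => A0; have /existsP[i bi] : [exists i, invmx D i b != 0].
    apply: contraNT (cD b); rewrite negb_exists => /forallP H; apply/eqP/colP => i.
    by rewrite !mxE; apply/eqP; have := H i; rewrite negbK.
  case/negP: (cD a); apply/eqP/colP => j; rewrite !mxE.
  have /matrixP/(_ i j) := A0; rewrite !mxE big_ord1 !mxE => /eqP.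
  by rewrite mulf_eq0 (negPf bi) => /eqP.
have B_neq0 : B != 0.
  apply: contraNneq A_neq0 => B0'; have u0 : u = 0.
    by rewrite uB B0' /tens big1 // => i _; rewrite big1 // => j _; rewrite mxE scale0r.
  by apply/eqP/matrixP => i j; rewrite -(tens_dual A i j elin edual) -/u u0 (linf0 (elin _)) mxE.
(* [C] holds the coordinates of [u] on joint eigenvectors along [f]. A nonzero entry must have the
   eigenvalues of [u] in all three gaps, which yields the three equations. *)
pose C := D *m B *m D^T.
have /existsP[d /existsP[c Cdc]] : [exists d, exists c, C d c != 0].
  apply: contraNT B_neq0; rewrite negb_exists => /forallP H.
  have C0 : C = 0.
    apply/matrixP => i j; rewrite [RHS]mxE; apply/eqP; have := H i; rewrite negb_exists.
    by move/forallP/(_ j); rewrite negbK.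
  have DTu : D^T \in unitmx by rewrite unitmx_tr.
  by rewrite -[B](mulKmx Du) -[D *m B](mulmxK DTu) -/C C0 mul0mx mulmx0.
exists c, d; split=> g; apply: (mulIf Cdc).
- have := congr1 (fun X => (D *m X *m D^T) d c) (B2 g).
  rewrite mulmxA (diagE Dchi) -scalemxAr -scalemxAl -!mulmxA mul_diag_mx.
  by rewrite [D *m (B *m _)]mulmxA -/C !mxE => <-.
- have := congr1 (fun X => (D *m X *m D^T) d c) (B0 g).
  rewrite -scalemxAr -scalemxAl -!mulmxA -trmx_mul (diagE Dl) trmx_mul tr_diag_mx.
  by rewrite !mulmxA -/C mul_mx_diag !mxE => <-; rewrite mulrC.
- have : D *m (L g *m B *m (M g)^T) *m D^T =
      diag_mx (\row_j l j g) *m C *m diag_mx (\row_j chi j g).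
    rewrite !mulmxA (diagE Dl) -[_ *m (M g)^T *m D^T]mulmxA -trmx_mul (diagE Dchi).
    by rewrite trmx_mul tr_diag_mx /C !mulmxA.
  rewrite B1 -scalemxAr -scalemxAl -/C => /matrixP/(_ d c).
  rewrite mul_mx_diag mul_diag_mx mxE [in RHS]mxE [in RHS]mxE !mxE => ->.
  by rewrite mulrAC.
Qed.

End Eigenbasis.
Lemma M_invQ g : M g *m invmx Q = invmx Q *m N g.
Proof. by rewrite -[LHS](mulKmx (gQ_unit G)) [Q *m _]mulmxA -gNQ mulmxK ?gQ_unit. Qed.

Lemma N_conj g : N g = Q *m M g *m invmx Q.
Proof. by rewrite -gNQ mulmxK ?gQ_unit. Qed.

Lemma dual_group : exists (A : finGroupType) (ch : A -> gT -> R) (sigma tau : A -> A),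
  [/\ #|A| = k.+1, forall a b : A, (a * b = b * a)%g,
      (forall a, is_char (ch a)) /\ (forall a b g, ch (a * b)%g g = ch a g * ch b g),
      forall g, (forall a, ch a g = 1) -> g = 1%g
    & [/\ injective sigma, forall x, x != 1%g -> sigma x != 1%g,
          forall x, x != 1%g -> tau x != 1%g
        & forall x y, x != 1%g -> y != 1%g -> (x * y)%g != 1%g ->
          sigma (sigma y * (sigma (x * y))^-1)%g = (tau y * sigma x)%g]].
Proof.
have [D Du [chi Dchi]] := diag_M.
have LMC g h : M g *m L h = L h *m M g by rewrite gLMC.
have NMC g h : M g *m N h = N h *m M g by rewrite gNMC.
have [l Dl] := commuting_eigen Du Dchi LMC.
have [r Dr] := commuting_eigen Du Dchi NMC.
have M1Q g : M g *m 1%:M = 1%:M *m M g by rewrite mulmx1 mul1mx.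
have chiP i := chi_char Du Dchi i.
have lP i : is_char (l i) := eigen_char Du (gL1 G) (gLM G) (Dl i).
have rP i : is_char (r i).
  apply: (eigen_char Du _ _ (Dr i)) => [|g h]; rewrite !N_conj.
    by rewrite gM1 mulmx1 mulmxV ?gQ_unit.
  by rewrite -MM -!mulmxA mulKmx ?gQ_unit.
have Qu := gQ_unit G; have Qu' : invmx Q \in unitmx by rewrite unitmx_inv.
have chi_inj := x_inj Du (unitmx1 _ _) M1Q Dchi chiP.
have l_inj := x_inj Du Qu (gMQ G) Dl lP.
have l_nt := x_nontriv Du Qu (gMQ G) Dl lP.
have chi_nt := x_nontriv Du (unitmx1 _ _) M1Q Dchi chiP.
have r_nt := x_nontriv Du Qu' M_invQ Dr rP.
have surj := x_surj Du (unitmx1 _ _) M1Q Dchi.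
(* [None] stands for the trivial character, the only one missing from [M], so [option 'I_k] indexes
   the whole dual group. *)
pose c0 (a : option 'I_k) : gT -> R := if a is Some i then chi i else fun=> 1.
have c0P a : is_char (c0 a) by case: a => [i|] //=; split=> // *; rewrite mulr1.
have c0_inj a b : c0 a =1 c0 b -> a = b.
  case: a b => [i|] [j|] //= E; first by rewrite (chi_inj i j).
    by have [g] := chi_nt i; rewrite E eqxx.
  by have [g] := chi_nt j; rewrite -E eqxx.
have c0_surj psi : is_char psi -> exists a, c0 a =1 psi.
  move=> psiP; have [/existsP[g0 p0]|] := boolP [exists g, psi g != 1].
    by have [i Ei] := surj psi g0 psiP p0; exists (Some i) => g; rewrite Ei.
  rewrite negb_exists => /forallP psi1; exists None => g /=.
  by apply/esym/eqP; have := psi1 g; rewrite negbK.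
have c0_inv a g : c0 a g * c0 a g^-1%g = 1.
  by have [c1 cM] := c0P a; rewrite -cM mulgV.
have /fin_all_exists[mulA mulAE] (ab : option 'I_k * option 'I_k) :
    exists c, forall g, c0 c g = c0 ab.1 g * c0 ab.2 g.
  case: ab => a b /=; apply: c0_surj; have [a1 aM] := c0P a; have [b1 bM] := c0P b.
  by split=> [|g h]; rewrite ?a1 ?b1 ?mulr1 // aM bM mulrACA.
have /fin_all_exists[invA invAE] (a : option 'I_k) : exists c, forall g, c0 c g = c0 a g^-1%g.
  apply: c0_surj; have [a1 aM] := c0P a.
  by split=> [|g h]; rewrite ?invg1 // invMg aM mulrC.
pose mul a b := mulA (a, b).
have mulE a b g : c0 (mul a b) g = c0 a g * c0 b g by rewrite mulAE.
have mulgA : associative mul by move=> a b c; apply: c0_inj => g; rewrite !mulE mulrA.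
have mul1g : left_id None mul by move=> a; apply: c0_inj => g; rewrite mulE mul1r.
have mulVg : left_inverse None invA mul.
  by move=> a; apply: c0_inj => g; rewrite mulE invAE mulrC c0_inv.
pose A : finGroupType := HB.pack_for finGroupType (option 'I_k)
  (Finite_isGroup.Build (option 'I_k) mulgA mul1g mulVg).
have /fin_all_exists[pi piE] i : exists j, chi j =1 l i.
  have [g0 lg] := l_nt i; have [j Ej] := surj _ _ (lP i) lg.
  by exists j => g; rewrite Ej.
have /fin_all_exists[rho rhoE] i : exists j, chi j =1 r i.
  have [g0 rg] := r_nt i; have [j Ej] := surj _ _ (rP i) rg.
  by exists j => g; rewrite Ej.
(* Index [i] stands for [chi i]. Thus [sigma], inverse to [lA], sends [l i] to [chi i], and
   [rA (sigma x)] sends it to [r i]. With [x = l a] and [y = l b], [pentagon_chars] says that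
   [x * y = l c], that [chi b / chi c = l d], and that [sigma] maps this to
   [chi d = r b * chi a]. *)
pose lA (a : A) : A := if a is Some i then Some (pi i) else None.
pose rA (a : A) : A := if a is Some i then Some (rho i) else None.
have lA_inj : injective lA.
  move=> [i|] [j|] //= [E]; congr Some; apply: l_inj => g.
  by rewrite -!piE E.
pose sigma := invF lA_inj.
have lAK x : lA (sigma x) = x := f_invF lA_inj x.
have sigmaK x : sigma (lA x) = x := invF_f lA_inj x.
have sigma_nt (x : A) : x != 1%g -> sigma x != 1%g.
  by apply: contraNneq => E; rewrite -[x]lAK E.
exists A, c0, sigma, (fun x => rA (sigma x)); split.
- by rewrite card_option card_ord.
- by move=> a b; apply: c0_inj => g; rewrite !mulE mulrC.
- by split.
- move=> g H; apply: (affinely_free_inj (@M_free _ _ _ G)); rewrite gM1.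
  rewrite -[M g](mulKmx Du); suff -> : D *m M g = D by rewrite mulVmx.
  apply/row_matrixP => i; rewrite row_mul Dchi.
  by have /= -> := H (Some i); rewrite scale1r.
- split=> //; first exact: can_inj lAK.
    by move=> x /sigma_nt; case: (sigma x).
  move=> x y x1 y1 xy1.
  case Ex: (sigma x) (sigma_nt _ x1) => [a|] // _.
  case Ey: (sigma y) (sigma_nt _ y1) => [b|] // _.
  have xE g : c0 x g = l a g by rewrite -[x]lAK Ex /= piE.
  have yE g : c0 y g = l b g by rewrite -[y]lAK Ey /= piE.
  have /existsP[g0 lab] : [exists g, l a g * l b g != 1].
    apply: contraNT xy1; rewrite negb_exists => /forallP H.
    apply/eqP; apply: c0_inj => g; rewrite [LHS]mulE xE yE.
    by apply/eqP; have := H g; rewrite negbK.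
  have [c [d [Ed Ec Elc]]] := pentagon_chars Du Dchi Dl Dr lab.
  have -> : sigma (x * y)%g = Some c.
    rewrite -[RHS]sigmaK; congr sigma; apply: c0_inj => g.
    by rewrite [LHS]mulE xE yE /= piE Ec.
  have -> : (rA (Some b) * Some a)%g = Some d :> A.
    by apply: c0_inj => g; rewrite [LHS]mulE /= rhoE Ed.
  rewrite -[RHS]sigmaK; congr sigma.
  apply: (mulIg (Some c : A)); rewrite mulgKV; apply: c0_inj => g.
  by rewrite [RHS]mulE /= piE Elc.
Qed.

End Characters.

(** * Near-fields *)

Section NearfieldScope.
Local Open Scope group_scope.

(** Two permutations agreeing off two points can differ only by exchanging the values there. This
    extends an identity to points where the pentagon relation is silent. *)
Lemma injective_swap (T : finType) (f g : T -> T) (a b : T) : injective f -> injective g ->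
  (forall z, z != a -> z != b -> f z = g z) -> f b = g a \/ f b = g b.
Proof.
move=> finj ginj E; have [h gh hg] := injF_bij ginj.
have [E1|nb] := eqVneq (h (f b)) b; first by right; rewrite -{2}E1 hg.
have [E1|na] := eqVneq (h (f b)) a; first by left; rewrite -E1 hg.
by case/eqP: (nb); apply: finj; rewrite [LHS](E _ na nb) hg.
Qed.

Section Frobenius.
Variables (gT : finGroupType) (G D : {group gT}) (n : nat).
Hypotheses (frobG : [Frobenius G with complement D]) (cardG : #|G| = (n * n.+1)%N)
  (cardD : #|D| = n) (cDD : abelian D).

(** By counting, [D] is transitive on the nontrivial elements of the kernel. They all have the same
    prime order, and no proper nontrivial subgroup of the kernel is stable under [D]. So the kernel
    is a faithful irreducible module over a prime field, which forces the abelian group [D] to be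
    cyclic. *)
Lemma sharply_2transitive_cyclic : cyclic D /\ exists p a, [/\ prime p, (0 < a)%N & n.+1 = (p ^ a)%N].
Proof.
have [K frobK] := Frobenius_kernel_exists frobG.
have [defG ntK ntD _ _] := Frobenius_context frobK.
have [_ _ nKD tiKD] := sdprodP defG.
have n_gt0 : (0 < n)%N by rewrite -cardD cardG_gt0.
have cardK : #|K| = n.+1.
  have /eqP := sdprod_card defG; rewrite cardG cardD mulnC eqn_pmul2l //.
  by move/eqP.
have regD x : x \in K^# -> 'C_D[x] = 1 by exact: (Frobenius_reg_compl frobK).
have orbK x : x \in K^# -> x ^: D = K^#.
  move=> Kx; apply/eqP; rewrite eqEcard; apply/andP; split.
    rewrite class_sub_norm //; last by rewrite normD1.
  rewrite -index_cent1 regD // indexg1 cardD.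
  by have := cardsD1 1 K; rewrite group1 cardK => -[->].
have minK (L : {group gT}) : L \subset K -> D \subset 'N(L) -> L :!=: 1 -> L :=: K.
  move=> sLK nLD /trivgPn[x Lx x1]; apply/eqP; rewrite eqEsubset sLK /=.
  apply/subsetP => y Ky; have [->|y1] := eqVneq y 1; first exact: group1.
  have Kx : x \in K^# by rewrite !inE x1 (subsetP sLK).
  have : y \in x ^: D by rewrite orbK // !inE y1.
  by case/imsetP => d Dd ->; rewrite memJ_norm // (subsetP nLD).
have K_gt1 : (1 < #|K|)%N by rewrite cardK ltnS.
pose p := pdiv #|K|; have pr_p : prime p by exact: pdiv_prime.
have [x Kx ox] := Cauchy pr_p (pdiv_dvd #|K|).
have x1 : x != 1 by rewrite -order_gt1 ox prime_gt1.
have oK y : y \in K^# -> #[y] = p.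
  have Kx' : x \in K^# by rewrite !inE x1.
  by rewrite -(orbK x Kx') => /imsetP[d _ ->]; rewrite orderJ.
have pK : p.-group K.
  apply/pgroupP => q pr_q /(Cauchy pr_q)[y Ky oy].
  have y1 : y \in K^# by rewrite !inE Ky -order_gt1 oy prime_gt1.
  by rewrite -oy oK // inE.
have cKK : abelian K.
  have ZK : 'Z(K) :=: K.
    apply: minK; rewrite ?center_sub // ?(char_norm_trans (center_char K)) //.
    by rewrite (center_nil_eq1 (pgroup_nil pK)).
  by rewrite -ZK center_abelian.
have abelK : p.-abelem K.
  apply/abelemP => //; split=> // y Ky; have [->|y1] := eqVneq y 1; first by rewrite expg1n.
  by rewrite -(oK y) ?expg_order // !inE y1.
split.
  have minKD : minnormal K D.
    by apply/mingroupP; rewrite ntK nKD; split=> // L /andP[ntL nLD] sLK; exact: minK.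
  apply: (mx_faithful_irr_abelian_cyclic (rG := abelem_repr abelK ntK nKD)) => //.
    apply: abelem_mx_faithful; apply/trivgP; rewrite -(regD x) ?inE ?x1 //.
    by rewrite setIS // -cent_set1 centS // sub1set.
  exact/abelem_mx_irrP.
exists p; have [a Ka] := p_natP pK; exists a; split=> //; last by rewrite -cardK.
by rewrite lt0n; apply: contraTneq K_gt1 => a0; rewrite Ka a0.
Qed.

End Frobenius.

Section Nearfield.
Variables (A : finGroupType) (sigma tau : A -> A).
Hypotheses (cAA : forall a b : A, a * b = b * a) (A_gt1 : (1 < #|A|)%N)
  (sigma_inj : injective sigma)
  (sigma_nt : forall x, x != 1 -> sigma x != 1) (tau_nt : forall x, x != 1 -> tau x != 1)
  (pentagon : forall x y, x != 1 -> y != 1 -> x * y != 1 ->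
     sigma (sigma y * (sigma (x * y))^-1) = tau y * sigma x).

Local Notation F := (option A).

(* [A] with [None] added as a zero will be the field, and [s] the map [x |-> 1 - x]. *)
Let s x := sigma x^-1.
Let t x := tau x^-1.

Let s_inj x y : s x = s y -> x = y.
Proof. by move/sigma_inj/invg_inj. Qed.

Let s_nt x : x != 1 -> s x != 1.
Proof. by move=> x1; apply: sigma_nt; rewrite invg_eq1. Qed.

Let sE x y : x != 1 -> y != 1 -> x * y != 1 -> s (s (x * y) * (s x)^-1) = t x * s y.
Proof.
move=> x1 y1 xy1; rewrite /s /t -pentagon ?invg_eq1 //; last first.
  by rewrite -invMg invg_eq1.
by congr sigma; rewrite -(invMg x y) [LHS]invMg invgK.
Qed.

Definition scal (a : A) (z : F) : F := omap (mulg a) z.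
Definition refl (z : F) : F :=
  if z is Some x then if x == 1 then None else Some (s x) else Some 1.

Lemma scal_inj a : injective (scal a).
Proof. by move=> [x|] [y|] //= [/mulgI->]. Qed.

Lemma refl_inj : injective refl.
Proof.
move=> [x|] [y|] //=.
- have [->|x1] := eqVneq x 1; have [->|y1] := eqVneq y 1 => //.
  by case=> /s_inj->.
- by have [->|x1] := eqVneq x 1 => // -[E]; have := s_nt x1; rewrite E eqxx.
- by have [->|y1] := eqVneq y 1 => // -[E]; have := s_nt y1; rewrite -E eqxx.
Qed.

(** In a field this is [1 - (1 - x z) / (1 - x) = t x * (1 - z)] with [t x = x / (x - 1)]. The
    pentagon relation gives it for [z] other than zero and [x^-1]; at these two points the sides
    could only be exchanged, which [t x != 1] excludes. *)
Lemma refl_scal x : x != 1 -> forall z,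
  refl (scal (s x)^-1 (refl (scal x z))) = scal (t x) (refl z).
Proof.
move=> x1; pose f z := refl (scal (s x)^-1 (refl (scal x z))).
pose g z := scal (t x) (refl z).
have finj : injective f by move=> y z /refl_inj/scal_inj/refl_inj/scal_inj.
have ginj : injective g by move=> y z /scal_inj/refl_inj.
have E z : z != None -> z != Some x^-1 -> f z = g z.
  case: z => [y|] // _ yx; have xy1 : x * y != 1.
    by apply: contra yx => /eqP xy; rewrite -[y](mulKg x) xy mulg1.
  rewrite /f /g /= (negPf xy1) /=; have [->|y1] := eqVneq y 1.
    by rewrite mulg1 mulVg eqxx.
  rewrite /= ifF; first by rewrite cAA sE.
  apply: contraNF y1 => /eqP/(canRL (mulKg _)); rewrite invgK mulg1 => /s_inj/esym.
  by move/(congr1 (mulg x^-1)); rewrite mulKg mulVg => ->.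
have fxV : f (Some x^-1) = Some 1 by rewrite /f /= mulgV eqxx.
have tx1 : t x != 1 by apply: tau_nt; rewrite invg_eq1.
have fg : f (Some x^-1) = g (Some x^-1).
  have [E1|//] := injective_swap finj ginj E.
  by move: E1; rewrite fxV /g /= mulg1 => -[/esym/eqP]; rewrite (negPf tx1).
move=> z; have [->|z1] := eqVneq z (Some x^-1); first exact: fg.
have [->|z2] := eqVneq z None; last exact: E.
have [E1|//] := injective_swap finj ginj (fun z za zb => E z zb za).
by rewrite -fg in E1; have := finj _ _ E1.
Qed.

(** [refl_scal] at zero and at [x^-1] gives two expressions for [t x]. *)
Lemma s_inv x : x != 1 -> s (s x)^-1 = (s x^-1)^-1.
Proof.
move=> x1; have := refl_scal x1 None; have := refl_scal x1 (Some x^-1).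
rewrite /= mulgV eqxx /= invg_eq1 (negPf x1) /= => -[E]; rewrite !mulg1.
rewrite invg_eq1 (negPf (s_nt x1)) => -[->].
by apply: (mulIg (s x^-1)); rewrite -E mulVg.
Qed.

(* The relation [s i s = i s i] with [i] the inversion makes [s] conjugate to [i]. *)
Lemma sK x : x != 1 -> s (s x) = x.
Proof.
move=> x1; have sx1 := s_nt x1; have ssx1 := s_nt sx1.
by apply/invg_inj/s_inj; rewrite s_inv // s_inv // invgK.
Qed.

Lemma reflK : involutive refl.
Proof.
case=> [x|] /=; last by rewrite eqxx.
by have [->|x1] := eqVneq x 1; rewrite //= (negPf (s_nt x1)) sK.
Qed.

Let P a : {perm F} := perm (@scal_inj a).
Let S : {perm F} := perm refl_inj.

Let PM a b : P (a * b) = P a * P b.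
Proof.
apply/permP => z; rewrite permM !permE.
by case: z => [x|] //=; rewrite mulgA [a * b]cAA.
Qed.

Let SS : S * S = 1.
Proof. by apply/permP => z; rewrite permM !permE reflK. Qed.

(** Choosing [x] with [(s x)^-1 = c] turns [refl_scal] into the double coset relation under which
    [H0] is closed. *)
Let SPS c : c != 1 -> exists a b, S * P c * S = P a * S * P b.
Proof.
move=> c1; pose x := s c^-1; have cV1 : c^-1 != 1 by rewrite invg_eq1.
have x1 : x != 1 by exact: s_nt.
have xc : (s x)^-1 = c by rewrite /x sK // invgK.
exists x^-1, (t x); apply/permP => z; rewrite !permM !permE.
have := refl_scal x1 (scal x^-1 z); rewrite xc => <-.
by congr (refl (scal c (refl _))); case: z => [y|] //=; rewrite mulKVg.
Qed.

(** Bruhat form of the affine group: the [P a] fix zero, and the cell of the [P a * S * P b]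
    consists of the maps [z |-> b * (1 - a * z)], which move it. *)
Let H0 := [set P a | a : A] :|: [set P ab.1 * S * P ab.2 | ab : A * A].

Let H0_P a : P a \in H0. Proof. by rewrite inE imset_f. Qed.
Let H0_PSP a b : P a * S * P b \in H0.
Proof. by rewrite inE; apply/orP; right; apply/imsetP; exists (a, b). Qed.

Let P1 : P 1 = 1.
Proof. by apply/permP => -[x|]; rewrite permE perm1 //= mul1g. Qed.

Let H0_group : group_set H0.
Proof.
apply/group_setP; split; first by rewrite -P1.
move=> x y /setUP[/imsetP[a _ ->]|/imsetP[[a b] _ ->]] /setUP[/imsetP[c _ ->]|/imsetP[[c d] _ ->]] /=.
- by rewrite -PM.
- by rewrite !mulgA -PM.
- by rewrite -mulgA -PM.
have -> : P a * S * P b * (P c * S * P d) = P a * (S * P (b * c) * S) * P d.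
  by rewrite PM !mulgA.
have [->|bc1] := eqVneq (b * c) 1; first by rewrite P1 mulg1 SS mulg1 -PM.
have [e [f ->]] := SPS bc1.
by rewrite -!mulgA -PM mulgA -[P a * P e]PM mulgA.
Qed.

Let H : {group {perm F}} := Group H0_group.
Let Pm : {morphism [set: A] >-> {perm F}} := Morphism (in2W PM).

Let stab : 'C_H[None | 'P] = Pm @* [set: A].
Proof.
apply/setP => h; rewrite inE; apply/andP/imsetP => [[]|[a _ ->]]; last first.
  by rewrite H0_P; split=> //; apply/astab1P; rewrite /= /aperm permE.
case/setUP => /imsetP[]; first by move=> a _ -> _; exists a; rewrite ?inE.
move=> [a b] _ -> /astab1P; rewrite /= /aperm !permM !permE /= mulg1.
by [].
Qed.

Let P_inj : 'injm Pm.
Proof.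
apply/injmP => a b _ _ /permP/(_ (Some 1)); rewrite !permE /= !mulg1.
by case.
Qed.

Let H_trans : [transitive H, on [set: F] | 'P].
Proof.
apply/imsetP; exists None; rewrite ?inE //; apply/esym/eqP; rewrite -subTset.
apply/subsetP => -[a|] _; last exact: orbit_refl.
apply/orbitP; exists (P 1 * S * P a); first exact: H0_PSP.
by rewrite /= /aperm !permM !permE /= mulg1.
Qed.

Lemma nearfield_cyclic : cyclic [set: A] /\
  exists p a, [/\ prime p, (0 < a)%N & #|A|.+1 = (p ^ a)%N].
Proof.
have cardD : #|Pm @* [set: A]| = #|A| by rewrite card_injm ?cardsT.
have cardH : #|H| = (#|A| * #|A|.+1)%N.
  rewrite -(card_orbit_stab 'P H None) stab cardD (atransP H_trans) ?inE //.
  by rewrite cardsT card_option mulnC.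
have cDD : abelian (Pm @* [set: A]).
  by apply: morphim_abelian; apply/centsP => a _ b _; exact: cAA.
have frobH : [Frobenius H with complement Pm @* [set: A]].
  apply/Frobenius_actionP; exists _ [set: F] 'P%act; split=> //.
  - apply/subsetP => h /setIP[_ /astabP E]; rewrite inE.
    by apply/eqP/permP => z; rewrite perm1; apply: E (in_setT z).
  (* If [h] fixes two points, a conjugate fixes zero and is therefore a scaling; as it also fixes a
     nonzero point, it is trivial. *)
  - move=> h /setD1P[h1 Hh]; apply/card_le1_eqP => y z.
    move=> /setIP[_ /afix1P hy] /setIP[_ /afix1P hz]; apply: contraNeq h1 => yz.
    have [g Hg yE] := atransP2 H_trans (in_setT None) (in_setT y).
    have : h ^ g^-1 \in 'C_H[None | 'P].
      rewrite inE groupJ ?groupV //=; apply/astab1P.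
      by rewrite conjgE invgK !actM -yE hy yE actK.
    rewrite stab => /imsetP[a _ hgE']; have {hgE'}hgE : h ^ g^-1 = P a := hgE'.
    have [w wE] : exists w, z = g w by exists (g^-1 z); rewrite permKV.
    case: w wE => [x|] wE; last by rewrite yE wE eqxx in yz.
    have : P a (Some x) = Some x.
      by rewrite -hgE conjgE invgK !permM -wE [h z]hz wE permK.
    rewrite permE /= -[in RHS](mul1g x) => -[/mulIg a1].
    by rewrite -(conjg_eq1 _ g^-1) hgE a1 /= P1.
  - by rewrite -cardG_gt1 cardD.
  - by exists None; rewrite ?inE // stab.
have [cycD ex] := sharply_2transitive_cyclic frobH cardH cardD cDD.
by split=> //; rewrite -(injm_cyclic P_inj).
Qed.

End Nearfield.

End NearfieldScope.

(** * Cyclicity of G and the units of finite fields *)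

Lemma cyclic_of_category (R : closedFieldType) (gT : finGroupType) (k : nat) :
  (0 < k)%N -> #|gT| = k.+1 -> #|gT|%:R != 0 :> R -> NearGroupCategory R gT k ->
  cyclic [set: gT] /\ exists p a, [/\ prime p, (0 < a)%N & #|gT| = (p ^ a).-1].
Proof.
move=> k_gt0 card_gT charR /(gap_data_of_category k_gt0 card_gT)[G].
have [A [ch [sigma [tau [cardA cAA [chP chM] ch_faithful [sinj snt tnt pent]]]]]] :=
  dual_group G k_gt0 card_gT charR.
have A_gt1 : (1 < #|A|)%N by rewrite cardA ltnS.
have [cycA [p [a [pr_p a_gt0 E]]]] := nearfield_cyclic cAA A_gt1 sinj snt tnt pent.
split; last by exists p, a; rewrite -E cardA card_gT.
(* All characters are powers of [ch x] and together they are faithful. So [ch x] alone embeds G in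
   the units of [R], whose finite subgroups are cyclic. *)
have /cyclicP[x Ax] := cycA.
apply: (@field_mul_group_cyclic _ [group of [set: gT]] _ (ch x)) => [g h _ _|g _].
  by have [_ ->] := chP x.
split=> [chg|->]; last by have [] := chP x.
apply: ch_faithful => b; have : b \in <[x]>%g by rewrite -Ax inE.
case/cycleP => j ->; elim: j => [|j IH]; last by rewrite expgS chM chg IH mulr1.
have := chM 1%g 1%g g; rewrite mulg1 expg0 -[X in X = _ -> _]mulr1.
have [c1 cM] := chP 1%g.
have nz : ch 1%g g != 0.
  by apply/eqP => c0; have /eqP := cM g g^-1%g; rewrite mulgV c1 c0 mul0r oner_eq0.
by move/(mulfI nz).
Qed.

Lemma Fq_starP (gT : finGroupType) : is_Fq_star gT <->
  cyclic [set: gT] /\ exists p a : nat, [/\ prime p, (0 < a)%N & #|gT| = (p ^ a).-1].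
Proof.
split=> [[F isoF]|[cycG [p [a [pr_p a_gt0 cardG]]]]].
  split; first by rewrite (isog_cyclic isoF) field_unit_group_cyclic.
  have [p pr_p pF] := finPcharP F; have cardF : #|F| = (p ^ logn p #|F|)%N := card_pprimeChar pF.
  exists p, (logn p #|F|); split=> //.
    by have := finNzRing_gt1 F; rewrite {1}cardF; case: logn.
  by rewrite -cardF -card_finField_unit -cardsT (card_isog isoF).
have [F pF cardF] := pPrimePowerField pr_p a_gt0.
exists F; rewrite (isog_cyclic_card _ cycG) field_unit_group_cyclic /=.
by rewrite card_finField_unit cardsT cardF cardG.
Qed.

Lemma sum_deltal (R : pzRingType) (X : finType) (x : X) (f : X -> R) :
  \sum_y (x == y)%:R * f y = f x.
Proof.
rewrite (bigD1 x) //= eqxx mul1r big1 ?addr0 // => y yx.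
by rewrite eq_sym (negPf yx) mul0r.
Qed.

Lemma sum_deltar (R : pzRingType) (X : finType) (x : X) (f : X -> R) :
  \sum_y f y * (y == x)%:R = f x.
Proof.
rewrite (bigD1 x) //= eqxx mulr1 big1 ?addr0 // => y yx.
by rewrite (negPf yx) mulr0.
Qed.

Lemma sum_unit (R : pzRingType) (f : unit -> R) : \sum_t f t = f tt.
Proof. by rewrite (bigD1 tt) //= big1 ?addr0 // => -[]. Qed.

(** In [c b c b = c b], cancel [c] on the left and [b] on the right. *)
Lemma full_rank_idempotent (K : fieldType) (m r : nat) (M : 'M[K]_m)
    (c : 'M_(m, r)) (b : 'M_(r, m)) :
  row_full c -> row_free b -> c *m b = M -> M *m M = M -> b *m c = 1%:M.
Proof.
move=> c_full b_free E MM; apply: (row_free_inj b_free); apply: (row_full_inj c_full).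
by rewrite /= mul1mx !mulmxA E -mulmxA E MM.
Qed.

Section DirectSum.
Variables (R : fieldType) (C : catData R) (x : Ob C) (I : Type) (S : I -> Ob C).
Variables (J : finType) (l : J -> I) (i : forall j, Hom C (S (l j)) x)
  (p : forall j, Hom C x (S (l j))).
Hypotheses (pi1 : forall j, cmp (p j) (i j) = idm _)
  (pi0 : forall j j', j != j' -> cmp (p j) (i j') = 0)
  (ip : \sum_j cmp (i j) (p j) = idm x).

Lemma is_dsum_bij n (o : 'I_n -> I) (e : 'I_n -> J) :
  bijective e -> (forall a, l (e a) = o a) -> is_dsum x (fun a => S (o a)).
Proof.
move=> e_bij oE.
(* Keeping [y] and the equation [l j = y] as variables lets case analysis on the equation remove
   every cast. *)
pose ci j y (E : l j = y) : Hom C (S y) x := let: erefl := E in i j.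
pose cp j y (E : l j = y) : Hom C x (S y) := let: erefl := E in p j.
have H1 j y (E : l j = y) : cmp (cp j y E) (ci j y E) = idm _ by case: y / E; exact: pi1.
have H0 j y (E : l j = y) j' y' (E' : l j' = y') : j != j' -> cmp (cp j y E) (ci j' y' E') = 0.
  by move=> jj; case: y / E; case: y' / E'; exact: pi0.
have H2 j y (E : l j = y) : cmp (ci j y E) (cp j y E) = cmp (i j) (p j) by case: y / E.
exists (fun a => ci (e a) (o a) (oE a)), (fun a => cp (e a) (o a) (oE a)); split.
- by move=> a; exact: H1.
- by move=> a b ab; apply: H0; rewrite (inj_eq (bij_inj e_bij)).
- rewrite -ip (reindex e); last exact: onW_bij.
  by apply: eq_bigr => a _; exact: H2.
Qed.

End DirectSum.

(** * Graded representations *)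

Section Construction.
Variables (R : fieldType) (F : finFieldType).
Local Notation Fu := {unit F}.

(* Representations of [Fu] graded by [F], compatibly with the multiplication of
   [Fu] on [F], in a homogeneous basis; [act c x y] is the coefficient of the
   basis vector [y] in [c] applied to [x]. *)
Record grep := GRep {
  gX : finType;
  deg : gX -> F;
  act : Fu -> gX -> gX -> R;
  act1 : forall x y, act 1%g x y = (x == y)%:R;
  actM : forall c d x z, act (c * d)%g x z = \sum_y act c x y * act d y z;
  act_deg : forall c x y, deg y != val c * deg x -> act c x y = 0 }.

Definition is_hom (V W : grep) (f : gX V -> gX W -> R) : Prop :=
  (forall x y, deg x != deg y -> f x y = 0) /\
  (forall c x y, \sum_z act c x z * f z y = \sum_z f x z * act c z y).

Section HomSpace.
Variables V W : grep.
Local Notation fT := {ffun gX V * gX W -> R^o}.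

Fact hom_eqs_linear : linear (fun f : fT =>
  ([ffun p : gX V * gX W => (deg p.1 != deg p.2)%:R * f p : R^o],
   [ffun q : Fu * (gX V * gX W) => \sum_z act q.1 q.2.1 z * f (z, q.2.2) -
      \sum_z f (q.2.1, z) * act q.1 z q.2.2 : R^o])).
Proof.
move=> a f g; congr (_, _); apply/ffunP => p; rewrite !ffunE.
  by rewrite mulrDr; congr (_ + _); exact: mulrCA.
rewrite scalerBr addrACA -opprD !scaler_sumr -!big_split.
congr (_ - _); apply: eq_bigr => z _; rewrite !ffunE.
  by rewrite mulrDr; congr (_ + _); exact: mulrCA.
by rewrite mulrDl; congr (_ + _); exact/esym/mulrA.
Qed.

Definition hom_space : {vspace fT} := lker (hom_of hom_eqs_linear).

Lemma hom_spaceP (f : fT) : reflect (is_hom (fun x y => f (x, y))) (f \in hom_space).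
Proof.
rewrite memv_ker hom_ofE; apply: (iffP eqP) => [[/ffunP E1 /ffunP E2]|[E1 E2]].
  split=> [x y xy|c x y].
    by have := E1 (x, y); rewrite !ffunE xy mul1r.
  have := E2 (c, (x, y)); rewrite !ffunE /= => /eqP.
  by rewrite subr_eq0 => /eqP.
congr (_, _); apply/ffunP; [case=> x y | case=> c [x y]]; rewrite !ffunE /=.
  by have [xy|xy] := boolP (_ != _); rewrite ?mul0r // mul1r E1.
by rewrite E2 subrr.
Qed.

End HomSpace.

Definition hom (V W : grep) : vectType R := subvs_of (hom_space V W).
Definition toH V W (f : gX V -> gX W -> R) : hom V W :=
  vsproj (hom_space V W) [ffun p => f p.1 p.2].
Definition cf V W (f : hom V W) x y : R := vsval f (x, y).

Lemma cf_hom V W (f : hom V W) : is_hom (cf f).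
Proof. exact/hom_spaceP/subvsP. Qed.

Lemma toHE V W (f : gX V -> gX W -> R) : is_hom f -> forall x y, cf (toH f) x y = f x y.
Proof.
move=> [f1 f2] x y; rewrite /cf vsprojK ?ffunE //; apply/hom_spaceP.
split=> [x' y' xy|c x' y']; first by rewrite ffunE f1.
under eq_bigr do rewrite ffunE; under [RHS]eq_bigr do rewrite ffunE.
exact: f2.
Qed.

Lemma homP V W (f g : hom V W) : (forall x y, cf f x y = cf g x y) -> f = g.
Proof. by move=> E; apply/val_inj/ffunP => -[x y]; exact: E. Qed.

Lemma cfP V W a (f g : hom V W) x y : cf (a *: f + g) x y = a * cf f x y + cf g x y.
Proof. by rewrite /cf linearP !ffunE. Qed.

Lemma cf0 V W x y : cf (0 : hom V W) x y = 0.
Proof. by rewrite /cf linear0 ffunE. Qed.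

Lemma cfZ V W a (f : hom V W) x y : cf (a *: f) x y = a * cf f x y.
Proof. by rewrite -[a *: f]addr0 cfP cf0 addr0. Qed.

Lemma cf_sum V W (I : Type) (r : seq I) (P : pred I) (f : I -> hom V W) x y :
  cf (\sum_(i <- r | P i) f i) x y = \sum_(i <- r | P i) cf (f i) x y.
Proof. by rewrite /cf linear_sum sum_ffunE. Qed.

Definition gcmp V W Z (g : hom W Z) (f : hom V W) : hom V Z :=
  toH (fun x z => \sum_y cf f x y * cf g y z).

Lemma gcmpE V W Z (g : hom W Z) (f : hom V W) x z :
  cf (gcmp g f) x z = \sum_y cf f x y * cf g y z.
Proof.
have [f1 f2] := cf_hom f; have [g1 g2] := cf_hom g; rewrite toHE //.
split=> [x' z' xz|c x' z'].
  rewrite big1 // => y _; have [xy|xy] := eqVneq (deg x') (deg y).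
    by rewrite g1 ?mulr0 // -xy.
  by rewrite f1 ?mul0r.
under eq_bigr => z0 _ do rewrite mulr_sumr.
rewrite exchange_big; under eq_bigr => y _ do
  (under eq_bigr => z0 _ do rewrite mulrA; rewrite -mulr_suml f2).
under eq_bigr => y _ do rewrite mulr_suml.
rewrite exchange_big; under [RHS]eq_bigr => y _ do rewrite mulr_suml.
rewrite [RHS]exchange_big; apply: eq_bigr => y _ /=.
under eq_bigr => z0 _ do rewrite -mulrA; rewrite -mulr_sumr g2 mulr_sumr.
by apply: eq_bigr => z0 _; rewrite mulrA.
Qed.

Section Mono.
Variables (V W : grep) (phi : gX V -> gX W) (psi : gX W -> gX V) (a : gX V -> R).
Hypotheses (phiK : cancel phi psi) (psiK : cancel psi phi)
  (phi_deg : forall x, deg (phi x) = deg x)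
  (phi_act : forall c x x', act c x x' * a x' = a x * act c (phi x) (phi x')).

Definition mono : hom V W := toH (fun x y => (phi x == y)%:R * a x).

Lemma monoE x y : cf mono x y = (phi x == y)%:R * a x.
Proof.
rewrite toHE //; split=> [x' y' xy|c x' y'].
  have [E|_] := eqVneq (phi x') y'; last by rewrite mul0r.
  by rewrite -E phi_deg eqxx in xy.
rewrite -{1}(psiK y'); under eq_bigr => z _ do rewrite (inj_eq (can_inj phiK)) mulrCA mulrC.
rewrite sum_deltar phi_act psiK.
under [RHS]eq_bigr => z _ do rewrite -mulrA.
by rewrite sum_deltal.
Qed.

End Mono.

Definition gid V : hom V V := mono (fun x => x) (fun=> 1).
Lemma gidE V x y : cf (gid V) x y = (x == y)%:R.
Proof. by rewrite (monoE (psi := id)) ?mulr1 // => c z z'; rewrite mulr1 mul1r. Qed.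

Fact gtob_act1 V W x y :
  act (g := V) 1%g x.1 y.1 * act (g := W) 1%g x.2 y.2 = (x == y)%:R.
Proof. by rewrite !act1 -natrM mulnb. Qed.
Fact gtob_actM V W (c d : Fu) x z : act (g := V) (c * d)%g x.1 z.1 * act (g := W) (c * d)%g x.2 z.2 =
  \sum_y (act c x.1 y.1 * act c x.2 y.2) * (act d y.1 z.1 * act d y.2 z.2).
Proof.
rewrite !actM big_distrlr pair_bigA; apply: eq_bigr => y _ /=.
by rewrite mulrACA.
Qed.
Fact gtob_deg V W (c : Fu) x y : deg (g := V) y.1 + deg (g := W) y.2 != val c * (deg x.1 + deg x.2) ->
  act c x.1 y.1 * act c x.2 y.2 = 0.
Proof.
have [E1|/act_deg->] := eqVneq (deg y.1) (val c * deg x.1); last by rewrite mul0r.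
have [E2|/act_deg->] := eqVneq (deg y.2) (val c * deg x.2); last by rewrite mulr0.
by rewrite E1 E2 mulrDr eqxx.
Qed.
Definition gtob V W : grep := @GRep (gX V * gX W)%type (fun p => deg p.1 + deg p.2)
  (fun c p p' => act c p.1 p'.1 * act c p.2 p'.2)
  (@gtob_act1 V W) (@gtob_actM V W) (@gtob_deg V W).

Definition gtm V V' W W' (f : hom V V') (g : hom W W') : hom (gtob V W) (gtob V' W') :=
  toH (V := gtob V W) (W := gtob V' W') (fun p q => cf f p.1 q.1 * cf g p.2 q.2).

Lemma gtmE V V' W W' (f : hom V V') (g : hom W W') (p : gX (gtob V W)) (q : gX (gtob V' W')) :
  cf (gtm f g) p q = cf f p.1 q.1 * cf g p.2 q.2.
Proof.
have [f1 f2] := cf_hom f; have [g1 g2] := cf_hom g; rewrite toHE //.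
split=> [[x y] [x' y'] /= xy|c [x y] [x' y'] /=].
  have [E1|/f1->] := eqVneq (deg x) (deg x'); last by rewrite mul0r.
  by rewrite g1 ?mulr0 //; apply: contra xy => /eqP->; rewrite E1.
under eq_bigr do rewrite mulrACA; under [RHS]eq_bigr do rewrite mulrACA.
rewrite -(pair_bigA _ (fun z1 z2 => act c x z1 * cf f z1 x' * (act c y z2 * cf g z2 y'))).
rewrite -(pair_bigA _ (fun z1 z2 => cf f x z1 * act c z1 x' * (cf g y z2 * act c z2 y'))) /=.
by rewrite -!big_distrlr /= f2 g2.
Qed.

Fact gone_act1 (x y : unit) : 1 = (x == y)%:R :> R. Proof. by case: x; case: y. Qed.
Fact gone_actM (c d : Fu) (x z : unit) : 1 = \sum_(y : unit) 1 * 1 :> R.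
Proof. by rewrite sum_unit mulr1. Qed.
Fact gone_deg (c : Fu) (x y : unit) : 0 != val c * 0 -> 1 = 0 :> R.
Proof. by rewrite mulr0 eqxx. Qed.
Definition gone : grep := @GRep unit (fun=> 0) (fun _ _ _ => 1) gone_act1 gone_actM gone_deg.

Fact gdl_act1 V (x y : gX V) : act 1^-1%g y x = (x == y)%:R.
Proof. by rewrite invg1 act1 eq_sym. Qed.
Fact gdl_actM V (c d : Fu) (x z : gX V) : act (c * d)^-1%g z x = \sum_y act c^-1%g y x * act d^-1%g z y.
Proof. by rewrite invMg actM; apply: eq_bigr => y _; rewrite mulrC. Qed.
Fact gdl_deg V (c : Fu) (x y : gX V) : - deg y != val c * - deg x -> act c^-1%g y x = 0.
Proof.
move=> xy; apply: act_deg; apply: contra xy => /eqP->.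
by rewrite FinRing.val_unitV mulrN mulVKr // (valP c).
Qed.
Definition gdl V : grep := @GRep (gX V) (fun x => - deg x) (fun c x y => act c^-1%g y x)
  (@gdl_act1 V) (@gdl_actM V) (@gdl_deg V).

Fact gev_hom V : @is_hom (gtob (gdl V) V) gone (fun p _ => (p.1 == p.2)%:R).
Proof.
split=> [[x y] _ /=|c [x y] [] /=].
  by have [->|_] := eqVneq x y; rewrite // addNr eqxx.
rewrite sum_unit mulr1.
transitivity (\sum_(z1 : gX V) \sum_(z2 : gX V)
    act (g := V) c^-1%g z1 x * act (g := V) c y z2 * (z1 == z2)%:R).
  by rewrite pair_bigA; apply: eq_bigr.
rewrite exchange_big; under eq_bigr => z _ do rewrite sum_deltar mulrC.
by rewrite -actM mulgV act1 eq_sym.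
Qed.
Definition gev V : hom (gtob (gdl V) V) gone :=
  toH (V := gtob (gdl V) V) (W := gone) (fun p _ => (p.1 == p.2)%:R).
Lemma gevE V p t : cf (gev V) p t = (p.1 == p.2)%:R.
Proof. by rewrite toHE //; exact: gev_hom. Qed.

Fact gcoev_hom V : @is_hom gone (gtob V (gdl V)) (fun _ p => (p.1 == p.2)%:R).
Proof.
split=> [_ [x y] /=|c [] [x y] /=].
  by have [->|_] := eqVneq x y; rewrite // addrN eqxx.
rewrite sum_unit mul1r.
transitivity (\sum_(z1 : gX V) \sum_(z2 : gX V) (z1 == z2)%:R *
    (act (g := V) c z1 x * act (g := V) c^-1%g y z2)); last first.
  by rewrite pair_bigA; apply: eq_bigr.
under [RHS]eq_bigr => z _ do rewrite sum_deltal mulrC.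
by rewrite -actM mulVg act1 eq_sym.
Qed.
Definition gcoev V : hom gone (gtob V (gdl V)) :=
  toH (V := gone) (W := gtob V (gdl V)) (fun _ p => (p.1 == p.2)%:R).
Lemma gcoevE V t p : cf (gcoev V) t p = (p.1 == p.2)%:R.
Proof. by rewrite toHE //; exact: gcoev_hom. Qed.

(** The associators and unitors merely relabel basis vectors, so coherence axioms become equalities
    of functions on bases through [delta_eq]. *)
Definition is_delta V W (f : hom V W) (phi : gX V -> gX W) : Prop :=
  forall x y, cf f x y = (phi x == y)%:R.

Lemma mono_delta V W (phi : gX V -> gX W) (psi : gX W -> gX V) :
  cancel phi psi -> cancel psi phi -> (forall x, deg (phi x) = deg x) ->
  (forall c x x', act c x x' = act c (phi x) (phi x')) -> is_delta (mono phi (fun=> 1)) phi.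
Proof.
move=> phiK psiK phi_deg phi_act x y.
by rewrite (monoE phiK psiK) ?mulr1 // => c z z'; rewrite mulr1 mul1r.
Qed.

Lemma gid_delta V : is_delta (gid V) id. Proof. exact: gidE. Qed.

Lemma gcmp_delta V W Z (g : hom W Z) (f : hom V W) phi psi :
  is_delta f phi -> is_delta g psi -> is_delta (gcmp g f) (psi \o phi).
Proof.
move=> fd gd x z; rewrite gcmpE; under eq_bigr => y _ do rewrite fd gd.
by rewrite sum_deltal.
Qed.

Lemma gtm_delta V V' W W' (f : hom V V') (g : hom W W') phi psi :
  is_delta f phi -> is_delta g psi ->
  is_delta (gtm f g) (fun p : gX (gtob V W) => (phi p.1, psi p.2)).
Proof. by move=> fd gd [x y] [x' y']; rewrite gtmE fd gd -natrM mulnb. Qed.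

Lemma delta_eq V W (f g : hom V W) phi psi :
  is_delta f phi -> is_delta g psi -> phi =1 psi -> f = g.
Proof. by move=> fd gd E; apply: homP => x y; rewrite fd gd E. Qed.

Lemma gcmp_deltal V W Z (g : hom W Z) (f : hom V W) phi x z :
  is_delta f phi -> cf (gcmp g f) x z = cf g (phi x) z.
Proof. by move=> fd; rewrite gcmpE; under eq_bigr => y _ do rewrite fd; rewrite sum_deltal. Qed.

Lemma gcmp_deltar V W Z (g : hom W Z) (f : hom V W) phi psi x z :
  is_delta g phi -> cancel phi psi -> cancel psi phi -> cf (gcmp g f) x z = cf f x (psi z).
Proof.
move=> gd phiK psiK; rewrite gcmpE.
under eq_bigr => y _ do rewrite gd (can2_eq phiK psiK).
by rewrite sum_deltar.
Qed.

Definition gaso V W Z : hom (gtob (gtob V W) Z) (gtob V (gtob W Z)) :=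
  mono (V := gtob (gtob V W) Z) (W := gtob V (gtob W Z))
    (fun p => (p.1.1, (p.1.2, p.2))) (fun=> 1).
Definition gasoV V W Z : hom (gtob V (gtob W Z)) (gtob (gtob V W) Z) :=
  mono (V := gtob V (gtob W Z)) (W := gtob (gtob V W) Z)
    (fun p => ((p.1, p.2.1), p.2.2)) (fun=> 1).
Definition glu V : hom (gtob gone V) V := mono (V := gtob gone V) (W := V) (fun p => p.2) (fun=> 1).
Definition gluV V : hom V (gtob gone V) := mono (V := V) (W := gtob gone V) (fun x => (tt, x)) (fun=> 1).
Definition gru V : hom (gtob V gone) V := mono (V := gtob V gone) (W := V) (fun p => p.1) (fun=> 1).
Definition gruV V : hom V (gtob V gone) := mono (V := V) (W := gtob V gone) (fun x => (x, tt)) (fun=> 1).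

Lemma gaso_delta V W Z : is_delta (gaso V W Z) (fun p => (p.1.1, (p.1.2, p.2))).
Proof.
apply: (@mono_delta (gtob (gtob V W) Z) (gtob V (gtob W Z)) _
  (fun p => ((p.1, p.2.1), p.2.2))) => [[[x y] z]|[x [y z]]|x|c x x'] //=.
  by rewrite addrA.
by rewrite mulrA.
Qed.
Lemma gasoV_delta V W Z : is_delta (gasoV V W Z) (fun p => ((p.1, p.2.1), p.2.2)).
Proof.
apply: (@mono_delta (gtob V (gtob W Z)) (gtob (gtob V W) Z) _
  (fun p => (p.1.1, (p.1.2, p.2)))) => [[x [y z]]|[[x y] z]|x|c x x'] //=.
  by rewrite addrA.
by rewrite mulrA.
Qed.
Lemma glu_delta V : is_delta (glu V) (fun p => p.2).
Proof.
apply: (@mono_delta (gtob gone V) (V) _ (fun x => (tt, x))) => [[[] x]|x|x|c x x'] //=.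
  by rewrite add0r.
by rewrite mul1r.
Qed.
Lemma gluV_delta V : is_delta (gluV V) (fun x => (tt, x)).
Proof.
apply: (@mono_delta (V) (gtob gone V) _ (fun p => p.2)) => [x|[[] x]|x|c x x'] //=.
  by rewrite add0r.
by rewrite mul1r.
Qed.
Lemma gru_delta V : is_delta (gru V) (fun p => p.1).
Proof.
apply: (@mono_delta (gtob V gone) (V) _ (fun x => (x, tt))) => [[x []]|x|x|c x x'] //=.
  by rewrite addr0.
by rewrite mulr1.
Qed.
Lemma gruV_delta V : is_delta (gruV V) (fun x => (x, tt)).
Proof.
apply: (@mono_delta (V) (gtob V gone) _ (fun p => p.1)) => [x|[x []]|x|c x x'] //=.
  by rewrite addr0.
by rewrite mulr1.
Qed.

Arguments gid_delta : clear implicits.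
Arguments gaso_delta : clear implicits.
Arguments gasoV_delta : clear implicits.
Arguments glu_delta : clear implicits.
Arguments gluV_delta : clear implicits.
Arguments gru_delta : clear implicits.
Arguments gruV_delta : clear implicits.

Definition gcat : catData R :=
  @CatData R grep hom gid (fun V W Z g f => gcmp g f) gtob (fun V V' W W' f g => gtm f g) gone
    gaso gasoV glu gluV gru gruV gdl gev gcoev.

Lemma gcat_category : is_category gcat.
Proof.
split=> [V W f|V W f|Y V W Z f g h] /=; apply: homP => x y.
- by rewrite (gcmp_deltal _ _ _ (gid_delta V)).
- by rewrite (gcmp_deltar (psi := id) _ _ _ (gid_delta W)).
- rewrite !gcmpE; under eq_bigr => z _ do rewrite gcmpE mulr_suml.
  rewrite exchange_big; apply: eq_bigr => z _ /=; rewrite gcmpE mulr_sumr.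
  by apply: eq_bigr => t _; rewrite mulrA.
Qed.

Lemma gcat_bilinear : cmp_bilinear gcat.
Proof.
split=> [V W Z a g g' f|V W Z a g f f'] /=; apply: homP => x y;
  rewrite cfP !gcmpE mulr_sumr -big_split; apply: eq_bigr => z _ /=; rewrite cfP.
  by rewrite mulrDr mulrCA.
by rewrite mulrDl mulrA.
Qed.

Lemma gcat_tensor : tensor_bifunctor gcat.
Proof.
split=> [V W|V V' V'' W W' W'' f f' g g'|V V' W W' a f f' g|V V' W W' a f g g'] /=.
- apply: (delta_eq (gtm_delta (gid_delta V) (gid_delta W)) (gid_delta _)).
  by case.
- apply: (@homP (gtob V W) (gtob V'' W'')) => p q; rewrite gtmE !gcmpE big_distrlr pair_bigA /=.
  by apply: eq_bigr => y _; rewrite !gtmE mulrACA.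
- by apply: (@homP (gtob V W) (gtob V' W')) => p q; rewrite cfP !gtmE cfP mulrDl mulrA.
- by apply: (@homP (gtob V W) (gtob V' W')) => p q; rewrite cfP !gtmE cfP mulrDr mulrCA.
Qed.

Lemma gcat_assoc : associator_ok gcat.
Proof.
split=> [V W Z|V W Z|V V' W W' Z Z' f g h|Y V W Z] /=.
- by apply: (delta_eq (gcmp_delta (gasoV_delta V W Z) (gaso_delta V W Z)) (gid_delta _)) => -[x [y z]].
- by apply: (delta_eq (gcmp_delta (gaso_delta V W Z) (gasoV_delta V W Z)) (gid_delta _)) => -[[x y] z].
- apply: (@homP (gtob (gtob V W) Z) (gtob V' (gtob W' Z'))) => p q.
  rewrite (gcmp_deltal _ _ _ (gaso_delta V W Z)).
  rewrite (@gcmp_deltar _ (gtob (gtob V' W') Z') (gtob V' (gtob W' Z')) _ _ _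
    (fun q => ((q.1, q.2.1), q.2.2)) _ _ (gaso_delta V' W' Z')).
  + by rewrite !gtmE /= mulrA.
  + by case=> -[].
  + by case=> ? [].
- apply: (delta_eq (gcmp_delta (gaso_delta (gtob Y V) W Z) (gaso_delta Y V (gtob W Z)))).
    exact: (gcmp_delta (gcmp_delta (gtm_delta (gaso_delta Y V W) (gid_delta Z))
      (gaso_delta Y (gtob V W) Z)) (gtm_delta (gid_delta Y) (gaso_delta V W Z))).
  by [].
Qed.

Lemma gcat_unit : unitors_ok gcat.
Proof.
split=> [V|V|V V' f|V V' f|V W] /=.
- split; first exact: (delta_eq (gcmp_delta (gluV_delta V) (glu_delta V)) (gid_delta _)).
  by apply: (delta_eq (gcmp_delta (glu_delta V) (gluV_delta V)) (gid_delta _)) => -[[] x].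
- split; first exact: (delta_eq (gcmp_delta (gruV_delta V) (gru_delta V)) (gid_delta _)).
  by apply: (delta_eq (gcmp_delta (gru_delta V) (gruV_delta V)) (gid_delta _)) => -[x []].
- apply: (@homP (gtob gone V) V') => -[[] x] y; rewrite (gcmp_deltal _ _ _ (glu_delta V)).
  rewrite (@gcmp_deltar _ (gtob gone V') V' _ _ _ (fun x => (tt, x)) _ _ (glu_delta V')) //;
    last by case=> -[].
  by rewrite gtmE gidE mul1r.
- apply: (@homP (gtob V gone) V') => -[x []] y; rewrite (gcmp_deltal _ _ _ (gru_delta V)).
  rewrite (@gcmp_deltar _ (gtob V' gone) V' _ _ _ (fun x => (x, tt)) _ _ (gru_delta V')) //;
    last by case=> ? [].
  by rewrite gtmE gidE mulr1.
- apply: (delta_eq (gcmp_delta (gaso_delta V gone W) (gtm_delta (gid_delta V) (glu_delta W)))).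
    exact: (gtm_delta (gru_delta V) (gid_delta W)).
  by [].
Qed.

Lemma gcat_rigid : rigid gcat.
Proof.
move=> V /=; split.
- apply: (@homP V V) => x y; rewrite gidE.
  rewrite (@gcmp_deltar _ (gtob V gone) V _ _ _ (fun x => (x, tt)) _ _ (gru_delta V)) //;
    last by case=> ? [].
  rewrite gcmpE -[RHS](sum_deltal ((x, (x, x)) : gX (gtob V (gtob (gdl V) V))) (fun=> _)).
  apply: eq_bigr => q _.
  rewrite (@gcmp_deltar _ (gtob (gtob V (gdl V)) V) (gtob V (gtob (gdl V) V)) _ _ _
      (fun q => ((q.1, q.2.1), q.2.2)) _ _ (gaso_delta V (gdl V) V));
    [|by case=> -[]|by case=> ? []].
  rewrite (gcmp_deltal _ _ _ (gluV_delta V)) !gtmE gcoevE !gidE gevE /=.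
  case: q => a [b c] /=; rewrite -!natrM !mulnb; congr (nat_of_bool _)%:R; apply/idP/idP.
    by case/andP => /andP[/eqP? /eqP?] /andP[/eqP? /eqP?]; subst; rewrite !eqxx.
  by case/andP => /eqP[? ? ?] /eqP?; subst; rewrite !eqxx.
- apply: (@homP (gdl V) (gdl V)) => x y; rewrite gidE.
  rewrite (@gcmp_deltar _ (gtob gone (gdl V)) (gdl V) _ _ _ (fun x => (tt, x)) _ _ (glu_delta _)) //;
    last by case=> -[].
  rewrite gcmpE -[RHS](sum_deltal (((x, x), x) : gX (gtob (gtob (gdl V) V) (gdl V))) (fun=> _)).
  apply: eq_bigr => q _.
  rewrite (@gcmp_deltar _ (gtob (gdl V) (gtob V (gdl V))) (gtob (gtob (gdl V) V) (gdl V)) _ _ _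
      (fun q => (q.1.1, (q.1.2, q.2))) _ _ (gasoV_delta (gdl V) V (gdl V)));
    [|by case=> ? []|by case=> -[]].
  rewrite (gcmp_deltal _ _ _ (gruV_delta _)) !gtmE gcoevE !gidE gevE /=.
  case: q => [[a b] c] /=; rewrite -!natrM !mulnb; congr (nat_of_bool _)%:R; apply/idP/idP.
    by case/andP => /andP[/eqP? /eqP?] /andP[/eqP? /eqP?]; subst; rewrite !eqxx.
  by case/andP => /eqP[? ? ?] /eqP?; subst; rewrite !eqxx.
Qed.

Lemma iso_mono (V W : grep) (phi : gX V -> gX W) (psi : gX W -> gX V) (a : gX V -> R) :
  cancel phi psi -> cancel psi phi -> (forall x, a x != 0) ->
  (forall x, deg (phi x) = deg x) ->
  (forall c x x', act c x x' * a x' = a x * act c (phi x) (phi x')) -> @iso R gcat V W.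
Proof.
move=> phiK psiK a0 phi_deg phi_act.
have psi_deg y : deg (psi y) = deg y by rewrite -phi_deg psiK.
have psi_act c y y' : act c y y' * (a (psi y'))^-1 = (a (psi y))^-1 * act c (psi y) (psi y').
  have := phi_act c (psi y) (psi y'); rewrite !psiK => E.
  by apply: (mulfI (a0 (psi y))); rewrite mulrA mulVKf // -E mulfK.
exists (mono phi a), (mono psi (fun y => (a (psi y))^-1)); split; apply: homP => x y; rewrite gcmpE gidE.
  under eq_bigr => z _ do rewrite (monoE psiK phiK psi_deg psi_act) (monoE phiK psiK phi_deg phi_act) -mulrA.
  by rewrite sum_deltal psiK mulrCA mulVf ?mulr1.
under eq_bigr => z _ do rewrite (monoE psiK phiK psi_deg psi_act) (monoE phiK psiK phi_deg phi_act) -mulrA.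
by rewrite sum_deltal phiK mulrCA mulfV ?mulr1.
Qed.

(** * Simple objects, semisimplicity and fusion rules *)

Section Simples.
Variables (gT : finGroupType) (chi : gT -> Fu -> R).
Local Notation n := (#|[set: Fu]|%:R : R).
Hypotheses (chi1l : forall c, chi 1%g c = 1) (chi1r : forall g, chi g 1%g = 1)
  (chiMl : forall g h c, chi (g * h)%g c = chi g c * chi h c)
  (chiMr : forall g c d, chi g (c * d)%g = chi g c * chi g d)
  (orthl : forall g, \sum_c chi g c = (g == 1%g)%:R * n)
  (orthr : forall c, \sum_g chi g c = (c == 1%g)%:R * n) (n_neq0 : n != 0).

Lemma chiVr g c : chi g c^-1%g = (chi g c)^-1.
Proof.
have : chi g c * chi g c^-1%g = 1 by rewrite -chiMr mulgV.
have [->|c0 E] := eqVneq (chi g c) 0; first by rewrite mul0r => /esym/eqP; rewrite oner_eq0.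
by apply: (mulfI c0); rewrite mulfV.
Qed.

Lemma chi_neq0 g c : chi g c != 0.
Proof.
apply/eqP => c0; have : chi g c * chi g c^-1%g = 1 by rewrite -chiMr mulgV.
by rewrite c0 mul0r => /esym/eqP; rewrite oner_eq0.
Qed.

Lemma Fu_mulC (c d : Fu) : (c * d = d * c)%g.
Proof. by apply: val_inj; rewrite !FinRing.val_unitM mulrC. Qed.

Lemma Fu_neq0 (c : Fu) : val c != 0.
Proof. by rewrite -unitfE (valP c). Qed.

Fact gchar_act1 g (x y : unit) : chi g 1%g = (x == y)%:R.
Proof. by rewrite chi1r; case: x; case: y. Qed.
Fact gchar_actM g (c d : Fu) (x z : unit) : chi g (c * d)%g = \sum_(y : unit) chi g c * chi g d.
Proof. by rewrite sum_unit chiMr. Qed.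
Fact gchar_deg g (c : Fu) (x y : unit) : 0 != val c * 0 -> chi g c = 0.
Proof. by rewrite mulr0 eqxx. Qed.
Definition gchar g : grep := @GRep unit (fun=> 0) (fun c _ _ => chi g c)
  (gchar_act1 g) (@gchar_actM g) (@gchar_deg g).

Fact greg_act1 (u v : Fu) : (1 * u == v)%g%:R = (u == v)%:R :> R.
Proof. by rewrite mul1g. Qed.
Fact greg_actM (c d : Fu) (u w : Fu) :
  (c * d * u == w)%g%:R = \sum_v (c * u == v)%g%:R * (d * v == w)%g%:R :> R.
Proof. by rewrite sum_deltal mulgA [(c * d)%g]Fu_mulC. Qed.
Fact greg_deg (c u v : Fu) : val v != val c * val u -> (c * u == v)%g%:R = 0 :> R.
Proof. by rewrite -FinRing.val_unitM (inj_eq val_inj) eq_sym => /negPf->. Qed.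
Definition greg : grep := @GRep Fu val (fun c u v => (c * u == v)%g%:R)
  greg_act1 greg_actM greg_deg.

Definition gsimple (i : option gT) : grep := if i is Some g then gchar g else greg.

Lemma gid_neq0 V (x : gX V) : gid V != 0.
Proof.
apply/eqP => E; have := @cf0 V V x x; rewrite -E gidE eqxx => /eqP.
by rewrite oner_eq0.
Qed.

Lemma dim_hom1 V (x : gX V) : (forall f : hom V V, exists a, f = a *: gid V) ->
  \dim {: hom V V} = 1%N.
Proof.
move=> H; suff <- : <[gid V]>%VS = fullv by rewrite dim_vline (gid_neq0 x).
apply/eqP; rewrite eqEsubv subvf; apply/subvP => f _; apply/vlineP; exact: H.
Qed.

Lemma dim_hom0 V W : (forall f : hom V W, f = 0) -> \dim {: hom V W} = 0%N.
Proof.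
move=> H; apply/eqP; rewrite dimv_eq0 -subv0; apply/subvP => f _.
by rewrite (H f) mem0v.
Qed.

Lemma gsimple_end i : \dim {: hom (gsimple i) (gsimple i)} = 1%N.
Proof.
case: i => [g|] /=.
  apply: (@dim_hom1 (gchar g) tt) => f; exists (cf f tt tt); apply: homP => -[] [].
  by rewrite cfZ gidE mulr1.
apply: (@dim_hom1 greg 1%g) => f; have [f1 f2] := cf_hom f.
exists (cf f 1%g 1%g); apply: homP => u v; rewrite cfZ gidE.
have [<-|uv] := eqVneq u v; last by rewrite mulr0 f1 //= (inj_eq val_inj).
have := f2 u 1%g u; rewrite /= sum_deltal mulg1 => ->.
under eq_bigr => z _ do rewrite -{2}[u]mulg1 (inj_eq (mulgI u)).
by rewrite sum_deltar mulr1.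
Qed.

Lemma gsimple_hom i j : i != j -> \dim {: hom (gsimple i) (gsimple j)} = 0%N.
Proof.
move=> ij; apply: dim_hom0 => f; have [f1 f2] := cf_hom f; apply: homP => x y; rewrite cf0.
case: i j ij f f1 f2 x y => [g|] [h|] //= ij f f1 f2.
- case=> -[]; have /existsP[c cgh] : [exists c, chi g c != chi h c].
    rewrite -negb_forall; apply: contra ij => /forallP E.
    apply/eqP; congr Some; apply: (mulgI h^-1%g); rewrite mulVg.
    have := orthl (h^-1 * g)%g.
    rewrite (eq_bigr (fun=> 1)) => [|c _]; last first.
      by rewrite chiMl (eqP (E c)) -chiMl mulVg chi1l.
    rewrite sumr_const -cardsT; case: eqP => // _ /eqP.
    by rewrite mul0r (negPf n_neq0).
  have /eqP := f2 c tt tt; rewrite /= !sum_unit mulrC -subr_eq0 -mulrBr mulf_eq0 subr_eq0.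
  by rewrite (negPf cgh) orbF => /eqP.
- by move=> x u; apply: f1 => /=; rewrite eq_sym Fu_neq0.
- by move=> u x; apply: f1 => /=; rewrite Fu_neq0.
Qed.

Lemma gunit_obj : @iso R gcat gone (gchar 1%g).
Proof.
apply: (@iso_mono gone (gchar 1%g) id id (fun=> 1)) => //= [x|c x x'].
  exact: oner_neq0.
by rewrite chi1l.
Qed.

Lemma gfus_gg g h : @iso R gcat (gtob (gchar g) (gchar h)) (gchar (g * h)%g).
Proof.
apply: (@iso_mono (gtob (gchar g) (gchar h)) (gchar (g * h)%g) (fun=> tt) (fun=> (tt, tt)) (fun=> 1)) => //=.
- by case=> -[] [].
- by case.
- by move=> x; exact: oner_neq0.
- by move=> x; rewrite addr0.
- by move=> c x x'; rewrite mulr1 mul1r chiMl.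
Qed.

(** The regular representation absorbs a character once the basis vector [u] is rescaled by
    [(chi g u)^-1]. *)
Lemma gfus_gm g : @iso R gcat (gtob (gchar g) greg) greg.
Proof.
apply: (@iso_mono (gtob (gchar g) greg) greg (fun p => p.2) (fun u => (tt, u))
  (fun p => (chi g p.2)^-1)) => //=.
- by case=> -[].
- by move=> x; rewrite invr_neq0 ?chi_neq0.
- by move=> x; rewrite add0r.
- move=> c [[] u] [[] v] /=; have [<-|] := eqVneq (c * u)%g v; last by rewrite !(mulr0, mul0r).
  by rewrite !mulr1 chiMr invfM mulVKf ?chi_neq0.
Qed.

Lemma gfus_mg g : @iso R gcat (gtob greg (gchar g)) greg.
Proof.
apply: (@iso_mono (gtob greg (gchar g)) greg (fun p => p.1) (fun u => (u, tt))
  (fun p => (chi g p.1)^-1)) => //=.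
- by case=> u [].
- by move=> x; rewrite invr_neq0 ?chi_neq0.
- by move=> x; rewrite addr0.
- move=> c [u []] [v []] /=; have [<-|] := eqVneq (c * u)%g v; last by rewrite !(mulr0, mul0r).
  by rewrite !(mul1r, mulr1) chiMr invfM mulVKf ?chi_neq0.
Qed.

(** The averaging projector onto the [chi g] component, cut down to degree 0. *)
Definition isotypic V g (x y : gX V) : R :=
  (deg x == 0)%:R * (n^-1 * \sum_c chi g c^-1%g * act c x y).

Lemma isotypic_degr V g (x y : gX V) : deg y != 0 -> isotypic g x y = 0.
Proof.
move=> y0; rewrite /isotypic; have [x0|] := eqVneq (deg x) 0; last by rewrite mul0r.
rewrite big1 ?mulr0 // => c _; rewrite act_deg ?mulr0 //.
by rewrite x0 mulr0.
Qed.

Lemma isotypic_actr V g d (x z : gX V) :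
  \sum_y isotypic g x y * act d y z = chi g d * isotypic g x z.
Proof.
under eq_bigr => y _ do rewrite -!mulrA mulr_suml.
rewrite -!mulr_sumr [RHS]mulrCA [chi g d * _]mulrCA; congr (_ * (_ * _)).
rewrite exchange_big mulr_sumr (reindex_inj (mulIg d^-1%g)); apply: eq_bigr => c _ /=.
under eq_bigr => y _ do rewrite -mulrA.
rewrite -mulr_sumr -actM mulgKV invMg invgK chiMr.
by rewrite mulrA.
Qed.

Lemma isotypic_actl V g d (x z : gX V) :
  \sum_y act d x y * isotypic g y z = chi g d * isotypic g x z.
Proof.
rewrite -isotypic_actr /isotypic.
transitivity ((deg x == 0)%:R * (n^-1 * \sum_c chi g c^-1%g * act (d * c)%g x z)).
  rewrite (eq_bigr (fun y => (deg x == 0)%:R * (act d x y *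
      (n^-1 * \sum_c chi g c^-1%g * act c y z)))) => [|y _].
    rewrite -mulr_sumr; congr (_ * _); under eq_bigr => y _ do rewrite mulrCA mulr_sumr.
    rewrite -mulr_sumr exchange_big; congr (_ * _); apply: eq_bigr => c _ /=.
    by rewrite actM mulr_sumr; apply: eq_bigr => y _; rewrite mulrCA.
  have [dy|dy] := eqVneq (deg y) (val d * deg x); last by rewrite act_deg // !mul0r mulr0.
  by rewrite mulrCA dy mulf_eq0 (negPf (Fu_neq0 d)).
under [RHS]eq_bigr => y _ do rewrite -!mulrA mulr_suml.
rewrite -!mulr_sumr; congr (_ * (_ * _)).
rewrite exchange_big; apply: eq_bigr => c _ /=.
rewrite Fu_mulC actM mulr_sumr; apply: eq_bigr => y _.
by rewrite mulrA.
Qed.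

Lemma isotypic_mul V g h (x z : gX V) :
  \sum_y isotypic g x y * isotypic h y z = (g == h)%:R * isotypic g x z.
Proof.
have E y : isotypic g x y * isotypic h y z =
    n^-1 * \sum_c chi h c^-1%g * (isotypic g x y * act c y z).
  have [y0|y0] := eqVneq (deg y) 0; last first.
    rewrite isotypic_degr // mul0r big1 ?mulr0 // => c _.
    by rewrite mul0r mulr0.
  rewrite {2}/isotypic y0 eqxx mul1r mulrCA mulr_sumr; congr (_ * _).
  by apply: eq_bigr => c _; rewrite mulrCA.
under eq_bigr => y _ do rewrite E.
rewrite -mulr_sumr exchange_big.
under eq_bigr => c _ do rewrite -mulr_sumr isotypic_actr mulrA.
rewrite -mulr_suml mulrA; congr (_ * _).
rewrite (eq_bigr (fun c => chi (h^-1 * g)%g c)) => [|c _]; last first.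
  rewrite chiMl; congr (_ * _); apply: (mulfI (chi_neq0 h c)).
  by rewrite -chiMr mulgV chi1r -chiMl mulgV chi1l.
rewrite orthl mulrCA mulVf // mulr1; congr (nat_of_bool _)%:R.
by rewrite -eq_mulVg1 eq_sym.
Qed.

Lemma isotypic_sum V (x y : gX V) :
  \sum_g isotypic g x y = (deg x == 0)%:R * (x == y)%:R.
Proof.
rewrite -!mulr_sumr exchange_big; congr (_ * _) => /=.
under eq_bigr => c _ do rewrite -mulr_suml orthr.
rewrite (bigD1 1%g) //= big1 => [|c c1]; last by rewrite invg_eq1 (negPf c1) !mul0r.
by rewrite invg1 eqxx mul1r addr0 act1 mulrA mulVf // mul1r.
Qed.

Section Decomposition.
Variables (V : grep) (r : gT -> nat) (A : forall g, gX V -> 'I_(r g) -> R)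
  (B : forall g, 'I_(r g) -> gX V -> R).
Hypotheses (AB : forall g x y, \sum_(j < r g) A x j * B j y = isotypic g x y)
  (BA : forall g (j j' : 'I_(r g)), \sum_x B j x * A x j' = (j == j')%:R).

Let AE g x (j : 'I_(r g)) : A x j = \sum_y isotypic g x y * A y j.
Proof.
under eq_bigr => y _ do rewrite -AB mulr_suml.
rewrite exchange_big; under eq_bigr => j' _ do
  (under eq_bigr => y _ do rewrite -mulrA; rewrite -mulr_sumr BA).
by rewrite sum_deltar.
Qed.

Let BE g (j : 'I_(r g)) y : B j y = \sum_x B j x * isotypic g x y.
Proof.
under eq_bigr => x _ do rewrite -AB mulr_sumr.
rewrite exchange_big; under eq_bigr => j' _ do
  (under eq_bigr => x _ do rewrite mulrA; rewrite -mulr_suml BA).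
by rewrite sum_deltal.
Qed.

Let A_deg g x (j : 'I_(r g)) : deg x != 0 -> A x j = 0.
Proof. by move=> x0; rewrite AE big1 // => y _; rewrite /isotypic (negPf x0) !mul0r. Qed.

Let B_deg g (j : 'I_(r g)) x : deg x != 0 -> B j x = 0.
Proof. by move=> x0; rewrite BE big1 // => y _; rewrite isotypic_degr // mulr0. Qed.

Let BA0 g h (j : 'I_(r g)) (j' : 'I_(r h)) : g != h -> \sum_x B j x * A x j' = 0.
Proof.
move=> gh; under eq_bigr => x _ do rewrite BE AE big_distrlr.
under eq_bigr => x _ do rewrite exchange_big.
rewrite exchange_big big1 // => z _; rewrite exchange_big big1 // => y _ /=.
rewrite (eq_bigr (fun x => B j y * A z j' * (isotypic g y x * isotypic h x z))) => [|x _].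
  by rewrite -mulr_sumr isotypic_mul (negPf gh) mul0r mulr0.
by rewrite [isotypic h x z * _]mulrC mulrACA.
Qed.

Let J := ({g : gT & 'I_(r g)} + {x : gX V | deg x == 1})%type.
Definition dec_simple (j : J) : option gT := if j is inl gj then Some (tag gj) else None.

Lemma inj_char_hom g (j : 'I_(r g)) : @is_hom (gchar g) V (fun _ y => B j y).
Proof.
split=> [x y /= y0|c x y /=]; first by rewrite B_deg // eq_sym.
rewrite sum_unit BE mulr_sumr.
under [RHS]eq_bigr => z _ do rewrite BE mulr_suml.
rewrite exchange_big; apply: eq_bigr => z _ /=.
by under [RHS]eq_bigr => t _ do rewrite -mulrA; rewrite -mulr_sumr isotypic_actr mulrCA.
Qed.

Lemma proj_char_hom g (j : 'I_(r g)) : @is_hom V (gchar g) (fun x _ => A x j).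
Proof.
split=> [x y /= x0|c x y /=]; first by rewrite A_deg.
rewrite sum_unit; under eq_bigr => z _ do rewrite AE mulr_sumr.
rewrite exchange_big [A x j]AE mulr_suml; apply: eq_bigr => z _ /=.
under eq_bigr => t _ do rewrite mulrA.
by rewrite -mulr_suml isotypic_actl [RHS]mulrC; apply/esym/mulrA.
Qed.

Lemma inj_reg_hom (x0 : gX V) : deg x0 = 1 -> @is_hom greg V (fun u y => act u x0 y).
Proof.
move=> x01; split=> [u y /= uy|c u y /=].
  by rewrite act_deg // x01 mulr1 eq_sym.
by rewrite sum_deltal Fu_mulC actM.
Qed.

Lemma proj_reg_hom (x0 : gX V) : deg x0 = 1 -> @is_hom V greg (fun y u => act u^-1%g y x0).
Proof.
move=> x01; split=> [y u /= uy|c y u /=].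
  rewrite act_deg // x01; apply: contra uy => /eqP E.
  by rewrite -[val u]mulr1 E FinRing.val_unitV mulVKr ?(valP u).
rewrite -actM; under [RHS]eq_bigr => z _ do
  rewrite -[u in (c * z)%g == u](mulKVg c) (inj_eq (mulgI c)).
by rewrite sum_deltar invMg invgK Fu_mulC.
Qed.

Definition dec_inj (j : J) : hom (gsimple (dec_simple j)) V := match j with
  | inl gj => toH (V := gchar (tag gj)) (fun _ y => B (tagged gj) y)
  | inr x => toH (V := greg) (fun u y => act u (val x) y) end.
Definition dec_proj (j : J) : hom V (gsimple (dec_simple j)) := match j with
  | inl gj => toH (W := gchar (tag gj)) (fun x _ => A x (tagged gj))
  | inr x => toH (W := greg) (fun y u => act u^-1%g y (val x)) end.

(** In degree 0, [A] and [B] split the isotypic projectors into lines. In nonzero degrees, permuted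
    simply transitively by the units, every basis vector of degree 1 generates a copy of [greg]. *)
Lemma decomposition :
  [/\ forall j, gcmp (dec_proj j) (dec_inj j) = gid _,
      forall j j', j != j' -> gcmp (dec_proj j) (dec_inj j') = 0
    & \sum_j gcmp (dec_inj j) (dec_proj j) = gid V].
Proof.
have H1 (x : {x : gX V | deg x == 1}) : deg (val x) = 1 by exact/eqP/(valP x).
split.
- case=> [[g j]|x]; apply: homP => y z; rewrite gcmpE gidE /=.
    under eq_bigr => t _ do rewrite (toHE (inj_char_hom j)) (toHE (proj_char_hom j)).
    by rewrite BA eqxx; case: y; case: z.
  under eq_bigr => t _ do rewrite (toHE (inj_reg_hom (H1 x))) (toHE (proj_reg_hom (H1 x))).
  rewrite -actM; have [->|yz] := eqVneq y z; first by rewrite mulgV act1 eqxx.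
  rewrite act_deg // !H1 mulr1; apply: contra yz => /eqP E.
  rewrite eq_mulgV1; apply/eqP/val_inj.
  by rewrite -E.
- case=> [[g j]|x] [[h j']|x'] jj; apply: homP => y z; rewrite gcmpE cf0 /=.
  + under eq_bigr => t _ do rewrite (toHE (inj_char_hom j')) (toHE (proj_char_hom j)).
    have [E|gh] := eqVneq h g; last exact: BA0.
    clear y z; move: j' jj; rewrite E => j' jj; rewrite BA.
    by have [jE|//] := eqVneq j' j; rewrite jE eqxx in jj.
  + under eq_bigr => t _ do rewrite (toHE (inj_reg_hom (H1 x'))) (toHE (proj_char_hom j)).
    rewrite big1 // => t _; have [t0|t0] := eqVneq (deg t) 0; last by rewrite A_deg ?mulr0.
    by rewrite act_deg ?mul0r // t0 H1 mulr1 eq_sym Fu_neq0.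
  + under eq_bigr => t _ do rewrite (toHE (inj_char_hom j')) (toHE (proj_reg_hom (H1 x))).
    rewrite big1 // => t _; have [t0|t0] := eqVneq (deg t) 0; last by rewrite B_deg ?mul0r.
    by rewrite act_deg ?mulr0 // t0 H1 mulr0 oner_neq0.
  + under eq_bigr => t _ do rewrite (toHE (inj_reg_hom (H1 x'))) (toHE (proj_reg_hom (H1 x))).
    rewrite -actM; have [E|yz] := eqVneq y z.
      rewrite E mulgV act1 (inj_eq val_inj).
      by have [xE|//] := eqVneq x' x; rewrite xE eqxx in jj.
    rewrite act_deg // !H1 mulr1; apply: contra yz => /eqP E.
    by rewrite eq_mulgV1; apply/eqP/val_inj; rewrite -E.
- apply: homP => x z; rewrite cf_sum gidE big_sumType /=.
  rewrite (eq_bigr (fun p : {g : gT & 'I_(r g)} => A x (tagged p) * B (tagged p) z))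
    => [|[g j] _]; last first.
    by rewrite gcmpE /= sum_unit (toHE (inj_char_hom j)) (toHE (proj_char_hom j)).
  rewrite -(@sig_big_dep R 0 +%R gT (fun g => 'I_(r g)) xpredT (fun=> xpredT)
    (fun g j => A x j * B j z)) (eq_bigr (fun g => isotypic g x z)) => [|g _]; last exact: AB.
  rewrite isotypic_sum.
  rewrite (eq_bigr (fun x0 : {x | deg x == 1} =>
      \sum_u act u^-1%g x (val x0) * act u (val x0) z)) => [|x0 _]; last first.
    rewrite gcmpE /=; apply: eq_bigr => u _.
    by rewrite (toHE (inj_reg_hom (H1 x0))) (toHE (proj_reg_hom (H1 x0))).
  rewrite exchange_big /=.
  (* Moving [x] by [u^-1] and back by [u] passes through degree 1 exactly when [val u = deg x]; the
     sum over basis vectors of degree 1 then gives the identity. *)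
  have E u : \sum_(x0 : {x | deg x == 1}) act u^-1%g x (val x0) * act u (val x0) z =
      (val u == deg x)%:R * (x == z)%:R.
    rewrite -(@big_sub _ _ _ _ [pred x0 | deg x0 == 1] (fun x0 => act u^-1%g x x0 * act u x0 z)) /=.
    have [ux|ux] := eqVneq (val u) (deg x).
      rewrite -act1 -(mulVg u) actM mul1r [RHS](bigID (fun x0 => deg x0 == 1)) /=.
      rewrite [X in _ = _ + X]big1 ?addr0 // => x0 x01.
      rewrite act_deg ?mul0r // -ux; apply: contra x01 => /eqP->.
      by rewrite FinRing.val_unitV mulVr ?eqxx // (valP u).
    rewrite mul0r big1 // => x0 /eqP x01; rewrite act_deg ?mul0r // x01.
    apply: contra ux => /eqP E.
    by rewrite -[val u]mulr1 E FinRing.val_unitV mulVKr ?(valP u).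
  under eq_bigr => u _ do rewrite E.
  rewrite -mulr_suml -mulrDl -[RHS]mul1r; congr (_ * _).
  have [x0|x0] := eqVneq (deg x) 0.
    by rewrite big1 ?addr0 // => u _; rewrite x0 (negPf (Fu_neq0 u)).
  have xu : deg x \is a GRing.unit by rewrite unitfE.
  rewrite (bigD1 (FinRing.unit F xu)) //= eqxx big1 ?add0r ?addr0 // => u ux.
  by rewrite (_ : (_ == _) = false) //; apply: contraNF ux => /eqP E'; apply/eqP/val_inj.
Qed.

End Decomposition.

(** Rank factorisations of the idempotent isotypic matrices supply [A] and [B] for
    [decomposition]. *)
Lemma gsemisimple (V : grep) : exists (N : nat) (o : 'I_N -> option gT),
  @is_dsum R gcat V N (fun j => gsimple (o j)).
Proof.
pose M g : 'M[R]_#|gX V| := \matrix_(i, j) isotypic g (enum_val i) (enum_val j).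
pose r g := \rank (M g).
pose A g x (j : 'I_(r g)) := col_base (M g) (enum_rank x) j.
pose B g (j : 'I_(r g)) x := row_base (M g) j (enum_rank x).
have AB g x y : \sum_(j < r g) A g x j * B g j y = isotypic g x y.
  have := mulmx_base (M g) => /matrixP/(_ (enum_rank x) (enum_rank y)).
  by rewrite !mxE !enum_rankK.
have MM g : M g *m M g = M g.
  apply/matrixP => i j; rewrite !mxE.
  have := isotypic_mul g g (enum_val i) (enum_val j); rewrite eqxx mul1r => <-.
  rewrite (reindex (@enum_rank _)) /=; last exact/onW_bij/enum_rank_bij.
  by apply: eq_bigr => y _; rewrite !mxE enum_rankK.
have BA g (j j' : 'I_(r g)) : \sum_x B g j x * A g x j' = (j == j')%:R.
  have E : row_base (M g) *m col_base (M g) = 1%:M.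
    exact: full_rank_idempotent (col_base_full _) (row_base_free _) (mulmx_base _) (MM g).
  have /matrixP/(_ j j') := E; rewrite !mxE => <-.
  rewrite [RHS](reindex (@enum_rank _)) //; exact/onW_bij/enum_rank_bij.
have [pi1 pi0 ip] := decomposition AB BA.
eexists _, _; apply: (@is_dsum_bij R gcat V _ gsimple _ _ _ _ pi1 pi0 ip _ _ enum_val) => //.
exact: enum_val_bij.
Qed.

Lemma gfus_mm k : #|[set: Fu]| = k.+1 ->
  @is_dsum R gcat (gtob greg greg) _ (fun j => gsimple (@mm_index gT k j)).
Proof.
move=> cardF; pose V := gtob greg greg.
(* Degree 0 of [greg] tensor [greg] has the basis of pairs [(u, -u)], which is a regular
   representation. Each character occurs once, hence the explicit factors of rank 1. *)
pose A (g : gT) (x : gX V) (j : 'I_1) : R := (deg x == 0)%:R * (chi g x.1 / n).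
pose B (g : gT) (j : 'I_1) (x : gX V) : R := (deg x == 0)%:R * (chi g x.1)^-1.
have AB g x y : \sum_(j < 1) A g x j * B g j y = isotypic g x y.
  rewrite big_ord1 /A /B; have [y0|y0] := eqVneq (deg y) 0; last first.
    by rewrite mul0r mulr0 isotypic_degr.
  rewrite /isotypic; have [x0|_] := eqVneq (deg x) 0; last by rewrite !mul0r.
  rewrite !mul1r mulrAC mulrC; congr (_ * _); rewrite (bigD1 (y.1 * x.1^-1)%g) //=.
  rewrite big1 ?addr0 => [|c cyx]; last first.
    suff /negPf-> : (c * x.1 != y.1)%g by rewrite mul0r mulr0.
    by apply: contra cyx => /eqP<-; rewrite mulgK.
  rewrite invMg invgK chiMr chiVr mulgKV eqxx mul1r.
  suff -> : (y.1 * x.1^-1 * x.2 == y.2)%g by rewrite mulr1.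
  apply/eqP/val_inj; rewrite !FinRing.val_unitM FinRing.val_unitV.
  have -> : val x.2 = - val x.1 by apply/eqP; rewrite -addr_eq0 addrC; exact/eqP.
  have -> : val y.2 = - val y.1 by apply/eqP; rewrite -addr_eq0 addrC; exact/eqP.
  by rewrite mulrN mulrVK ?(valP x.1).
have BA g (j j' : 'I_1) : \sum_x B g j x * A g x j' = (j == j')%:R.
  rewrite !ord1 eqxx -(pair_bigA _ (fun u v => B g ord0 (u, v) * A g (u, v) ord0)) /= /A /B /=.
  transitivity (\sum_(u : Fu) n^-1); last first.
    by rewrite sumr_const -cardsT -[LHS]mulr_natl mulfV.
  apply: eq_bigr => u _.
  have uN : - val u \is a GRing.unit by rewrite unitrN (valP u).
  rewrite (bigD1 (FinRing.unit F uN)) //= addrN eqxx big1 => [|v vu].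
    by rewrite !mul1r addr0 mulrA mulVf ?chi_neq0 // mul1r.
  suff /negPf-> : val u + val v != 0 by rewrite !mul0r.
  by apply: contra vu => /eqP uv; apply/eqP/val_inj/eqP; rewrite /= -addr_eq0 addrC uv.
have [pi1 pi0 ip] := decomposition AB BA.
(* In a pair of units with sum 1 the first can be any unit but 1, so there are [q - 2 = k] copies of
   [m]. *)
have card1 : #|{: {x : gX V | deg x == 1}}| = k.
  rewrite card_sig -(card_in_image (f := fst)) => [|[u v] [u' v']]; last first.
    rewrite !inE /= => /eqP uv /eqP uv' uu; congr (_, _) => //; apply: val_inj.
    by apply: (addrI (val u)); rewrite uv uu uv'.
  rewrite -[k]/(k.+1.-1) -cardF cardsT -(cardC1 (1%g : Fu)); apply: eq_card => u.
  rewrite !inE; apply/imageP/idP => [[[u' v]] + ->|u1].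
    rewrite inE /= => /eqP uv; apply/eqP => u1; have := Fu_neq0 v.
    suff -> : val v = 0 by rewrite eqxx.
    by apply: (addrI 1); rewrite addr0 -[RHS]uv u1.
  have vU : 1 - val u \is a GRing.unit.
    by rewrite unitfE subr_eq0 eq_sym; apply: contra u1 => /eqP u1; apply/eqP/val_inj.
  by exists (u, FinRing.unit F vU); rewrite // inE /= addrC subrK.
pose J := ({g : gT & 'I_1} + {x : gX V | deg x == 1})%type.
pose e (i : 'I_#|gT| + 'I_k) : J := match i with
  | inl a => inl (existT (fun g : gT => 'I_1) (enum_val a) ord0)
  | inr b => inr (enum_val (cast_ord (esym card1) b)) end.
pose e' (j : J) : 'I_#|gT| + 'I_k := match j with
  | inl gj => inl (enum_rank (tag gj))
  | inr x => inr (cast_ord card1 (enum_rank x)) end.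
have eK : cancel e e' by case=> a; rewrite /= enum_valK ?cast_ordKV.
have eK' : cancel e' e.
  by case=> [[g j]|x]; rewrite /= ?cast_ordK enum_rankK // !ord1.
apply: (@is_dsum_bij R gcat (gtob greg greg) _ gsimple _ _ _ _ pi1 pi0 ip _ _ (e \o split)).
  exact: bij_comp (Bijective eK eK') (Bijective (@splitK _ _) (@unsplitK _ _)).
move=> i; rewrite /mm_index /=; case: splitP => a ia //.
by rewrite ia /= (enum_val_nth 1%g).
Qed.

End Simples.
End Construction.

(** * A perfect pairing of cyclic groups, and the existence of the category *)

Lemma sum_mult_eq0 (R : fieldType) (gT : finGroupType) (f : gT -> R) (x : gT) :
  (forall y z, f (y * z)%g = f y * f z) -> f x != 1 -> \sum_y f y = 0.
Proof.
move=> fM fx; have E : f x * (\sum_y f y) = \sum_y f y.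
  by rewrite [RHS](reindex_inj (mulgI x)) mulr_sumr; apply: eq_bigr => y _; rewrite fM.
apply/eqP; have /eqP : (f x - 1) * (\sum_y f y) = 0 by rewrite mulrBl mul1r E subrr.
by rewrite mulf_eq0 subr_eq0 (negPf fx).
Qed.

Lemma discrete_log (gT : finGroupType) : cyclic [set: gT] -> exists (x : gT) (lg : gT -> nat),
  [/\ #[x]%g = #|gT|, forall y, y = (x ^+ lg y)%g,
      forall y, (#|gT| %| lg y)%N = (y == 1%g), lg x = 1 %[mod #|gT|]
    & forall y z, lg (y * z)%g = lg y + lg z %[mod #|gT|]].
Proof.
case/cyclicP=> x Gx; have /fin_all_exists[lg lgE] (y : gT) : exists i, y = (x ^+ i)%g.
  by apply/cycleP; rewrite -Gx inE.
have ox : #[x]%g = #|gT| by rewrite -cardsT Gx.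
exists x, lg; split=> // [y||y z].
- by rewrite -ox {2}(lgE y) order_dvdn.
- by apply/eqP; rewrite -ox -eq_expg_mod_order -lgE expg1.
- by apply/eqP; rewrite -ox -eq_expg_mod_order expgD -!lgE.
Qed.

(** The pairing is [z ^+ (log g * log c)] for a primitive root of unity [z] of order the common
    cardinality. A nontrivial multiplicative function has zero sum, and nontriviality is visible at
    a generator. *)
Lemma cyclic_pairing (R : closedFieldType) (gT hT : finGroupType) :
  cyclic [set: gT] -> cyclic [set: hT] -> #|gT| = #|hT| -> #|hT|%:R != 0 :> R ->
  exists chi : gT -> hT -> R,
  [/\ forall g h c, chi (g * h)%g c = chi g c * chi h c,
      forall g c d, chi g (c * d)%g = chi g c * chi g d,
      forall g, \sum_c chi g c = (g == 1%g)%:R * #|hT|%:R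
    & forall c, \sum_g chi g c = (c == 1%g)%:R * #|hT|%:R].
Proof.
move=> /discrete_log[x [lx [_ _ lx1 lxx lxM]]] /discrete_log[y [ly [_ _ ly1 lyy lyM]]] cGH nR.
rewrite cGH in lx1 lxx lxM; have [z z_prim] := closed_prim_root nR.
have zX m i j : i = j %[mod #|hT|] -> z ^+ m ^+ i = z ^+ m ^+ j.
  have zm : z ^+ m ^+ #|hT| = 1 by rewrite exprAC (prim_expr_order z_prim) expr1n.
  by move=> ij; rewrite -(expr_mod i zm) ij expr_mod.
pose chi g c := z ^+ (lx g * ly c).
have chiMl g h c : chi (g * h)%g c = chi g c * chi h c.
  by rewrite /chi mulnC exprM (zX _ _ _ (lxM g h)) exprD -!exprM ![(ly c * _)%N]mulnC.
have chiMr g c d : chi g (c * d)%g = chi g c * chi g d.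
  by rewrite /chi exprM (zX _ _ _ (lyM c d)) exprD -!exprM.
exists chi; split=> // [g|c].
- have [->|g1] := eqVneq g 1%g.
    rewrite mul1r (eq_bigr (fun=> 1)) ?sumr_const // => c _; apply/eqP.
    by rewrite /chi -(prim_order_dvd z_prim) dvdn_mulr // lx1.
  rewrite mul0r; apply: (@sum_mult_eq0 _ _ _ y) => [c d|]; first exact: chiMr.
  by rewrite /chi exprM (zX _ _ _ lyy) expr1 -(prim_order_dvd z_prim) lx1.
- have [->|c1] := eqVneq c 1%g.
    rewrite mul1r -cGH (eq_bigr (fun=> 1)) ?sumr_const // => g _; apply/eqP.
    by rewrite /chi -(prim_order_dvd z_prim) dvdn_mull // ly1.
  rewrite mul0r; apply: (@sum_mult_eq0 _ _ (chi^~ c) x) => [g h|]; first exact: chiMl.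
  by rewrite /chi mulnC exprM (zX _ _ _ lxx) expr1 -(prim_order_dvd z_prim) ly1.
Qed.

Lemma category_of_Fq_star (R : closedFieldType) (gT : finGroupType) (k : nat) :
  #|gT| = k.+1 -> #|gT|%:R != 0 :> R -> is_Fq_star gT ->
  inhabited (NearGroupCategory R gT k).
Proof.
move=> cardG nR [F isoF]; have cFG := esym (card_isog isoF).
have cycF : cyclic [set: {unit F}] by exact: field_unit_group_cyclic.
have cycG : cyclic [set: gT] by rewrite (isog_cyclic isoF).
rewrite !cardsT in cFG.
have [|chi [chiMl chiMr orthl orthr]] := cyclic_pairing cycG cycF (esym cFG) (R := R).
  by rewrite cFG.
rewrite -cardsT in orthl orthr.
have n_neq0 : #|[set: {unit F}]|%:R != 0 :> R by rewrite cardsT cFG.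
have chi_neq0 g c : chi g c != 0.
  apply/eqP => gc0; have := orthl 1%g; rewrite eqxx mul1r.
  rewrite big1 => [/esym/eqP|d _]; first by rewrite (negPf n_neq0).
  by rewrite -[d](mulKVg c) chiMr -(mulVg g) [chi _ c]chiMl gc0 mulr0 mul0r.
have chi1l c : chi 1%g c = 1.
  by apply: (mulfI (chi_neq0 1%g c)); rewrite -chiMl mulg1 mulr1.
have chi1r g : chi g 1%g = 1.
  by apply: (mulfI (chi_neq0 g 1%g)); rewrite -chiMr mulg1 mulr1.
constructor; refine (@NGC R gT k (gcat R F) (@gcat_category R F) (@gcat_bilinear R F) (@gcat_tensor R F)
  (@gcat_assoc R F) (@gcat_unit R F) (@gcat_rigid R F) (@gsimple R F gT chi chi1r chiMr) _ _ _ _ _ _ _ _).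
- exact: gsimple_end.
- exact: gsimple_hom.
- exact: gsemisimple.
- exact: gunit_obj.
- exact: gfus_gg.
- exact: gfus_gm.
- exact: gfus_mg.
- by apply: gfus_mm; rewrite // cardsT cFG.
Qed.

Theorem theorem1p2 (R : closedFieldType) (gT : finGroupType) (k : nat) :
  (1 <= k)%N -> #|gT| = k.+1 ->
  (* standing convention: char R does not divide |G| *)
  (#|gT|)%:R != 0 :> R ->
  [/\ (inhabited (NearGroupCategory R gT k) -> is_Fq_star gT),
      (* existence direction: additionally char R does not divide q(q-1),
         where q - 1 = |G| *)
      ((#|gT|.+1 * #|gT|)%:R != 0 :> R ->
         is_Fq_star gT -> inhabited (NearGroupCategory R gT k))
    & (is_Fq_star gT <->
         cyclic [set: gT] /\
         exists p a : nat, [/\ prime p, (0 < a)%N & #|gT| = (p ^ a).-1])].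
Proof.
move=> k_gt0 cardG nR; split; last exact: Fq_starP.
- by move=> [C]; apply/Fq_starP; exact: cyclic_of_category C.
- by move=> _; exact: category_of_Fq_star.
Qed.
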